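(* Let $n\ge 1$ and let $H_1,H_2$ be any two $n\times n$ Hadamard matrices. Then the Hadamard graphs of order $4n$ constructed from $H_1$ and from $H_2$ are quantum isomorphic.
   Context: A Hadamard matrix is an $n\times n$ matrix $H$ with entries in $\{\pm1\}$ satisfying $HH^\top=nI$. The Hadamard graph of $H$ (of order $4n$) has vertex set $\{r_1^+,r_1^-,\dots,r_n^+,r_n^-,c_1^+,c_1^-,\dots,c_n^+,c_n^-\}$; if $H_{ij}=1$ then $r_i^+\sim c_j^+$ and $r_i^-\sim c_j^-$, and if $H_{ij}=-1$ then $r_i^+\sim c_j^-$ and $r_i^-\sim c_j^+$; there are no other edges. Quantum isomorphism: graphs $G,H$ on $N$ vertices with adjacency matrices $A_G,A_H$ are quantum isomorphic if there exist a unital $C^*$-algebra $\mathcal A$ and an $N\times N$ matrix $\mathcal U=(u_{ij})$ over $\mathcal A$ whose entries are self-adjoint projections ($u_{ij}=u_{ij}^*=u_{ij}^2$) with every row and every column summing to $\mathbf 1$, such that $\mathcal U A_G=A_H\mathcal U$. By a theorem of Mančinska and Roberson, $G$ and $H$ are quantum isomorphic if and only if $\hom(F,G)=\hom(F,H)$ for every planar graph $F$, where $\hom(F,G)$ is the number of graph homomorphisms from $F$ to $G$. *)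

(* Defs.v *)
From HB Require Import structures.
From mathcomp Require Import all_boot all_order all_algebra.
From mathcomp Require Import complex.
From mathcomp Require Import Rstruct.


Set Implicit Arguments.
Unset Strict Implicit.
Unset Printing Implicit Defensive.

Import Order.TTheory GRing.Theory Num.Theory.
Local Open Scope ring_scope.

Definition CC : Type := complex Rdefinitions.R.

Record cstar_algebra := CStarAlgebra {
  cs_alg :> algType CC;
  cs_star : cs_alg -> cs_alg;
  cs_norm : cs_alg -> Rdefinitions.R;
  cs_oner_neq0 : (1 : cs_alg) != 0;
  cs_starK : forall x, cs_star (cs_star x) = x;
  cs_starD : forall x y, cs_star (x + y) = cs_star x + cs_star y;
  cs_starZ : forall (a : CC) x, cs_star (a *: x) = (conjc a) *: cs_star x;
  cs_starM : forall x y, cs_star (x * y) = cs_star y * cs_star x;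
  cs_norm_ge0 : forall x, 0 <= cs_norm x;
  cs_norm_eq0 : forall x, cs_norm x = 0 -> x = 0;
  cs_normD : forall x y, cs_norm (x + y) <= cs_norm x + cs_norm y;
  cs_normZ : forall (a : CC) x, cs_norm (a *: x) = complex.Re `|a| * cs_norm x;
  cs_normM : forall x y, cs_norm (x * y) <= cs_norm x * cs_norm y;
  cs_normC : forall x, cs_norm (cs_star x * x) = cs_norm x ^+ 2;
  cs_complete : forall u : nat -> cs_alg,
    (forall e : Rdefinitions.R, 0 < e -> exists N : nat, forall m n : nat,
        (N <= m)%N -> (N <= n)%N -> cs_norm (u m - u n) < e) ->
    exists l : cs_alg, forall e : Rdefinitions.R, 0 < e ->
      exists N : nat, forall n : nat, (N <= n)%N -> cs_norm (u n - l) < e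
}.

Definition quantum_isomorphic (V : finType) (eG eH : rel V) : Prop :=
  exists (A : cstar_algebra) (u : V -> V -> A),
    [/\ forall x y, cs_star (u x y) = u x y /\ u x y * u x y = u x y,
        forall x, \sum_(y : V) u x y = 1,
        forall y, \sum_(x : V) u x y = 1 &
        forall x y, \sum_(z : V) u x z * ((eG z y : nat)%:R : A)
                  = \sum_(z : V) ((eH x z : nat)%:R : A) * u z y].

Definition is_hadamard (n : nat) (H : 'M[int]_n) : Prop :=
  (forall i j, H i j = 1 \/ H i j = -1) /\ H *m H^T = (n%:R : int)%:M.

(* Vertices of the Hadamard graph: (is_row, (index, is_plus)).
   (true, (i, true)) = r_i^+, (true, (i, false)) = r_i^-,
   (false, (j, true)) = c_j^+, (false, (j, false)) = c_j^-.            *)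
Definition hvertex (n : nat) : finType := (bool * ('I_n * bool))%type.

Definition hadamard_adj (n : nat) (H : 'M[int]_n) : rel (hvertex n) :=
  fun x y =>
    match x, y with
    | (true, (i, s)), (false, (j, t)) => (s == t) == (H i j == 1)
    | (false, (j, t)), (true, (i, s)) => (s == t) == (H i j == 1)
    | _, _ => false
    end.

(* Main.v *)
(**
  A quantum isomorphism amounts to N x N matrices x and y over a C*-algebra with
  self-adjoint entries, mutually orthogonal along rows and columns, whose squares
  sum to 1 along rows and columns ("cubic" matrices), such that x H1 = H2 y: the
  projections are then (x_ik^2 +- x_ik) / 2 on the rows and (y_lj^2 +- y_lj) / 2 on
  the columns.

  Put HH = H2 (x) H1, a Hadamard matrix with rows s = (i,k) and columns p = (l,j).
  For magic unitaries P = (P_s) and Q = (Q_p), set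
  T_st = N^-1 sum_p HH_sp HH_tp Q_p.  If P_s T_st = T_st P_t for all s, t, then
  sum_t e_(0,t.2)(1,t.1) P_s T_st plus its adjoint is a cubic x over 2N x 2N
  matrices; exchanging P and Q and rotating the matrix units e by H1 and H2 gives
  the matching y.

  Such P and Q act on words w in the letters p: Q_p prepends a letter, while the
  transfer matrices M_st, built from the rank-one magic unitary
  n^-1 HH_sp HH_tp HH_sq HH_tq of HH (n = N^2), satisfy an exchange relation with Q
  that gives M_st T_ss' = T_ss' M_s't exactly; then P_s = sum_c M_s(c,c).  The inner
  product is <w,w'> = f(rev w ++ w').  Starting from the character f(w) =
  prod [l = j] one averages f over the M_ss repeatedly: each average is again
  positive and satisfies the magic relations for Q, and on words of a given length
  the averages are powers of a positive contraction, so they converge to an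
  M-invariant f.  Invariance makes the M_st self-adjoint.

  The C*-algebra consists of the sesquilinear forms that are norm limits of
  adjointable operators on finite combinations of words.
*)

Require Import Defs.
From HB Require Import structures.
From mathcomp Require Import all_boot all_order all_algebra.
From mathcomp Require Import boolp classical_sets reals.
From mathcomp Require Import complex Rstruct ring lra.

Set Implicit Arguments.
Unset Strict Implicit.
Unset Printing Implicit Defensive.

Import Order.TTheory GRing.Theory Num.Theory.
Local Open Scope ring_scope.
Local Open Scope complex_scope.

Local Notation R := Rdefinitions.R.
Local Notation C := (complex Rdefinitions.R).
Local Notation Re := complex.Re.
Local Notation Im := complex.Im.
Local Arguments conjc {R} x : simpl never.

(** * Convergence of real and complex sequences *)

(** On words, everything asked of the M_st except self-adjointness is algebraic: idempotence,
    orthogonality along rows and columns and the partition sums hold against any functional f. The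
    missing property is what forces the search for a state with f o M_st = [s = t] f. The starting
    character is evaluation at Q = identity permutation matrix, which exists whatever H1 and H2 are.
    The exchange with T collapses because the coefficient matrix of M in the states s, c is the
    projection onto the vector (HH_sp HH_cp)_p, while T_ss' combines the Q_p along (HH_sp HH_s'p)_p,
    and these vectors are orthogonal for c <> s'. Matrix units enter because x must be self-adjoint
    while the adjoint of P_s T_st is P_t T_ts: placed in an off-diagonal corner and added to its
    adjoint, it becomes self-adjoint, and the products within one corner vanish. Finite combinations
    of words form only a pre-Hilbert space, where a norm limit of operators need not be an operator;
    its sesquilinear form always exists, so no completion of the space is built. *)

Lemma real_cauchy_cvg (u : nat -> R) :
  (forall e, 0 < e -> exists N, forall m n, (N <= m)%N -> (N <= n)%N ->
     `|u m - u n| < e) ->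
  exists l, forall e, 0 < e -> exists N, forall n, (N <= n)%N -> `|u n - l| < e.
Proof.
move=> uC; have [|l ul] := Rcomplete.R_complete u.
  move=> e /RltP e0; have [N uN] := uC e e0.
  exists N => m n /ssrnat.leP Nm /ssrnat.leP Nn; apply/RltP.
  by rewrite /Rfunctions.Rdist RabsE RminusE uN.
exists l => e /RltP e0; have [N uN] := ul e e0; exists N => n /ssrnat.leP Nn.
by apply/RltP; rewrite -RabsE -RminusE; exact: uN.
Qed.

(** Offering [e <= 1] to the caller lets error terms in [e ^+ 2] be absorbed into [e * K]; no sign
    of [K] is assumed, so any error expression can be supplied. *)
Lemma le_of_eps (a b K : R) :
  (forall e, 0 < e -> e <= 1 -> a <= b + e * K) -> a <= b.
Proof.
move=> H; case: (leP a b) => // ab.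
have [K0|K0] := leP K 0.
  have := H 1 ltr01 (lexx _); lra.
pose e := Num.min 1 ((a - b) / (2 * K)).
have e0 : 0 < e by rewrite lt_min ltr01 divr_gt0 //; nra.
have e1 : e <= 1 by rewrite ge_min lexx.
have eK : e * K <= (a - b) / 2.
  have /(ler_wpM2r (ltW K0)) : e <= (a - b) / (2 * K) by rewrite ge_min lexx orbT.
  by move/le_trans; apply; rewrite invfM mulrA mulfVK ?gt_eqF.
have := H e e0 e1; lra.
Qed.

(** The norm [|z|] of [C] is itself a complex number, whereas the estimates are carried out in
    [R]. *)
Definition cabs (z : C) : R := Normc.normc z.

Lemma cabsE z : cabs z = Re `|z|. Proof. by []. Qed.

Lemma cabs_normE (z : C) : `|z| = (cabs z)%:C. Proof. by []. Qed.

Lemma cabs_ge0 z : 0 <= cabs z.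
Proof. by rewrite -lecR -cabs_normE normr_ge0. Qed.

Lemma cabsD z w : cabs (z + w) <= cabs z + cabs w.
Proof. by rewrite -lecR rmorphD /= -!cabs_normE ler_normD. Qed.

Lemma cabsM z w : cabs (z * w) = cabs z * cabs w.
Proof. exact: Normc.normcM. Qed.

Lemma cabsN z : cabs (- z) = cabs z.
Proof. by apply: complexI; rewrite -!cabs_normE normrN. Qed.

Lemma cabsB z w : cabs (z - w) = cabs (w - z).
Proof. by rewrite -cabsN opprB. Qed.

Lemma cabs0 : cabs 0 = 0.
Proof. by apply: complexI; rewrite -cabs_normE normr0. Qed.

Lemma cabs1 : cabs 1 = 1.
Proof. by apply: complexI; rewrite -cabs_normE normr1. Qed.

Lemma cabs_eq0 z : cabs z = 0 -> z = 0.
Proof. exact: Normc.eq0_normc. Qed.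

Lemma cabs_conj z : cabs (conjc z) = cabs z.
Proof. by case: z => a b; rewrite /cabs /= sqrrN. Qed.

Lemma cabs_real (a : R) : 0 <= a -> cabs a%:C = a.
Proof. by move=> a0; apply: complexI; rewrite -cabs_normE ger0_norm // ler0c. Qed.

Lemma cabs_tri z w v : cabs (z - w) <= cabs (z - v) + cabs (v - w).
Proof. by have := cabsD (z - v) (v - w); rewrite addrA subrK. Qed.

Lemma cabs_sqr z : ((cabs z) ^+ 2)%:C = z * conjc z.
Proof.
rewrite rmorphXn /= -cabs_normE -add_Re2_Im2; case: z => a b.
by apply/eqP; rewrite eq_complex /=; apply/andP; split; apply/eqP; ring.
Qed.

Lemma Re_le_cabs z : `|Re z| <= cabs z.
Proof.
case: z => a b; rewrite /cabs /= -sqrtr_sqr ler_wsqrtr //.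
by rewrite lerDl sqr_ge0.
Qed.

Lemma Im_le_cabs z : `|Im z| <= cabs z.
Proof.
case: z => a b; rewrite /cabs /= -sqrtr_sqr ler_wsqrtr //.
by rewrite lerDr sqr_ge0.
Qed.

Lemma cabs_le_ReIm z : cabs z <= `|Re z| + `|Im z|.
Proof.
case: z => a b; rewrite [complex.Re _]/= [complex.Im _]/=.
have -> : a +i* b = a%:C + b *i by apply/eqP; rewrite eq_complex /= addr0 add0r !eqxx.
apply: le_trans (cabsD _ _) _.
by rewrite /cabs /= expr0n /= addr0 add0r !sqrtr_sqr.
Qed.

Definition cconv (z : nat -> C) (l : C) :=
  forall e, 0 < e -> exists N, forall n, (N <= n)%N -> cabs (z n - l) < e.

Lemma complex_cauchy_cvg (z : nat -> C) :
  (forall e, 0 < e -> exists N, forall m n, (N <= m)%N -> (N <= n)%N ->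
     cabs (z m - z n) < e) ->
  exists l, cconv z l.
Proof.
move=> zC.
have [|a za] := @real_cauchy_cvg (fun n => Re (z n)).
  move=> e /zC[N zN]; exists N => m n Nm Nn; apply: le_lt_trans (zN m n Nm Nn).
  by apply: le_trans (Re_le_cabs _); case: (z m) (z n) => ? ? [].
have [|b zb] := @real_cauchy_cvg (fun n => Im (z n)).
  move=> e /zC[N zN]; exists N => m n Nm Nn; apply: le_lt_trans (zN m n Nm Nn).
  by apply: le_trans (Im_le_cabs _); case: (z m) (z n) => ? ? [].
exists (a +i* b) => e e0.
have e20 : 0 < e / 2 by lra.
have [N1 H1] := za _ e20; have [N2 H2] := zb _ e20.
exists (maxn N1 N2) => n; rewrite geq_max => /andP[n1 n2].
apply: le_lt_trans (cabs_le_ReIm _) _.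
have := H1 n n1; have := H2 n n2; case: (z n) => c d /=; lra.
Qed.

Lemma cconv_unique z l l' : cconv z l -> cconv z l' -> l = l'.
Proof.
move=> zl zl'; apply/eqP; rewrite -subr_eq0; apply/eqP/cabs_eq0.
apply/le_anti; rewrite cabs_ge0 andbT; apply: (@le_of_eps _ _ 2) => e e0 _.
have [N1 H1] := zl _ e0; have [N2 H2] := zl' _ e0.
have := H1 _ (leq_maxl N1 N2); have := H2 _ (leq_maxr N1 N2).
have := cabs_tri l l' (z (maxn N1 N2)); rewrite (cabsB l (z _)); lra.
Qed.

Lemma cconvD z w l l' : cconv z l -> cconv w l' -> cconv (fun n => z n + w n) (l + l').
Proof.
move=> zl wl e e0; have e20 : 0 < e / 2 by lra.
have [N1 H1] := zl _ e20; have [N2 H2] := wl _ e20.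
exists (maxn N1 N2) => n; rewrite geq_max => /andP[n1 n2].
have := H1 n n1; have := H2 n n2; have := cabsD (z n - l) (w n - l').
by rewrite opprD addrACA; lra.
Qed.

Lemma cconvZ a z l : cconv z l -> cconv (fun n => a * z n) (a * l).
Proof.
move=> zl e e0; have a0 : 0 < cabs a + 1 by have := cabs_ge0 a; lra.
have [N H] := zl (e / (cabs a + 1)) (divr_gt0 e0 a0).
exists N => n /H zn; rewrite -mulrBr cabsM.
apply: (@le_lt_trans _ _ ((cabs a + 1) * cabs (z n - l))).
  by rewrite ler_wpM2r ?cabs_ge0 // lerDl.
by rewrite mulrC -ltr_pdivlMr.
Qed.

Lemma cconv_sum (I : Type) (r : seq I) (z : I -> nat -> C) (l : I -> C) :
  (forall i, cconv (z i) (l i)) ->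
  cconv (fun n => \sum_(i <- r) z i n) (\sum_(i <- r) l i).
Proof.
move=> zl; elim: r => [|i r IH].
  rewrite big_nil => e e0; exists 0%N => n _; by rewrite big_nil subrr cabs0.
rewrite big_cons => e e0; have [N H] := cconvD (zl i) IH e0.
by exists N => n /H; rewrite big_cons.
Qed.

Lemma cconv_le z l K (w : C) :
  cconv z l -> (forall e, 0 < e -> exists N, forall n, (N <= n)%N -> cabs (w - z n) <= K + e) ->
  cabs (w - l) <= K.
Proof.
move=> zl zK; apply: (@le_of_eps _ _ 2) => e e0 _.
have [N1 H1] := zl _ e0; have [N2 H2] := zK _ e0.
have := H1 _ (leq_maxl N1 N2); have := H2 _ (leq_maxr N1 N2).
have := cabs_tri w l (z (maxn N1 N2)); lra.
Qed.

(** * Operators on the pre-Hilbert space of a positive kernel *)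

Section Vectors.
Variable B : Type.

(* Formal linear combinations: they matter only through the values of forms on
   them, so lists need no quotient. *)
Definition vec := seq (C * B).
Definition ket (b : B) : vec := [:: (1, b)].
Definition sc (a : C) (x : vec) : vec := [seq (a * p.1, p.2) | p <- x].
Definition lin (T : B -> vec) (x : vec) : vec :=
  flatten [seq sc p.1 (T p.2) | p <- x].
Definition ext (t : B -> B -> C) (x y : vec) : C :=
  \sum_(p <- x) \sum_(q <- y) conjc p.1 * q.1 * t p.2 q.2.

Lemma ext_ket t b b' : ext t (ket b) (ket b') = t b b'.
Proof. by rewrite /ext !big_seq1 /= conjc1 !mul1r. Qed.

Lemma extDl t x y z : ext t (x ++ y) z = ext t x z + ext t y z.
Proof. by rewrite /ext big_cat. Qed.

Lemma extDr t x y z : ext t x (y ++ z) = ext t x y + ext t x z.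
Proof. by rewrite /ext -big_split; apply: eq_bigr => p _; rewrite big_cat. Qed.

Lemma extZl t a x z : ext t (sc a x) z = conjc a * ext t x z.
Proof.
rewrite /ext big_map mulr_sumr; apply: eq_bigr => p _; rewrite mulr_sumr.
by apply: eq_bigr => q _ /=; rewrite rmorphM !mulrA.
Qed.

Lemma extZr t a x z : ext t x (sc a z) = a * ext t x z.
Proof.
rewrite /ext mulr_sumr; apply: eq_bigr => p _; rewrite big_map mulr_sumr.
by apply: eq_bigr => q _ /=; rewrite !mulrA [_ * a]mulrC.
Qed.

Lemma ext0l t z : ext t [::] z = 0. Proof. by rewrite /ext big_nil. Qed.
Lemma ext0r t x : ext t x [::] = 0.
Proof. by rewrite /ext big1 // => p _; rewrite big_nil. Qed.

Lemma lin_cons T p x : lin T (p :: x) = sc p.1 (T p.2) ++ lin T x.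
Proof. by []. Qed.

Lemma lin_cat T x y : lin T (x ++ y) = lin T x ++ lin T y.
Proof. by rewrite /lin map_cat flatten_cat. Qed.

Lemma sc_cat a x y : sc a (x ++ y) = sc a x ++ sc a y.
Proof. exact: map_cat. Qed.

Lemma scA a b x : sc a (sc b x) = sc (a * b) x.
Proof. by rewrite /sc -map_comp; apply: eq_map => p /=; rewrite mulrA. Qed.

Lemma sc1 x : sc 1 x = x.
Proof. by rewrite /sc -[RHS]map_id; apply: eq_map => -[a b] /=; rewrite mul1r. Qed.

Lemma lin_sc T a x : lin T (sc a x) = sc a (lin T x).
Proof.
elim: x => // p x IH; rewrite /sc map_cons -/(sc a x) !lin_cons IH.
by rewrite -/(sc _ _) -/(sc a _) sc_cat scA.
Qed.

Lemma lin_comp S T x : lin S (lin T x) = lin (fun b => lin S (T b)) x.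
Proof. by elim: x => // p x IH; rewrite !lin_cons lin_cat IH lin_sc. Qed.

Lemma lin_ket T b : lin T (ket b) = T b.
Proof. by rewrite /lin /= cats0 sc1. Qed.

Lemma lin_id x : lin ket x = x.
Proof.
by elim: x => // -[a b] x IH; rewrite lin_cons IH /ket /sc /= mulr1.
Qed.

Lemma ext_expandl t x y :
  ext t x y = \sum_(p <- x) conjc p.1 * ext t (ket p.2) y.
Proof.
rewrite /ext; apply: eq_bigr => p _; rewrite big_seq1 mulr_sumr.
by apply: eq_bigr => q _ /=; rewrite conjc1 mul1r mulrA.
Qed.

Lemma ext_expandr t x y :
  ext t x y = \sum_(q <- y) q.1 * ext t x (ket q.2).
Proof.
rewrite /ext exchange_big /=; apply: eq_bigr => q _; rewrite mulr_sumr.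
by apply: eq_bigr => p _ /=; rewrite big_seq1 /= mulr1 mulrCA mulrA.
Qed.

Lemma ext_linr t x T y :
  ext t x (lin T y) = ext (fun b b' => ext t (ket b) (T b')) x y.
Proof.
elim: y => [|q y IH]; first by rewrite !ext0r.
rewrite lin_cons extDr IH extZr -cat1s extDr; congr (_ + _).
rewrite ext_expandl mulr_sumr [RHS]/ext; apply: eq_bigr => p _.
by rewrite big_seq1 mulrCA mulrA.
Qed.

Lemma ext_linl t x T y :
  ext t (lin T x) y = ext (fun b b' => ext t (T b) (ket b')) x y.
Proof.
elim: x => [|p x IH]; first by rewrite !ext0l.
rewrite lin_cons extDl IH extZl -cat1s extDl; congr (_ + _).
rewrite ext_expandr mulr_sumr [RHS]/ext big_seq1; apply: eq_bigr => q _.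
by rewrite mulrA.
Qed.

Lemma eq_ext t t' x y : (forall b b', t b b' = t' b b') -> ext t x y = ext t' x y.
Proof. by move=> tt'; do 2!apply: eq_bigr => ? _; rewrite tt'. Qed.

Lemma ext_add t t' x y : ext (fun b b' => t b b' + t' b b') x y = ext t x y + ext t' x y.
Proof.
rewrite /ext -big_split; apply: eq_bigr => p _ /=; rewrite -big_split.
by apply: eq_bigr => q _ /=; rewrite mulrDr.
Qed.

Lemma ext_scale a t x y : ext (fun b b' => a * t b b') x y = a * ext t x y.
Proof.
rewrite /ext mulr_sumr; apply: eq_bigr => p _; rewrite mulr_sumr.
by apply: eq_bigr => q _ /=; rewrite mulrCA.
Qed.

Lemma ext_conj t x y : ext (fun b b' => conjc (t b' b)) x y = conjc (ext t y x).
Proof.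
rewrite /ext exchange_big /= rmorph_sum; apply: eq_bigr => q _.
rewrite rmorph_sum; apply: eq_bigr => p _ /=.
by rewrite !rmorphM /= conjcK [X in X * _]mulrC.
Qed.

Lemma cconv_ext (t : nat -> B -> B -> C) u x y :
  (forall b b', cconv (fun n => t n b b') (u b b')) ->
  cconv (fun n => ext (t n) x y) (ext u x y).
Proof.
by move=> tu; apply: cconv_sum => p; apply: cconv_sum => q; apply: cconvZ.
Qed.

End Vectors.

(** Null vectors are not divided out: equality is only ever tested through the kernel. The last
    field gives a vector of nonzero length, hence 1 != 0 in the algebra and nonnegative norm
    bounds. *)
Record psd_kernel := PsdKernel {
  kbasis : Type;
  kfun : kbasis -> kbasis -> C;
  kfun_herm : forall b b', kfun b' b = conjc (kfun b b');
  kfun_psd : forall x, 0 <= ext kfun x x;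
  kfun_neq0 : exists b, kfun b b != 0
}.

Section PreHilbert.
Variable k : psd_kernel.
Local Notation B := (kbasis k).
Local Notation vec := (vec B).
Local Notation ip := (ext (@kfun k)).

Lemma ip_conj x y : ip y x = conjc (ip x y).
Proof. by rewrite -ext_conj; apply: eq_ext => b b'; rewrite -kfun_herm. Qed.

Definition nrm (x : vec) : R := Num.sqrt (Re (ip x x)).

Lemma nrm_ge0 x : 0 <= nrm x. Proof. exact: sqrtr_ge0. Qed.

Lemma nrm2 x : ip x x = (nrm x ^+ 2)%:C.
Proof.
have := kfun_psd x; rewrite lecE => /andP[/eqP i0 r0].
rewrite sqr_sqrtr //; case: (ip x x) i0 => a b /= ->; by [].
Qed.

Lemma cauchy_schwarz x y : cabs (ip x y) <= nrm x * nrm y.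
Proof.
set a := nrm x ^+ 2; set b := nrm y ^+ 2; set c := cabs (ip x y).
have a0 : 0 <= a by exact: sqr_ge0.
have b0 : 0 <= b by exact: sqr_ge0.
have c0 : 0 <= c by exact: cabs_ge0.
suff H : c ^+ 2 <= a * b.
  rewrite -(@ler_pXn2r _ 2) // ?nnegrE ?mulr_ge0 ?nrm_ge0 //.
  by rewrite exprMn.
apply: (@le_of_eps _ _ a) => e e0 _.
(* The usual Cauchy-Schwarz vector with [b] shifted by [e]: positivity at [v] gives (b + e) ((b + e)
   a - c^2) >= e c^2, and dividing by b + e > 0 covers b = 0 as well. *)
pose v := sc (b + e)%:C x ++ sc (- conjc (ip x y)) y.
have := kfun_psd v; rewrite /v !extDl !extDr !extZl !extZr !nrm2 -/a -/b.
rewrite conjc_real rmorphN /= conjcK (ip_conj x y).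
set w := ip x y.
set bC := (b + e)%:C.
rewrite (_ : _ + _ = bC * (bC * a%:C - w * conjc w) - (bC - b%:C) * (w * conjc w)); last first.
  ring.
rewrite -cabs_sqr -/c /bC -!(rmorphM, rmorphB) /= ler0c.
nra.
Qed.

Lemma le_of_sqr_le (n c : R) : 0 <= n -> 0 <= c -> n ^+ 2 <= c * n -> n <= c.
Proof. by move=> n0 c0 H; case: (leP n c) => // cn; nra. Qed.

Lemma nrm_eq x x' : (forall z, ip x z = ip x' z) -> nrm x = nrm x'.
Proof. by move=> H; rewrite /nrm H ip_conj H -ip_conj. Qed.

Lemma nrm_sqr x : nrm x ^+ 2 = cabs (ip x x).
Proof. by rewrite nrm2 cabs_real ?sqr_ge0. Qed.

Lemma nrm_sc a x : nrm (sc a x) = cabs a * nrm x.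
Proof.
apply/eqP; rewrite -(@eqrXn2 _ 2) ?mulr_ge0 ?nrm_ge0 ?cabs_ge0 //.
by rewrite exprMn !nrm_sqr extZl extZr !cabsM cabs_conj mulrA -expr2.
Qed.

Lemma nrm_cat x y : nrm (x ++ y) <= nrm x + nrm y.
Proof.
apply: le_of_sqr_le; rewrite ?addr_ge0 ?nrm_ge0 // nrm_sqr extDl mulrDl.
by apply: le_trans (cabsD _ _) (lerD (cauchy_schwarz _ _) (cauchy_schwarz _ _)).
Qed.

(** The adjoint is carried as data, since in an incomplete space a bounded map may have none. Only
    [oT] is required to be bounded; [adjoint_bound] gives [oA] the same constant. *)
Record op := Op {
  oT : B -> vec;
  oA : B -> vec;
  op_adj : forall b b', ip (ket b) (oT b') = ip (oA b) (ket b');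
  op_bd : exists2 K, 0 <= K & forall x, nrm (lin oT x) <= K * nrm x
}.

Lemma adjoint_lin (S T : B -> vec) :
  (forall b b', ip (ket b) (S b') = ip (T b) (ket b')) ->
  forall x y, ip x (lin S y) = ip (lin T x) y.
Proof. by move=> ST x y; rewrite ext_linr ext_linl; apply: eq_ext. Qed.

Lemma op_adjE (T : op) x y : ip x (lin (oT T) y) = ip (lin (oA T) x) y.
Proof. exact/adjoint_lin/op_adj. Qed.

Lemma op_adjE' (T : op) x y : ip (lin (oT T) x) y = ip x (lin (oA T) y).
Proof. by rewrite ip_conj op_adjE -ip_conj. Qed.

(** With v = T x one has |v|^2 = <x, S v> <= |x| K |v|, and a factor |v| cancels. *)
Lemma adjoint_bound (S T : B -> vec) K : 0 <= K ->
  (forall b b', ip (ket b) (S b') = ip (T b) (ket b')) ->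
  (forall x, nrm (lin S x) <= K * nrm x) -> forall x, nrm (lin T x) <= K * nrm x.
Proof.
move=> K0 /adjoint_lin ST SK x; apply: le_of_sqr_le; rewrite ?mulr_ge0 ?nrm_ge0 //.
rewrite nrm_sqr -ST; apply: le_trans (cauchy_schwarz _ _) _.
rewrite mulrAC mulrC; apply: ler_wpM2r; rewrite ?nrm_ge0 //; exact: SK.
Qed.

Fact op_id_bd : exists2 K : R, 0 <= K & forall x, nrm (lin (@ket B) x) <= K * nrm x.
Proof. by exists 1 => // x; rewrite lin_id mul1r. Qed.
Definition op_id := @Op (@ket B) (@ket B) (fun b b' => erefl) op_id_bd.

Fact op_adjoint_adj (T : op) b b' : ip (ket b) (oA T b') = ip (oT T b) (ket b').
Proof. by rewrite ip_conj -op_adj -ip_conj. Qed.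
Fact op_adjoint_bd (T : op) : exists2 K, 0 <= K & forall x, nrm (lin (oA T) x) <= K * nrm x.
Proof.
have [K K0 TK] := op_bd T; exists K => //.
by apply: adjoint_bound TK => // *; exact: op_adj.
Qed.
Definition op_adjoint T := Op (op_adjoint_adj T) (op_adjoint_bd T).

Fact op_comp_adj (S T : op) b b' :
  ip (ket b) (lin (oT S) (oT T b')) = ip (lin (oA T) (oA S b)) (ket b').
Proof. by rewrite op_adjE lin_ket -[oT T b']lin_ket op_adjE. Qed.
Fact op_comp_bd (S T : op) :
  exists2 K, 0 <= K & forall x, nrm (lin (fun b => lin (oT S) (oT T b)) x) <= K * nrm x.
Proof.
have [K K0 SK] := op_bd S; have [L L0 TL] := op_bd T.
exists (K * L) => [|x]; first exact: mulr_ge0.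
rewrite -lin_comp; apply: le_trans (SK _) _; rewrite -mulrA; exact: ler_wpM2l.
Qed.
Definition op_comp S T := Op (op_comp_adj S T) (op_comp_bd S T).

Lemma ext_lin_cat t (S T : B -> vec) x y :
  ext t x (lin (fun b => S b ++ T b) y) = ext t x (lin S y) + ext t x (lin T y).
Proof. by rewrite !ext_linr -ext_add; apply: eq_ext => b b'; rewrite extDr. Qed.

Lemma ext_lin_catl t (S T : B -> vec) x y :
  ext t (lin (fun b => S b ++ T b) x) y = ext t (lin S x) y + ext t (lin T x) y.
Proof. by rewrite !ext_linl -ext_add; apply: eq_ext => b b'; rewrite extDl. Qed.

Lemma ext_lin_sc t a (T : B -> vec) x y :
  ext t x (lin (fun b => sc a (T b)) y) = a * ext t x (lin T y).
Proof. by rewrite !ext_linr -ext_scale; apply: eq_ext => b b'; rewrite extZr. Qed.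

Lemma ext_lin_scl t a (T : B -> vec) x y :
  ext t (lin (fun b => sc a (T b)) x) y = conjc a * ext t (lin T x) y.
Proof. by rewrite !ext_linl -ext_scale; apply: eq_ext => b b'; rewrite extZl. Qed.

Fact op_add_adj (S T : op) b b' :
  ip (ket b) (oT S b' ++ oT T b') = ip (oA S b ++ oA T b) (ket b').
Proof. by rewrite extDl extDr !op_adj. Qed.
Fact op_add_bd (S T : op) :
  exists2 K, 0 <= K & forall x, nrm (lin (fun b => oT S b ++ oT T b) x) <= K * nrm x.
Proof.
have [K K0 SK] := op_bd S; have [L L0 TL] := op_bd T.
exists (K + L) => [|x]; first exact: addr_ge0.
(* The two lists contain the same terms in different orders, so they are compared through their
   inner products only. *)
rewrite (@nrm_eq _ (lin (oT S) x ++ lin (oT T) x)); last first.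
  by move=> z; rewrite ext_lin_catl extDl.
by rewrite mulrDl; apply: le_trans (nrm_cat _ _) (lerD (SK _) (TL _)).
Qed.
Definition op_add S T := Op (op_add_adj S T) (op_add_bd S T).

Fact op_sc_adj a (T : op) b b' :
  ip (ket b) (sc a (oT T b')) = ip (sc (conjc a) (oA T b)) (ket b').
Proof. by rewrite extZl extZr op_adj conjcK. Qed.
Fact op_sc_bd a (T : op) :
  exists2 K, 0 <= K & forall x, nrm (lin (fun b => sc a (oT T b)) x) <= K * nrm x.
Proof.
have [K K0 TK] := op_bd T.
exists (cabs a * K) => [|x]; first by rewrite mulr_ge0 ?cabs_ge0.
rewrite (@nrm_eq _ (sc a (lin (oT T) x))); last first.
  by move=> z; rewrite ext_lin_scl extZl.
by rewrite nrm_sc -mulrA ler_wpM2l ?cabs_ge0.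
Qed.
Definition op_sc a T := Op (op_sc_adj a T) (op_sc_bd a T).

Definition bnd t K := forall x y, cabs (ext t x y) <= K * (nrm x * nrm y).
Definition appr t (T : op) e :=
  forall x y, cabs (ext t x y - ip x (lin (oT T) y)) <= e * (nrm x * nrm y).
(** These forms stand for the norm closure of the adjointable operators. Tolerances are restricted
    to [e <= 1] to match [le_of_eps]. *)
Definition approximable t := forall e, 0 < e -> e <= 1 -> exists T, appr t T e.

Lemma nrmM_ge0 x y : 0 <= nrm x * nrm y.
Proof. by rewrite mulr_ge0 ?nrm_ge0. Qed.

Lemma appr_adjE t T e x y : appr t T e ->
  cabs (ext t x y - ip (lin (oA T) x) y) <= e * (nrm x * nrm y).
Proof. by rewrite -op_adjE. Qed.

Lemma bnd_ge0 t K : bnd t K -> 0 <= K.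
Proof.
move=> tK; have [b kb] := kfun_neq0 k.
have := tK (ket b) (ket b); rewrite -expr2 nrm_sqr !ext_ket.
have k0 : 0 < cabs (kfun b b).
  rewrite lt_neqAle cabs_ge0 andbT eq_sym; apply: contra kb => /eqP.
  by move/cabs_eq0 ->.
move/(le_trans (cabs_ge0 _)); by rewrite pmulr_lge0.
Qed.

Lemma approximable_bnd t : approximable t -> exists K, bnd t K.
Proof.
move=> /(_ 1 ltr01 (lexx _))[T tT]; have [K K0 TK] := op_bd T.
exists (1 + K) => x y; rewrite mulrDl.
rewrite -(subrK (ip x (lin (oT T) y)) (ext t x y)).
apply: le_trans (cabsD _ _) (lerD (tT _ _) _).
apply: le_trans (cauchy_schwarz _ _) _.
by rewrite [K * _]mulrCA ler_wpM2l ?nrm_ge0.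
Qed.

Definition tnorm t : R := inf [set K | bnd t K].

Lemma tnorm_le t K : bnd t K -> tnorm t <= K.
Proof.
move=> tK; apply: ge_inf => //.
by exists 0 => L /= /bnd_ge0.
Qed.

Lemma tnormP t : approximable t -> bnd t (tnorm t).
Proof.
move=> tA x y; have [K tK] := approximable_bnd tA.
apply: (@le_of_eps _ _ (nrm x * nrm y)) => e e0 _.
have [|L /= tL Le] := @inf_adherent _ [set K | bnd t K] _ e0.
  by split; [exists K | exists 0 => M /= /bnd_ge0].
apply: le_trans (tL x y) _; rewrite -mulrDl.
by apply: ler_wpM2r (ltW Le); exact: nrmM_ge0.
Qed.

Lemma tnorm_ge0 t : approximable t -> 0 <= tnorm t.
Proof. by move=> tA; exact: bnd_ge0 (tnormP tA). Qed.

(** The form is tested at (T x, x): there it is at most K |T x| |x| and differs from |T x|^2 by at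
    most e |T x| |x|. *)
Lemma appr_nrm t T e K x : appr t T e -> bnd t K -> 0 <= K + e ->
  nrm (lin (oT T) x) <= (K + e) * nrm x.
Proof.
move=> tT tK Ke; apply: le_of_sqr_le; rewrite ?mulr_ge0 ?nrm_ge0 //.
rewrite nrm_sqr; set v := lin _ x.
have := tT v x; have := tK v x; have := cabs_tri (ip v v) 0 (ext t v x).
rewrite !subr0 (cabsB (ip v v)) -/v; lra.
Qed.

Lemma appr_nrmA t T e K x : appr t T e -> bnd t K -> 0 <= K + e ->
  nrm (lin (oA T) x) <= (K + e) * nrm x.
Proof.
move=> tT tK Ke; apply: le_of_sqr_le; rewrite ?mulr_ge0 ?nrm_ge0 //.
rewrite nrm_sqr; set v := lin _ x.
have := appr_adjE x v tT; have := tK x v; have := cabs_tri (ip v v) 0 (ext t x v).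
rewrite !subr0 (cabsB (ip v v)) -/v; lra.
Qed.

(** Two operators approaching the same form have adjoints within [d + e] of each other in norm, as
    testing on v = S' x - T' x shows, with S', T' the adjoints. This makes products independent of
    the chosen approximation. *)
Lemma appr_diff s t S T d e K x y : bnd t K -> 0 <= K -> appr s S d -> appr s T e ->
  0 <= d + e ->
  cabs (ext t (lin (oA S) x) y - ext t (lin (oA T) x) y)
    <= K * (d + e) * (nrm x * nrm y).
Proof.
move=> tK K0 sS sT de.
pose v := lin (oA S) x ++ sc (-1) (lin (oA T) x).
have vE u z : ext u v z = ext u (lin (oA S) x) z - ext u (lin (oA T) x) z.
  by rewrite extDl extZl rmorphN1 mulN1r.
rewrite -vE; apply: le_trans (tK _ _) _; rewrite -mulrA ler_wpM2l //.
rewrite mulrA ler_wpM2r ?nrm_ge0 //.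
apply: le_of_sqr_le; rewrite ?mulr_ge0 ?nrm_ge0 //.
rewrite nrm_sqr vE; have := appr_adjE x v sS; have := appr_adjE x v sT.
have := cabs_tri (ip (lin (oA S) x) v) (ip (lin (oA T) x) v) (ext s x v).
by rewrite (cabsB _ (ext s x v)); lra.
Qed.

End PreHilbert.

Lemma inv_small (e : R) : 0 < e ->
  exists N, forall n, (N <= n)%N -> n.+1%:R^-1 < e.
Proof.
move=> e0; have := archi_boundP (ltW (divr_gt0 ltr01 e0)).
set N := Num.bound _ => H; exists N => n Nn.
rewrite invf_plt ?posrE // -[e^-1]mul1r; apply: lt_le_trans H _.
by rewrite ler_nat (leq_trans Nn).
Qed.

Lemma scale_eps (e L : R) : 0 < e -> 0 <= L ->
  exists d, [/\ 0 < d, d <= 1, d <= e & d * L <= e].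
Proof.
move=> e0 L0; have L1 : 0 < L + 1 by lra.
exists (Num.min 1 (e / (L + 1))); split.
- by rewrite lt_min ltr01 divr_gt0.
- by rewrite ge_min lexx.
- by rewrite ge_min ler_pdivrMr //; apply/orP; right; nra.
- apply: (@le_trans _ _ (e / (L + 1) * L)); first by rewrite ler_wpM2r // ge_min lexx orbT.
  by rewrite mulrAC ler_pdivrMr //; nra.
Qed.

(** * Products, adjoints and norms of approximable forms *)

Section Product.
Variable k : psd_kernel.
Local Notation B := (kbasis k).
Local Notation vec := (vec B).
Local Notation form := (B -> B -> C).
Local Notation ip := (ext (@kfun k)).
Implicit Types s t u v w : form.

Lemma eq_form u u' K :
  (forall e, 0 < e -> e <= 1 -> forall b b',
     cabs (u b b' - u' b b') <= e * K * (nrm (ket b) * nrm (ket b'))) -> u = u'.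
Proof.
move=> H; apply: funext => b; apply: funext => b'.
apply/eqP; rewrite -subr_eq0; apply/eqP/cabs_eq0/le_anti; rewrite cabs_ge0 andbT.
apply: (@le_of_eps _ _ (K * (nrm (ket b) * nrm (ket b')))) => e e0 e1.
by rewrite add0r mulrA H.
Qed.

Lemma appr_le t T d e : appr t T d -> d <= e -> appr t T e.
Proof. by move=> tT de x y; apply: le_trans (tT x y) _; rewrite ler_wpM2r ?nrmM_ge0. Qed.

(* [u] is the product [s t]: its value at [(x, y)] is approached by [t] at
   [(T^* x, y)] when the operator [T] approaches [s] in norm. *)
Definition isprod s t u := exists2 K, 0 <= K & forall e, 0 < e -> e <= 1 ->
  exists2 T, appr s T e & forall x y,
    cabs (ext u x y - ext t (lin (oA T) x) y) <= e * K * (nrm x * nrm y).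

Lemma isprod_uniq s t u u' : approximable t ->
  isprod s t u -> isprod s t u' -> u = u'.
Proof.
move=> tA [K K0 H] [K' K'0 H'].
have tK := tnormP tA; set Kt := tnorm t in tK; have Kt0 : 0 <= Kt := tnorm_ge0 tA.
apply: (@eq_form _ _ (K + K' + 2 * Kt)) => e e0 e1 b b'.
have [S sS uS] := H e e0 e1; have [T sT uT] := H' e e0 e1.
have ee : 0 <= e + e by lra.
have := appr_diff (ket b) (ket b') tK Kt0 sS sT ee.
have := uS (ket b) (ket b'); have := uT (ket b) (ket b'); rewrite !ext_ket.
set x := ext t (lin (oA S) _) _; set y := ext t (lin (oA T) _) _.
have := cabs_tri (u b b') (u' b b') y; have := cabs_tri (u b b') y x.
by rewrite (cabsB y (u' _ _)); lra.
Qed.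

(** The product is the pointwise limit of [t] evaluated after the adjoints of operators T_n within
    1/(n+1) of [s]; [appr_diff] makes these values Cauchy, uniformly relative to the norms of the
    arguments. *)
Lemma isprod_exists s t : approximable s -> approximable t -> exists u, isprod s t u.
Proof.
move=> sA tA; pose eps n : R := n.+1%:R^-1.
have eps0 n : 0 < eps n by rewrite invr_gt0.
have eps1 n : eps n <= 1 by rewrite invf_le1 // ler1n.
have tK := tnormP tA; set K := tnorm t in tK; have K0 : 0 <= K := tnorm_ge0 tA.
have [T sT] := choice (fun n => sA _ (eps0 n) (eps1 n)).
have D m n x y : cabs (ext t (lin (oA (T m)) x) y - ext t (lin (oA (T n)) x) y)
     <= K * (eps m + eps n) * (nrm x * nrm y).
  by apply: (appr_diff x y tK K0 (sT m) (sT n)); rewrite addr_ge0 ?ltW.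
have eps_small d L : 0 < d -> 0 <= L -> exists N, forall n, (N <= n)%N -> eps n * L <= d.
  move=> d0 L0; have [e [e0 _ _ eL]] := scale_eps d0 L0.
  have [N HN] := inv_small e0; exists N => n /HN ne.
  by apply: (le_trans _ eL); apply: ler_wpM2r => //; exact: ltW.
pose z b b' n := ext t (oA (T n) b) (ket b').
have zC b b' : exists l, cconv (z b b') l.
  apply: complex_cauchy_cvg => e e0.
  pose L := K * (nrm (ket b) * nrm (ket b')).
  have L0 : 0 <= L by rewrite mulr_ge0 ?nrmM_ge0.
  have e3 : 0 < e / 3 by lra.
  have [N HN] := eps_small _ _ e3 L0; exists N => m n /HN Hm /HN Hn.
  have := D m n (ket b) (ket b'); rewrite !lin_ket -/(z b b' m) -/(z b b' n).
  by rewrite mulrAC -/L; lra.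
have [u0 Hu0] := choice (fun p : B * B => zC p.1 p.2); pose u : form := fun b b' => u0 (b, b').
have uE x y : cconv (fun n => ext t (lin (oA (T n)) x) y) (ext u x y).
  move=> e e0; have [N H] := cconv_ext x y (fun b b' => Hu0 (b, b')) e0.
  by exists N => n /H; rewrite ext_linl.
exists u; exists K => // e e0 e1.
have [N HN] := inv_small e0; exists (T N); first by exact: appr_le (sT N) (ltW (HN _ (leqnn _))).
move=> x y; rewrite cabsB; apply: cconv_le (uE x y) _ => d d0.
pose L := K * (nrm x * nrm y).
have L0 : 0 <= L by rewrite mulr_ge0 ?nrmM_ge0.
have [M HM] := eps_small _ _ d0 L0; exists M => n /HM Hn.
apply: le_trans (D _ _ _ _) _; rewrite mulrAC -/L mulrDr -[e * K * _]mulrA -/L.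
rewrite [L * eps n]mulrC; apply: lerD => //; rewrite mulrC ler_wpM2r //.
exact/ltW/HN.
Qed.

Lemma isprod_bnd s t u : approximable s -> approximable t ->
  isprod s t u -> bnd u (tnorm s * tnorm t).
Proof.
move=> sA tA [K K0 H] x y.
have sK := tnormP sA; have tK := tnormP tA.
have Ks0 := tnorm_ge0 sA; have Kt0 := tnorm_ge0 tA.
apply: (@le_of_eps _ _ ((K + tnorm t) * (nrm x * nrm y))) => e e0 e1.
have [T sT uT] := H e e0 e1.
have sTn := appr_nrmA x sT sK (addr_ge0 Ks0 (ltW e0)).
have := tK (lin (oA T) x) y; have := uT x y.
have := cabs_tri (ext u x y) 0 (ext t (lin (oA T) x) y); rewrite !subr0.
have /(ler_wpM2l Kt0) := ler_wpM2r (nrm_ge0 y) sTn.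
by lra.
Qed.

Lemma isprod_approximable s t u : approximable s -> approximable t ->
  isprod s t u -> approximable u.
Proof.
move=> sA tA [K K0 H] e' e'0 e'1.
have sK := tnormP sA; have Ks0 := tnorm_ge0 sA.
have L0 : 0 <= K + tnorm s + 1 by lra.
have [e [e0 e1 _ eL]] := scale_eps e'0 L0.
have [S sS uS] := H e e0 e1; have [T tT] := tA e e0 e1.
exists (op_comp S T) => x y /=; rewrite -lin_comp op_adjE.
have Sn := appr_nrmA x sS sK (addr_ge0 Ks0 (ltW e0)).
have := uS x y; have := tT (lin (oA S) x) y.
have := cabs_tri (ext u x y) (ip (lin (oA S) x) (lin (oT T) y)) (ext t (lin (oA S) x) y).
have /(ler_wpM2l (ltW e0)) := ler_wpM2r (nrm_ge0 y) Sn.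
have n0 := nrmM_ge0 x y; have := ler_wpM2r n0 eL.
have := ler_wpM2r n0 (ler_wpM2l (ltW e0) e1).
by lra.
Qed.

(** If S approaches [s] and T approaches [t], then S T approaches the product [u], and both
    bracketings are close to [v] evaluated at T' S' x and y, with S', T' the adjoints. *)
Lemma isprodA s t v u u' w : approximable s -> approximable t -> approximable v ->
  isprod s t u -> isprod u v w -> isprod t v u' -> isprod s u' w.
Proof.
move=> sA tA vA Hu Hw [K2 K20 Hu'].
have uA := isprod_approximable sA tA Hu.
case: Hu => K1 K10 Hu; case: Hw => K3 K30 Hw.
have sK := tnormP sA; have Ks0 := tnorm_ge0 sA.
have vK := tnormP vA; have Kv0 := tnorm_ge0 vA.
exists (K3 + tnorm v * (1 + (K1 + tnorm s + 1)) + K2 * (tnorm s + 1)).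
  by rewrite !(addr_ge0, mulr_ge0).
move=> e e0 e1.
have [S sS uS] := Hu e e0 e1; have [T tT u'T] := Hu' e e0 e1.
have [U uU wU] := Hw e e0 e1.
exists S => // x y.
have Sn z := appr_nrmA z sS sK (addr_ge0 Ks0 (ltW e0)).
have Sn1 z : nrm (lin (oA S) z) <= (tnorm s + 1) * nrm z.
  by apply: le_trans (Sn z) _; rewrite ler_wpM2r ?nrm_ge0 //; lra.
have uST : appr u (op_comp S T) (e * (K1 + tnorm s + 1)).
  move=> a b /=; rewrite -lin_comp op_adjE.
  have := uS a b; have := tT (lin (oA S) a) b.
  have := cabs_tri (ext u a b) (ip (lin (oA S) a) (lin (oT T) b)) (ext t (lin (oA S) a) b).
  have /(ler_wpM2l (ltW e0)) := ler_wpM2r (nrm_ge0 b) (Sn1 a).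
  by lra.
have := wU x y; have := u'T (lin (oA S) x) y.
have := @appr_diff k u v U (op_comp S T) e _ _ x y vK Kv0 uU uST.
rewrite /= -lin_comp => /(_ _)/wrap[|].
  by apply: addr_ge0; [exact: ltW | apply: mulr_ge0; [exact: ltW | lra]].
set a := ext v (lin (oA U) x) y; set b := ext v (lin (oA T) _) y.
set c := ext u' _ _; set d := ext w x y => H1 H2 H3.
have := cabs_tri d c a; have := cabs_tri a c b; rewrite (cabsB b c).
have /(ler_wpM2l K20) := ler_wpM2r (nrm_ge0 y) (Sn1 x).
move/(ler_wpM2l (ltW e0)); lra.
Qed.

Lemma appr_add s t S T d e : appr s S d -> appr t T e ->
  appr (fun b b' => s b b' + t b b') (op_add S T) (d + e).
Proof.
move=> sS tT x y; rewrite ext_add /= ext_lin_cat opprD addrACA mulrDl.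
exact: le_trans (cabsD _ _) (lerD (sS _ _) (tT _ _)).
Qed.

Lemma appr_sc a t T e : appr t T e ->
  appr (fun b b' => a * t b b') (op_sc a T) (cabs a * e).
Proof.
move=> tT x y; rewrite ext_scale /= ext_lin_sc -mulrBr cabsM -mulrA.
by rewrite ler_wpM2l ?cabs_ge0.
Qed.

Lemma approximable_add s t : approximable s -> approximable t ->
  approximable (fun b b' => s b b' + t b b').
Proof.
move=> sA tA e e0 e1; have h0 : 0 < e / 2 by lra.
have h1 : e / 2 <= 1 by lra.
have [S sS] := sA _ h0 h1; have [T tT] := tA _ h0 h1.
by exists (op_add S T); rewrite [e]splitr; apply: appr_add.
Qed.

Lemma approximable_sc a t : approximable t -> approximable (fun b b' => a * t b b').
Proof.
move=> tA e e0 e1; have [d [d0 d1 _ da]] := scale_eps e0 (cabs_ge0 a).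
have [T tT] := tA _ d0 d1; exists (op_sc a T).
by apply: appr_le (appr_sc a tT) _; rewrite mulrC.
Qed.

Lemma appr_conj t T e : appr t T e -> appr (fun b b' => conjc (t b' b)) (op_adjoint T) e.
Proof.
move=> tT x y; rewrite ext_conj (ip_conj _ x) -op_adjE -rmorphB cabs_conj.
by rewrite [nrm x * _]mulrC.
Qed.

Lemma approximable_conj t : approximable t -> approximable (fun b b' => conjc (t b' b)).
Proof. by move=> tA e e0 e1; have [T /appr_conj] := tA e e0 e1; exists (op_adjoint T). Qed.

Lemma isprodDl s s' t u u' : isprod s t u -> isprod s' t u' ->
  isprod (fun b b' => s b b' + s' b b') t (fun b b' => u b b' + u' b b').
Proof.
move=> [K K0 H] [K' K'0 H']; exists (K + K'); first exact: addr_ge0.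
move=> e e0 e1; have h0 : 0 < e / 2 by lra.
have h1 : e / 2 <= 1 by lra.
have [S sS uS] := H _ h0 h1; have [T tT uT] := H' _ h0 h1.
exists (op_add S T); first by rewrite [e]splitr; apply: appr_add.
move=> x y; rewrite ext_add /= ext_lin_catl opprD addrACA.
apply: le_trans (cabsD _ _) _; have := uS x y; have := uT x y.
have := mulr_ge0 (mulr_ge0 (ltW e0) K0) (nrmM_ge0 x y).
have := mulr_ge0 (mulr_ge0 (ltW e0) K'0) (nrmM_ge0 x y).
by lra.
Qed.

Lemma isprodDr s t t' u u' : approximable t' -> isprod s t u -> isprod s t' u' ->
  isprod s (fun b b' => t b b' + t' b b') (fun b b' => u b b' + u' b b').
Proof.
move=> tA [K K0 H] [K' K'0 H'].
have tK := tnormP tA; have Kt0 := tnorm_ge0 tA.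
exists (K + K' + 2 * tnorm t'); first by rewrite !addr_ge0 // mulr_ge0.
move=> e e0 e1.
have [S sS uS] := H _ e0 e1; have [T sT uT] := H' _ e0 e1.
exists S => // x y; rewrite !ext_add opprD addrACA.
apply: le_trans (cabsD _ _) _; have := uS x y; have := uT x y.
have := appr_diff x y tK Kt0 sT sS (addr_ge0 (ltW e0) (ltW e0)).
have := cabs_tri (ext u' x y) (ext t' (lin (oA S) x) y) (ext t' (lin (oA T) x) y).
by lra.
Qed.

Lemma isprodZl a s t u : isprod s t u ->
  isprod (fun b b' => a * s b b') t (fun b b' => a * u b b').
Proof.
move=> [K K0 H]; exists K => // e e0 e1.
have [d [d0 d1 _ da]] := scale_eps e0 (cabs_ge0 a).
have [T sT uT] := H _ d0 d1; exists (op_sc a T).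
  by apply: appr_le (appr_sc a sT) _; rewrite mulrC.
move=> x y; rewrite ext_scale /= ext_lin_scl conjcK -mulrBr cabsM.
apply: le_trans (ler_wpM2l (cabs_ge0 a) (uT x y)) _.
by rewrite !mulrA !ler_wpM2r ?nrm_ge0 // mulrC.
Qed.

Lemma isprodZr a s t u : isprod s t u ->
  isprod s (fun b b' => a * t b b') (fun b b' => a * u b b').
Proof.
move=> [K K0 H]; exists (cabs a * K); first by rewrite mulr_ge0 ?cabs_ge0.
move=> e e0 e1; have [T sT uT] := H _ e0 e1; exists T => // x y.
rewrite !ext_scale -mulrBr cabsM.
by apply: le_trans (ler_wpM2l (cabs_ge0 a) (uT x y)) _; lra.
Qed.

Definition opf (T : op k) : form := fun b b' => ip (ket b) (oT T b').

Lemma ext_opf T x y : ext (opf T) x y = ip x (lin (oT T) y).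
Proof. by rewrite ext_linr. Qed.

Lemma appr_opf T e : 0 <= e -> appr (opf T) T e.
Proof. by move=> e0 x y; rewrite ext_opf subrr cabs0 mulr_ge0 ?nrmM_ge0. Qed.

Lemma approximable_opf T : approximable (opf T).
Proof. by move=> e e0 _; exists T; apply: appr_opf; exact: ltW. Qed.

Lemma isprod_opl S t : isprod (opf S) t (fun b b' => ext t (oA S b) (ket b')).
Proof.
exists 0 => // e e0 e1; exists S; first exact: appr_opf (ltW e0).
by move=> x y; rewrite ext_linl subrr cabs0 mulr0 mul0r.
Qed.

Lemma isprod1r s : approximable s -> isprod s (opf (op_id k)) s.
Proof.
move=> sA; exists 1 => // e e0 e1; have [T sT] := sA e e0 e1; exists T => // x y.
by rewrite ext_opf lin_id mulr1; exact: appr_adjE.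
Qed.

(** Both u(y, x) and s(y, T x) are close to <S' y, T x>, where S, T approach [s], [t] and S' is the
    adjoint of S. *)
Lemma isprod_conj s t u : approximable s -> approximable t -> isprod s t u ->
  isprod (fun b b' => conjc (t b' b)) (fun b b' => conjc (s b' b))
         (fun b b' => conjc (u b' b)).
Proof.
move=> sA tA [K K0 H].
have sK := tnormP sA; have Ks0 := tnorm_ge0 sA.
have tK := tnormP tA; have Kt0 := tnorm_ge0 tA.
exists (K + (tnorm s + 1) + (tnorm t + 1)); first by rewrite !addr_ge0.
move=> e e0 e1; have [T tT] := tA e e0 e1; exists (op_adjoint T); first exact: appr_conj.
move=> x y /=; rewrite !ext_conj -rmorphB cabs_conj.
have [S sS uS] := H e e0 e1.
have Sn : nrm (lin (oA S) y) <= (tnorm s + 1) * nrm y.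
  apply: le_trans (appr_nrmA y sS sK (addr_ge0 Ks0 (ltW e0))) _.
  by rewrite ler_wpM2r ?nrm_ge0 //; lra.
have Tn : nrm (lin (oT T) x) <= (tnorm t + 1) * nrm x.
  apply: le_trans (appr_nrm x tT tK (addr_ge0 Kt0 (ltW e0))) _.
  by rewrite ler_wpM2r ?nrm_ge0 //; lra.
have := uS y x; have := tT (lin (oA S) y) x; have := appr_adjE y (lin (oT T) x) sS.
set a := ext u y x; set b := ext t _ _; set c := ip _ _; set d := ext s _ _.
have := cabs_tri a d b; have := cabs_tri b d c; rewrite (cabsB c d).
have /(ler_wpM2l (ltW e0)) := ler_wpM2r (nrm_ge0 x) Sn.
have /(ler_wpM2l (ltW e0)) := ler_wpM2l (nrm_ge0 y) Tn.
by lra.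
Qed.

Lemma tnorm_conj t : approximable t -> tnorm (fun b b' => conjc (t b' b)) = tnorm t.
Proof.
have H s : approximable s -> tnorm (fun b b' => conjc (s b' b)) <= tnorm s.
  move=> sA; apply: tnorm_le => x y.
  by rewrite ext_conj cabs_conj [nrm x * _]mulrC; exact: tnormP.
move=> tA; apply/le_anti; rewrite H //=.
have := H _ (approximable_conj tA); congr (tnorm _ <= _).
by apply: funext => b; apply: funext => b'; rewrite conjcK.
Qed.

(** Only [tnorm t ^+ 2 <= tnorm u] needs work. For T approaching [t], |T y|^2 = <y, T' T y> is
    within O(e) |y|^2 of u(y, y), so |T y| <= sqrt M |y| with M = |u| + O(e), and hence |t| <= sqrt
    M + e. *)
Lemma tnorm_cstar t u : approximable t ->
  isprod (fun b b' => conjc (t b' b)) t u -> tnorm u = tnorm t ^+ 2.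
Proof.
move=> tA; have tA' := approximable_conj tA => Hu.
have uA := isprod_approximable tA' tA Hu.
have tK := tnormP tA; have Kt0 := tnorm_ge0 tA.
have uK := tnormP uA; have Ku0 := tnorm_ge0 uA.
apply/le_anti/andP; split.
  by apply: tnorm_le; have := isprod_bnd tA' tA Hu; rewrite tnorm_conj // -expr2.
case: Hu => K K0 H.
apply: (@le_of_eps _ _ (K + 2 * tnorm t + (tnorm t + 1) + (tnorm t + 3) * (tnorm t + 1))) => e e0 e1.
have [S sS uS] := H e e0 e1; have [T tT] := tA e e0 e1.
have ee : 0 <= e + e by lra.
pose M := tnorm u + e * (K + 2 * tnorm t + (tnorm t + 1)).
have M0 : 0 <= M by apply: addr_ge0 => //; apply: mulr_ge0; [exact: ltW | lra].
have Tn y : nrm (lin (oT T) y) ^+ 2 <= M * nrm y ^+ 2.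
  rewrite nrm_sqr op_adjE'.
  have Tn1 : nrm (lin (oT T) y) <= (tnorm t + 1) * nrm y.
    apply: le_trans (appr_nrm y tT tK (addr_ge0 Kt0 (ltW e0))) _.
    by rewrite ler_wpM2r ?nrm_ge0 //; lra.
  have /(ler_wpM2l (ltW e0)) := ler_wpM2r (nrm_ge0 y) Tn1.
  have := appr_diff y y tK Kt0 sS (appr_conj tT) ee; rewrite /=.
  have := uS y y; have := uK y y; have := tT (lin (oT T) y) y.
  rewrite op_adjE' /M expr2.
  set a := ext u y y; set b := ext t (lin (oA S) y) y.
  set c := ext t (lin (oT T) y) y; set d := ip y _.
  have := cabs_tri d 0 c; have := cabs_tri c 0 b; have := cabs_tri b 0 a.
  by rewrite !subr0 (cabsB d c) (cabsB b a) (cabsB c b); lra.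
have TN y : nrm (lin (oT T) y) <= Num.sqrt M * nrm y.
  rewrite -(@ler_pXn2r _ 2) // ?nnegrE ?mulr_ge0 ?nrm_ge0 ?sqrtr_ge0 //.
  by rewrite exprMn (sqr_sqrtr M0).
have tM : tnorm t <= Num.sqrt M + e.
  apply: tnorm_le => x y; have := tT x y.
  have := cauchy_schwarz x (lin (oT T) y); have := ler_wpM2l (nrm_ge0 x) (TN y).
  have := cabs_tri (ext t x y) 0 (ip x (lin (oT T) y)); rewrite !subr0; lra.
have sM := sqr_sqrtr M0; have sM0 := sqrtr_ge0 M.
have : tnorm t ^+ 2 <= M + e * (tnorm t + 3) * (tnorm t + 1).
  rewrite -sM; set r := Num.sqrt M in tM sM0 *.
  (* From |t| - e <= r one may square only when |t| >= e; otherwise |t|^2 <= e |t| is already an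
     error term. *)
  have [rt|rt] := leP (tnorm t) e; nra.
by rewrite /M; lra.
Qed.

End Product.

(** * The C*-algebra of a positive kernel *)

Definition cstar_of (k : psd_kernel) : Type :=
  {t : kbasis k -> kbasis k -> C | approximable t}.

HB.instance Definition _ k := gen_eqMixin (cstar_of k).
HB.instance Definition _ k := gen_choiceMixin (cstar_of k).

Section CStar.
Variable k : psd_kernel.
Local Notation A := (cstar_of k).
Local Notation B := (kbasis k).
Implicit Types s t u : A.

Definition mkA (f : B -> B -> C) (fA : approximable f) : A := exist _ f fA.

Lemma cst_eq s t : (forall b b', sval s b b' = sval t b b') -> s = t.
Proof.
case: s t => [f fA] [g gA] /= fg; apply: eq_exist.
by apply: funext => b; apply: funext => b'; exact: fg.
Qed.

Definition cst_op (T : op k) : A := mkA (approximable_opf T).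
Definition cst_one : A := cst_op (op_id k).
Definition cst_add s t : A := mkA (approximable_add (svalP s) (svalP t)).
Definition cst_scale (a : C) t : A := mkA (approximable_sc a (svalP t)).
Definition cst_zero : A := cst_scale 0 cst_one.
Definition cst_opp t : A := cst_scale (-1) t.
Definition cst_star t : A := mkA (approximable_conj (svalP t)).
Definition cst_mul s t : A :=
  let p := cid (isprod_exists (svalP s) (svalP t)) in
  mkA (isprod_approximable (svalP s) (svalP t) (svalP p)).

Lemma cst_mulP s t : isprod (sval s) (sval t) (sval (cst_mul s t)).
Proof. by rewrite /cst_mul; case: cid. Qed.

(** The product is obtained by choice. Its uniqueness reduces every algebra law to exhibiting a form
    with the product property. *)
Lemma cst_mul_eq s t u : isprod (sval s) (sval t) (sval u) -> cst_mul s t = u.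
Proof.
move=> H; apply: cst_eq => b b'.
by rewrite (isprod_uniq (svalP t) (cst_mulP s t) H).
Qed.

Fact cst_addA : associative cst_add.
Proof. by move=> s t u; apply: cst_eq => b b' /=; rewrite addrA. Qed.
Fact cst_addC : commutative cst_add.
Proof. by move=> s t; apply: cst_eq => b b' /=; rewrite addrC. Qed.
Fact cst_add0 : left_id cst_zero cst_add.
Proof. by move=> s; apply: cst_eq => b b' /=; rewrite mul0r add0r. Qed.
Fact cst_addN : left_inverse cst_zero cst_opp cst_add.
Proof. by move=> s; apply: cst_eq => b b' /=; rewrite mul0r mulN1r addNr. Qed.

Fact cst_mulA : associative cst_mul.
Proof.
move=> s t u; apply: cst_mul_eq.
exact: isprodA (svalP s) (svalP t) (svalP u) (cst_mulP s t) (cst_mulP _ u) (cst_mulP t u).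
Qed.
Fact cst_mul1l : left_id cst_one cst_mul.
Proof.
move=> t; apply: cst_mul_eq; have := isprod_opl (op_id k) (sval t).
by congr (isprod _ _ _); apply: funext => b; apply: funext => b'; rewrite ext_ket.
Qed.
Fact cst_mul1r : right_id cst_one cst_mul.
Proof. by move=> t; apply/cst_mul_eq/isprod1r/svalP. Qed.
Fact cst_mulDl : left_distributive cst_mul cst_add.
Proof. by move=> s t u; apply/cst_mul_eq/isprodDl; exact: cst_mulP. Qed.
Fact cst_mulDr : right_distributive cst_mul cst_add.
Proof. by move=> s t u; apply/cst_mul_eq/isprodDr; [exact: svalP | exact: cst_mulP..]. Qed.
Fact cst_one_neq0 : cst_one != cst_zero.
Proof.
apply/eqP => /(congr1 (@sval _ _)) H; have [b] := kfun_neq0 k.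
have := congr1 (fun f => f b b) H; rewrite /= mul0r /opf /= ext_ket => ->.
by rewrite eqxx.
Qed.

Fact cst_scaleA (a b : C) t : cst_scale a (cst_scale b t) = cst_scale (a * b) t.
Proof. by apply: cst_eq => ? ? /=; rewrite mulrA. Qed.
Fact cst_scale1 : left_id 1 cst_scale.
Proof. by move=> t; apply: cst_eq => ? ? /=; rewrite mul1r. Qed.
Fact cst_scaleDr : right_distributive cst_scale cst_add.
Proof. by move=> a s t; apply: cst_eq => ? ? /=; rewrite mulrDr. Qed.
Fact cst_scaleDl t : {morph cst_scale^~ t : a b / a + b >-> cst_add a b}.
Proof. by move=> a b; apply: cst_eq => ? ? /=; rewrite mulrDl. Qed.
Fact cst_scaleAl (a : C) s t : cst_scale a (cst_mul s t) = cst_mul (cst_scale a s) t.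
Proof. by symmetry; apply/cst_mul_eq/isprodZl/cst_mulP. Qed.
Fact cst_scaleAr (a : C) s t : cst_scale a (cst_mul s t) = cst_mul s (cst_scale a t).
Proof. by symmetry; apply/cst_mul_eq/isprodZr/cst_mulP. Qed.

End CStar.

HB.instance Definition _ k := GRing.isZmodule.Build (cstar_of k)
  (@cst_addA k) (@cst_addC k) (@cst_add0 k) (@cst_addN k).
HB.instance Definition _ k := GRing.Zmodule_isNzRing.Build (cstar_of k)
  (@cst_mulA k) (@cst_mul1l k) (@cst_mul1r k) (@cst_mulDl k) (@cst_mulDr k)
  (@cst_one_neq0 k).
HB.instance Definition _ k := GRing.Zmodule_isLmodule.Build C (cstar_of k)
  (@cst_scaleA k) (@cst_scale1 k) (@cst_scaleDr k) (@cst_scaleDl k).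
HB.instance Definition _ k := GRing.Lmodule_isLalgebra.Build C (cstar_of k)
  (@cst_scaleAl k).
HB.instance Definition _ k := GRing.Lalgebra_isAlgebra.Build C (cstar_of k)
  (@cst_scaleAr k).

Section CStarAxioms.
Variable k : psd_kernel.
Local Notation A := (cstar_of k).
Implicit Types s t u : A.

Definition cst_norm t : R := tnorm (sval t).

Lemma cst_addE s t b b' : sval (s + t) b b' = sval s b b' + sval t b b'.
Proof. by []. Qed.
Lemma cst_scaleE a t b b' : sval (a *: t) b b' = a * sval t b b'.
Proof. by []. Qed.
Lemma cst_subE s t b b' : sval (s - t) b b' = sval s b b' - sval t b b'.
Proof. by rewrite cst_addE /= mulN1r. Qed.
Lemma ext_cst_sub s t x y : ext (sval (s - t)) x y = ext (sval s) x y - ext (sval t) x y.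
Proof.
rewrite -[- ext _ _ _]mulN1r -ext_scale -ext_add; apply: eq_ext => b b'.
by rewrite cst_subE mulN1r.
Qed.

Fact cst_starK t : cst_star (cst_star t) = t.
Proof. by apply: cst_eq => b b' /=; rewrite conjcK. Qed.
Fact cst_starD s t : cst_star (s + t) = cst_star s + cst_star t.
Proof. by apply: cst_eq => b b' /=; rewrite rmorphD. Qed.
Fact cst_starZ (a : C) t : cst_star (a *: t) = conjc a *: cst_star t.
Proof. by apply: cst_eq => b b' /=; rewrite rmorphM. Qed.
Fact cst_starM s t : cst_star (s * t) = cst_star t * cst_star s.
Proof.
symmetry; apply/cst_mul_eq/isprod_conj; [exact: svalP | exact: svalP |].
exact: cst_mulP.
Qed.
Fact cst_norm_ge0 t : 0 <= cst_norm t.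
Proof. exact/tnorm_ge0/svalP. Qed.
Fact cst_norm_eq0 t : cst_norm t = 0 -> t = 0.
Proof.
move=> t0; apply: cst_eq => b b' /=; rewrite mul0r -[LHS]ext_ket; apply: cabs_eq0.
apply/le_anti; rewrite cabs_ge0 andbT.
by have := tnormP (svalP t) (ket b) (ket b'); rewrite -/(cst_norm t) t0 mul0r.
Qed.
Fact cst_normD s t : cst_norm (s + t) <= cst_norm s + cst_norm t.
Proof.
apply: tnorm_le => x y.
rewrite ext_add mulrDl; apply: le_trans (cabsD _ _) _.
by apply: lerD; apply: tnormP; exact: svalP.
Qed.
Fact cst_normZ_le (a : C) t : cst_norm (a *: t) <= cabs a * cst_norm t.
Proof.
apply: tnorm_le => x y.
rewrite ext_scale cabsM -mulrA ler_wpM2l ?cabs_ge0 //.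
by apply: tnormP; exact: svalP.
Qed.
Fact cst_normZ (a : C) t : cst_norm (a *: t) = Re `|a| * cst_norm t.
Proof.
rewrite -cabsE; apply/le_anti; rewrite cst_normZ_le /=.
have [->|a0] := eqVneq a 0; first by rewrite cabs0 mul0r cst_norm_ge0.
have := cst_normZ_le a^-1 (a *: t); rewrite scalerA mulVf // scale1r.
move/(ler_wpM2l (cabs_ge0 a)); rewrite mulrA -cabsM mulfV // cabs1 mul1r.
exact.
Qed.
Fact cst_normM s t : cst_norm (s * t) <= cst_norm s * cst_norm t.
Proof.
apply: tnorm_le.
by apply: isprod_bnd (cst_mulP s t); exact: svalP.
Qed.
Fact cst_normC t : cst_norm (cst_star t * t) = cst_norm t ^+ 2.
Proof. by apply: tnorm_cstar (cst_mulP (cst_star t) t); exact: svalP. Qed.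

(** The forms converge pointwise, and the Cauchy bound passes to the limit uniformly relative to |x|
    |y|. An operator within e/2 of a late term then approximates the limit form. *)
Fact cst_complete (u : nat -> A) :
  (forall e, 0 < e -> exists N, forall m n, (N <= m)%N -> (N <= n)%N ->
      cst_norm (u m - u n) < e) ->
  exists l, forall e, 0 < e -> exists N, forall n, (N <= n)%N -> cst_norm (u n - l) < e.
Proof.
move=> uC.
have D m n x y : cabs (ext (sval (u m)) x y - ext (sval (u n)) x y)
    <= cst_norm (u m - u n) * (nrm x * nrm y).
  by rewrite -ext_cst_sub; apply: tnormP; exact: svalP.
have uC' (e L : R) : 0 < e -> 0 <= L -> exists N, forall m n, (N <= m)%N -> (N <= n)%N ->
    cst_norm (u m - u n) * L <= e.
  move=> e0 L0; have [d [d0 _ _ dL]] := scale_eps e0 L0.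
  have [N HN] := uC d d0; exists N => m n Nm Nn; apply: (le_trans _ dL).
  by apply: ler_wpM2r => //; apply/ltW/HN.
have zC (p : kbasis k * kbasis k) : exists l, cconv (fun n => sval (u n) p.1 p.2) l.
  apply: complex_cauchy_cvg => e e0; have e20 : 0 < e / 2 by lra.
  have [N HN] := uC' _ _ e20 (nrmM_ge0 (ket p.1) (ket p.2)).
  exists N => m n Nm Nn; have := D m n (ket p.1) (ket p.2); rewrite !ext_ket.
  by have := HN m n Nm Nn; lra.
have [l0 Hl0] := choice zC; pose l b b' := l0 (b, b').
have lE x y : cconv (fun n => ext (sval (u n)) x y) (ext l x y).
  exact: cconv_ext (fun b b' => Hl0 (b, b')).
have lN e : 0 < e -> exists N, forall n, (N <= n)%N -> forall x y,
    cabs (ext (sval (u n)) x y - ext l x y) <= e * (nrm x * nrm y).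
  move=> e0; have [N HN] := uC e e0; exists N => n Nn x y.
  apply: cconv_le (lE x y) _ => d d0; exists N => m Nm.
  apply: le_trans (D n m x y) _; apply: ler_wpDr; first exact: ltW.
  by apply: ler_wpM2r; [exact: nrmM_ge0 | apply/ltW/HN].
have lA : approximable l.
  move=> e e0 e1; have e20 : 0 < e / 2 by lra.
  have e21 : e / 2 <= 1 by lra.
  have [N HN] := lN _ e20; have [T uT] := svalP (u N) _ e20 e21; exists T => x y.
  have := HN N (leqnn _) x y; have := uT x y.
  have := cabs_tri (ext l x y) (ext (@kfun k) x (lin (oT T) y)) (ext (sval (u N)) x y).
  by rewrite (cabsB (ext l x y) (ext (sval (u N)) x y)); lra.
exists (mkA lA) => e e0; have e20 : 0 < e / 2 by lra.
have [N HN] := lN _ e20; exists N => n Nn.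
apply: (@le_lt_trans _ _ (e / 2)); last by lra.
apply: tnorm_le => x y.
by rewrite ext_cst_sub; exact: HN.
Qed.

Definition kernel_cstar : cstar_algebra :=
  @CStarAlgebra (cstar_of k) (@cst_star k) cst_norm (oner_neq0 _)
    cst_starK cst_starD cst_starZ cst_starM cst_norm_ge0 cst_norm_eq0 cst_normD
    cst_normZ cst_normM cst_normC cst_complete.

End CStarAxioms.

(** * Transfer matrices acting on functionals of words *)

Definition rconv (u : nat -> R) l := cconv (fun n => (u n)%:C) l%:C.

Lemma rconv_unique u l l' : rconv u l -> rconv u l' -> l = l'.
Proof. by move=> ul ul'; apply: complexI; exact: cconv_unique ul ul'. Qed.

Lemma eq_rconv u v l : u =1 v -> rconv u l -> rconv v l.
Proof. by move=> uv ul e /ul[N H]; exists N => n /H; rewrite uv. Qed.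

Lemma rconvZ a u l : rconv u l -> rconv (fun n => a * u n) (a * l).
Proof. by move=> ul e /(cconvZ a%:C ul)[N H]; exists N => n /H; rewrite !rmorphM. Qed.

Lemma rconv_sum (I : Type) (r : seq I) (u : I -> nat -> R) (l : I -> R) :
  (forall i, rconv (u i) (l i)) ->
  rconv (fun n => \sum_(i <- r) u i n) (\sum_(i <- r) l i).
Proof.
move=> ul e e0; have [N H] := cconv_sum r ul e0.
by exists N => n /H; rewrite !rmorph_sum.
Qed.

Lemma rconv_cst l : rconv (fun=> l) l.
Proof. by move=> e e0; exists 0%N => n _; rewrite subrr cabs0. Qed.

Section Words.
Variables (S L : finType) (z : S -> S -> L -> L -> R).
Hypothesis z_sym : forall s t p q, z s t p q = z s t q p.
Hypothesis z_symS : forall s t p q, z s t p q = z t s p q.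
Hypothesis z_sum : forall s p q, \sum_t z s t p q = (p == q)%:R.

Local Notation word := (seq L).
Implicit Types (f g : word -> R) (s t c d : S) (p q : L) (u v w : word).

(* [act f s t] is [f] composed with M_st; [c] runs over the intermediate states. *)
Fixpoint act f s t w : R :=
  if w is p :: w' then \sum_c \sum_q z s c p q * act (fun v => f (q :: v)) c t w'
  else (s == t)%:R * f [::].

Lemma eq_act f g s t w : f =1 g -> act f s t w = act g s t w.
Proof.
elim: w f g s => [|p w IH] f g s fg /=; first by rewrite fg.
by apply: eq_bigr => c _; apply: eq_bigr => q _; rewrite (IH _ (fun v => g (q :: v))).
Qed.

Lemma act_add f g s t w : act (fun v => f v + g v) s t w = act f s t w + act g s t w.
Proof.
elim: w f g s => [|p w IH] f g s /=; first by rewrite mulrDr.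
rewrite -big_split; apply: eq_bigr => c _; rewrite -big_split.
by apply: eq_bigr => q _; rewrite IH mulrDr.
Qed.

Lemma act_scale a f s t w : act (fun v => a * f v) s t w = a * act f s t w.
Proof.
elim: w f s => [|p w IH] f s /=; first by rewrite mulrCA.
rewrite mulr_sumr; apply: eq_bigr => c _; rewrite mulr_sumr.
by apply: eq_bigr => q _; rewrite IH mulrCA.
Qed.

Lemma act0 s t w : act (fun=> 0) s t w = 0.
Proof.
by rewrite -[RHS](mul0r (act (fun=> 0) s t w)) -act_scale; apply: eq_act => v; rewrite mul0r.
Qed.

Lemma act_sum (I : Type) (r : seq I) (P : pred I) (F : I -> word -> R) s t w :
  act (fun v => \sum_(i <- r | P i) F i v) s t w = \sum_(i <- r | P i) act (F i) s t w.
Proof.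
elim: r => [|i r IH].
  by rewrite big_nil -[RHS](act0 s t w); apply: eq_act => v; rewrite big_nil.
rewrite big_cons -IH; case: ifP => Pi.
  by rewrite -act_add; apply: eq_act => v; rewrite big_cons Pi.
by apply: eq_act => v; rewrite big_cons Pi.
Qed.

Lemma act1 f s t p : act f s t [:: p] = \sum_q z s t p q * f [:: q].
Proof.
rewrite /= (bigD1 t) //= [X in _ + X]big1 ?addr0 => [|c ct].
  by apply: eq_bigr => q _; rewrite eqxx mul1r.
by rewrite big1 // => q _; rewrite (negPf ct) mul0r mulr0.
Qed.

(** M_st sums over paths of states from s to t that advance once per letter; cutting the word cuts
    the path, and [c] is the state at the cut. *)
Lemma act_cat f s t u v :
  act f s t (u ++ v) = \sum_c act (fun u' => act (fun v' => f (u' ++ v')) c t v) s c u.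
Proof.
elim: u f s => [|p u IH] f s /=.
  rewrite (bigD1 s) //= eqxx mul1r big1 ?addr0 // => c cs.
  by rewrite eq_sym (negPf cs) mul0r.
rewrite [RHS]exchange_big /=; apply: eq_bigr => c _; rewrite [RHS]exchange_big /=.
by apply: eq_bigr => q _; rewrite IH mulr_sumr.
Qed.

(** Reading a word backwards reverses the path of states, and [z_symS] leaves the weight of each
    step unchanged. *)
Lemma act_rev f s t w : act f s t (rev w) = act (fun v => f (rev v)) t s w.
Proof.
elim: w f s t => [|p w IH] f s t; first by rewrite /= eq_sym.
rewrite rev_cons -cats1 act_cat [RHS]/=; apply: eq_bigr => c _.
rewrite IH (eq_act (g := fun v => \sum_q z t c p q * f (rev (q :: v)))) => [|v].
  by rewrite act_sum; apply: eq_bigr => q _; rewrite act_scale.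
rewrite act1; apply: eq_bigr => q _.
by rewrite z_symS rev_cons -cats1.
Qed.

Lemma act_exchange (f : word -> word -> R) s t s' t' w w' :
  act (fun u => act (f u) s' t' w') s t w = act (fun v => act (f^~ v) s t w) s' t' w'.
Proof.
elim: w f s => [|p w IH] f s /=; first by rewrite act_scale.
rewrite act_sum; apply: eq_bigr => c _; rewrite act_sum; apply: eq_bigr => q _.
by rewrite act_scale -IH.
Qed.

Lemma act_sumr f s w : \sum_t act f s t w = f w.
Proof.
elim: w f s => [|p w IH] f s /=.
  rewrite (bigD1 s) //= eqxx mul1r big1 ?addr0 // => c cs.
  by rewrite eq_sym (negPf cs) mul0r.
rewrite exchange_big /=; under eq_bigr do rewrite exchange_big /=.
under eq_bigr do under eq_bigr do rewrite -mulr_sumr IH.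
rewrite exchange_big /= (bigD1 p) //= -mulr_suml z_sum eqxx mul1r.
by rewrite big1 ?addr0 // => q qp; rewrite -mulr_suml z_sum eq_sym (negPf qp) mul0r.
Qed.

Lemma act_suml f t w : \sum_s act f s t w = f w.
Proof.
rewrite -(revK w); under eq_bigr do rewrite act_rev.
by rewrite (act_sumr (fun v => f (rev v))).
Qed.

Lemma act_act_cons f s t s' t' p w :
  act (act f s t) s' t' (p :: w) =
  \sum_c \sum_d \sum_r (\sum_q z s' c p q * z s d q r) *
     act (act (fun v => f (r :: v)) d t) c t' w.
Proof.
rewrite [LHS]/=; apply: eq_bigr => c _.
under eq_bigr => q _.
  rewrite [X in _ * act X _ _ _](_ : _ = fun v =>
    \sum_d \sum_r z s d q r * act (fun v' => f (r :: v')) d t v) //.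
  rewrite act_sum mulr_sumr; under eq_bigr do rewrite act_sum mulr_sumr.
  over.
rewrite exchange_big; apply: eq_bigr => d _; rewrite exchange_big; apply: eq_bigr => r _.
by rewrite mulr_suml; apply: eq_bigr => q _; rewrite act_scale mulrA.
Qed.

(** A composite of two transfer matrices sums over pairs of paths. A pair starting in [A] and ending
    outside it leaves [A] at some letter, where the product of the coefficient matrices is zero.
    Equality as [A] gives orthogonality along rows, inequality along columns. *)
Lemma act_act0 (A : rel S) :
  (forall s s' d c p r, A s s' -> ~~ A d c -> \sum_q z s' c p q * z s d q r = 0) ->
  forall f s t s' t' w, A s s' -> ~~ A t t' -> act (act f s t) s' t' w = 0.
Proof.
move=> zA f s t s' t' w; elim: w f s s' => [|p w IH] f s s' Ass' Att'.
  rewrite /=; have [s't|_] := eqVneq s' t'; last by rewrite mul0r.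
  have [st|_] := eqVneq s t; last by rewrite mul0r mulr0.
  by move: Att'; rewrite -st -s't Ass'.
rewrite act_act_cons big1 // => c _; rewrite big1 // => d _; rewrite big1 // => r _.
case: (boolP (A d c)) => Adc; first by rewrite IH ?mulr0.
by rewrite (zA _ _ _ _ _ _ Ass' Adc) mul0r.
Qed.

Definition kills (A : rel L) f :=
  forall u v p q, A p q -> f (u ++ p :: q :: v) = 0.

(** [kills] is the relation Q_p Q_q = 0 read on a functional. After summation over the state between
    the two letters, a pair in [A] is sent only to pairs in [A], where [f] already vanishes. *)
Lemma act_kills (A : rel L) f s t :
  (forall c e p q p' q', A p q -> ~~ A p' q' -> \sum_d z c d p p' * z d e q q' = 0) ->
  kills A f -> kills A (act f s t).
Proof.
move=> zA fA u v p q Apq; rewrite act_cat big1 // => c _.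
rewrite -[RHS](act0 s c u); apply: eq_act => u' /=.
transitivity (\sum_p' \sum_e \sum_q' (\sum_d z c d p p' * z d e q q') *
   act (fun v' => f (u' ++ p' :: q' :: v')) e t v).
  rewrite exchange_big; apply: eq_bigr => p' _ /=.
  under eq_bigr do rewrite mulr_sumr.
  rewrite exchange_big; apply: eq_bigr => e _ /=.
  under eq_bigr do rewrite mulr_sumr.
  rewrite exchange_big; apply: eq_bigr => q' _ /=.
  by rewrite mulr_suml; apply: eq_bigr => d _; rewrite mulrA.
rewrite big1 // => p' _; rewrite big1 // => e _; rewrite big1 // => q' _.
case: (boolP (A p' q')) => Apq'; last by rewrite (zA _ _ _ _ _ _ Apq) ?mul0r.
by rewrite (eq_act (g := fun=> 0)) ?act0 ?mulr0 // => v'; rewrite fA.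
Qed.

Definition sums (I : finType) (X : I -> pred L) f :=
  forall i u v, \sum_(p | X i p) f (u ++ p :: v) = f (u ++ v).

(** [sums] says that the Q_p over each fibre add up to 1. The coefficients take a sum over one fibre
    to a combination of sums over fibres; [f] deletes each of these, and the weights that remain add
    up to [c = d], so the path does not move. *)
Lemma act_sums (I : finType) (X : I -> pred L) (g : S -> S -> I -> I -> R) f s t :
  (forall c d i q, \sum_(p | X i p) z c d p q = \sum_j g c d i j * (X j q)%:R) ->
  (forall c d i, \sum_j g c d i j = (c == d)%:R) ->
  sums X f -> sums X (act f s t).
Proof.
move=> zX g1 fX i u v; under eq_bigr do rewrite act_cat.
rewrite exchange_big act_cat; apply: eq_bigr => c _ /=.
rewrite -act_sum; apply: eq_act => u' /=.
transitivity (\sum_d (\sum_j g c d i j) * act (fun v' => f (u' ++ v')) d t v).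
  rewrite exchange_big; apply: eq_bigr => d _ /=; rewrite exchange_big /=.
  under eq_bigr do rewrite -mulr_suml zX mulr_suml.
  rewrite exchange_big mulr_suml; apply: eq_bigr => j _ /=.
  under eq_bigr do rewrite -mulrA; rewrite -mulr_sumr; congr (_ * _).
  rewrite (eq_act (g := fun v' => \sum_(p | X j p) f (u' ++ p :: v'))) => [|v'].
    rewrite act_sum [RHS]big_mkcond; apply: eq_bigr => q _.
    by case: (X j q); rewrite ?mul1r ?mul0r.
  by rewrite fX.
rewrite (bigD1 c) //= g1 eqxx mul1r big1 ?addr0 // => d dc.
by rewrite g1 eq_sym (negPf dc) mul0r.
Qed.

(** * Convergence of the averages, one word length at a time *)

Fixpoint dot m f g : R :=
  if m is m'.+1 then \sum_p dot m' (fun v => f (p :: v)) (fun v => g (p :: v))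
  else f [::] * g [::].

Lemma eq_dot m f f' g g' : f =1 f' -> g =1 g' -> dot m f g = dot m f' g'.
Proof.
elim: m f f' g g' => [|m IH] f f' g g' ff' gg' /=; first by rewrite ff' gg'.
by apply: eq_bigr => p _; apply: IH => v.
Qed.

Lemma dotC m f g : dot m f g = dot m g f.
Proof.
elim: m f g => [|m IH] f g /=; first exact: mulrC.
by apply: eq_bigr => p _; rewrite IH.
Qed.

Lemma dotDl m f f' g : dot m (fun w => f w + f' w) g = dot m f g + dot m f' g.
Proof.
elim: m f f' g => [|m IH] f f' g /=; first exact: mulrDl.
by rewrite -big_split; apply: eq_bigr => p _; rewrite IH.
Qed.

Lemma dotZl m a f g : dot m (fun w => a * f w) g = a * dot m f g.
Proof.
elim: m f g => [|m IH] f g /=; first by rewrite mulrA.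
by rewrite mulr_sumr; apply: eq_bigr => p _; rewrite IH.
Qed.

Lemma dotDr m f g g' : dot m f (fun w => g w + g' w) = dot m f g + dot m f g'.
Proof. by rewrite dotC dotDl !(dotC _ f). Qed.

Lemma dotZr m a f g : dot m f (fun w => a * g w) = a * dot m f g.
Proof. by rewrite dotC dotZl dotC. Qed.

Lemma dot_suml m (I : Type) (r : seq I) (F : I -> word -> R) g :
  dot m (fun w => \sum_(i <- r) F i w) g = \sum_(i <- r) dot m (F i) g.
Proof.
elim: r => [|i r IH].
  rewrite big_nil -[RHS](mul0r (dot m (fun=> 0) g)) -dotZl.
  by apply: eq_dot => // w; rewrite big_nil mul0r.
by rewrite big_cons -IH -dotDl; apply: eq_dot => // w; rewrite big_cons.
Qed.

Lemma dot_sumr m (I : Type) (r : seq I) (F : I -> word -> R) g :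
  dot m g (fun w => \sum_(i <- r) F i w) = \sum_(i <- r) dot m g (F i).
Proof. by rewrite dotC dot_suml; apply: eq_bigr => i _; rewrite dotC. Qed.

Lemma dot_ge0 m f : 0 <= dot m f f.
Proof.
elim: m f => [|m IH] f /=; first exact: sqr_ge0.
by apply: sumr_ge0 => p _; exact: IH.
Qed.

Lemma dot_ge_sqr f w : f w ^+ 2 <= dot (size w) f f.
Proof.
elim: w f => [|p w IH] f /=; first by rewrite expr2.
rewrite (bigD1 p) //=; apply: ler_wpDr; first by apply: sumr_ge0 => q _; exact: dot_ge0.
exact: (IH (fun v => f (p :: v))).
Qed.

(** M_st preserves word length, and [z_sym] makes it symmetric on the finite-dimensional space of
    functions of words of length [m]; with [act_idem] it is an orthogonal projection there. *)
Lemma dot_act m f g s t : dot m (act f s t) g = dot m f (act g s t).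
Proof.
elim: m f g s => [|m IH] f g s /=; first by rewrite mulrCA mulrA.
under eq_bigr do rewrite dot_suml.
under [RHS]eq_bigr do rewrite dot_sumr.
rewrite exchange_big [RHS]exchange_big; apply: eq_bigr => c _ /=.
under eq_bigr do rewrite dot_suml.
under [RHS]eq_bigr do rewrite dot_sumr.
rewrite exchange_big; apply: eq_bigr => q _; apply: eq_bigr => p _ /=.
by rewrite dotZl dotZr IH z_sym.
Qed.

Hypothesis z_row : forall s d c p r, d != c -> \sum_q z s c p q * z s d q r = 0.
Hypothesis z_col : forall s s' c p r, s != s' -> \sum_q z s' c p q * z s c q r = 0.
Hypothesis S_gt0 : (0 < #|S|)%N.

Lemma act_row f s t t' w : t != t' -> act (act f s t) s t' w = 0.
Proof.
move=> tt'; apply: (@act_act0 eq_op) => // {}s s' d c p r /eqP <-.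
exact: z_row.
Qed.

Lemma act_col f s s' t w : s != s' -> act (act f s t) s' t w = 0.
Proof.
move=> ss'; apply: (@act_act0 (fun a b => a != b)) => //; last by rewrite eqxx.
by move=> a b d c p r ab /negPn/eqP ->; exact: z_col.
Qed.

(** Expand the argument by the partition sum over [c] of M_sc; row orthogonality leaves only
    [c = t]. *)
Lemma act_idem f s t w : act (act f s t) s t w = act f s t w.
Proof.
rewrite -[RHS](eq_act s t w (f := fun v => \sum_c act f s c v)) => [|v]; last exact: act_sumr.
rewrite act_sum (bigD1 t) //= big1 ?addr0 // => c ct; exact: act_row.
Qed.

Local Notation nS := (#|S|%:R : R).

Definition avg f w : R := nS^-1 * \sum_s act f s s w.

Lemma nS_gt0 : 0 < nS. Proof. by rewrite ltr0n. Qed.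

Lemma dot_avgr m f g : dot m f (avg g) = nS^-1 * \sum_s dot m f (act g s s).
Proof. by rewrite dotZr dot_sumr. Qed.

Lemma dot_avg m f g : dot m (avg f) g = dot m f (avg g).
Proof.
rewrite dot_avgr dotZl dot_suml; congr (_ * _); apply: eq_bigr => s _.
exact: dot_act.
Qed.

Lemma dot_act_idem m f s : dot m (act f s s) (act f s s) = dot m f (act f s s).
Proof. by rewrite dot_act; apply: eq_dot => // w; exact: act_idem. Qed.

Lemma dot_sub m f g :
  dot m (fun w => f w + (-1) * g w) (fun w => f w + (-1) * g w)
  = dot m f f - 2 * dot m f g + dot m g g.
Proof. by rewrite !dotDl !dotDr !dotZl !dotZr (dotC m g f); lra. Qed.

(** The defect of the average is a sum of squared distances to the ranges of the projections. It
    bounds the average by 1, and when it vanishes it forces invariance under every single M_ss. *)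
Lemma dot_sub_act m f :
  \sum_s dot m (fun w => f w + (-1) * act f s s w) (fun w => f w + (-1) * act f s s w)
  = nS * (dot m f f - dot m f (avg f)).
Proof.
rewrite dot_avgr mulrBr mulrA mulfV ?gt_eqF ?nS_gt0 // mul1r.
rewrite mulr_natl -sumr_const -sumrB; apply: eq_bigr => s _.
by rewrite dot_sub dot_act_idem; lra.
Qed.

Lemma dot_avg_le1 m f : dot m f (avg f) <= dot m f f.
Proof.
have : 0 <= nS * (dot m f f - dot m f (avg f)).
  by rewrite -dot_sub_act; apply: sumr_ge0 => s _; exact: dot_ge0.
by rewrite pmulr_rge0 ?nS_gt0 // subr_ge0.
Qed.

(** The difference of the two sides is the variance over [s] of the vectors M_ss f, whose mean is
    [avg f]. *)
Lemma dot_avg_le2 m f : dot m (avg f) (avg f) <= dot m f (avg f).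
Proof.
have : 0 <= nS * (dot m f (avg f) - dot m (avg f) (avg f)).
  suff <- : \sum_s dot m (fun w => act f s s w + (-1) * avg f w)
     (fun w => act f s s w + (-1) * avg f w)
     = nS * (dot m f (avg f) - dot m (avg f) (avg f)).
    by apply: sumr_ge0 => s _; exact: dot_ge0.
  under eq_bigr do rewrite dot_sub dot_act_idem.
  rewrite !big_split /= sumrN -mulr_sumr sumr_const -mulr_natl.
  have E g : \sum_s dot m g (act f s s) = nS * dot m g (avg f).
    by rewrite dot_avgr mulrA mulfV ?gt_eqF ?nS_gt0 // mul1r.
  have E' : \sum_s dot m (act f s s) (avg f) = nS * dot m (avg f) (avg f).
    by rewrite -E; apply: eq_bigr => s _; rewrite dotC.
  by rewrite E E'; lra.
by rewrite pmulr_rge0 ?nS_gt0 // subr_ge0.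
Qed.

Lemma dot_iter_avg m f i j :
  dot m (iter i avg f) (iter j avg f) = dot m f (iter (i + j) avg f).
Proof.
elim: i j => [|i IH] j; first by [].
by rewrite iterS dot_avg -[avg (iter j _ _)]iterS IH addSnnS.
Qed.

(* The Gram matrix of the iterates depends on [i + j] only and decreases. *)
Lemma iter_avg_cauchy f w (e : R) : 0 < e ->
  exists N, forall i j, (N <= i)%N -> (N <= j)%N ->
  `|iter i avg f w - iter j avg f w| < e.
Proof.
move=> e0; pose m := size w; pose a i := dot m f (iter i avg f).
have aS i : a i.+1 <= a i.
  (* With g the j-th iterate, an even index asks for <g, avg g> <= <g, g> and an odd one for <avg g,
     avg g> <= <g, avg g>. *)
  have [j [->|->]] : exists j, i = (j + j)%N \/ i = (j + j).+1.
  - have := odd_double_half i; rewrite -addnn.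
    by case: (odd i) => /= E; exists i./2; [right | left].
  - by rewrite /a -addnS -!dot_iter_avg; exact: dot_avg_le1.
  - by rewrite /a -[in X in _ <= X]addnS -addSn -addnS -!dot_iter_avg; exact: dot_avg_le2.
have a_anti i j : (i <= j)%N -> a j <= a i.
  by move=> /subnKC <-; elim: (j - i)%N => [|d IH]; rewrite ?addn0 // addnS (le_trans (aS _)).
have a0 i : 0 <= a i.
  apply: le_trans (a_anti _ _ (leq_addl i i)).
  by rewrite /a -dot_iter_avg dot_ge0.
(* The squared distance of two iterates is a(2i) - 2 a(i+j) + a(2j); both outer terms are less than
   e^2/2 above the infimum, and the middle one is at least the infimum. *)
have d0 : 0 < e ^+ 2 / 2 by rewrite divr_gt0 // exprn_gt0.
pose E : set R := fun x => exists i, x = a i.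
have Einf : has_inf E by split; [exists (a 0%N), 0%N | exists 0 => x [i ->]].
have [x [N ->] aN] := inf_adherent d0 Einf.
have aE i : inf E <= a i by apply: ge_inf; [exact: Einf.2 | exists i].
exists N => i j Ni Nj; rewrite -(@ltr_pXn2r _ 2) ?nnegrE ?normr_ge0 ?ltW //.
rewrite real_normK ?num_real // -mulN1r.
apply: le_lt_trans (dot_ge_sqr (fun w => iter i avg f w + (-1) * iter j avg f w) w) _.
rewrite dot_sub !dot_iter_avg -/m -!/(a _).
have := a_anti _ _ (leq_trans Ni (leq_addr i i)).
have := a_anti _ _ (leq_trans Nj (leq_addr j j)).
have := aE (i + j)%N; lra.
Qed.

Lemma rconv_act (F : nat -> word -> R) f s t w :
  (forall v, rconv (fun n => F n v) (f v)) -> rconv (fun n => act (F n) s t w) (act f s t w).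
Proof.
elim: w F f s => [|p w IH] F f s Ff /=; first exact: rconvZ.
by do 2!apply: rconv_sum => ?; apply/rconvZ/IH.
Qed.

Lemma avg_limit f : exists g, forall w, rconv (fun n => iter n avg f w) (g w).
Proof.
suff H w : exists l, rconv (fun n => iter n avg f w) l by have [g] := choice H; exists g.
have [l Hl] := real_cauchy_cvg (@iter_avg_cauchy f w).
exists l => e /Hl[N HN]; exists N => n /HN; rewrite -rmorphB.
by rewrite /cabs /= expr0n addr0 sqrtr_sqr.
Qed.

(** * Invariance of the limit and the relations it inherits *)

Section Limit.
Variables f g : word -> R.
Hypothesis fg : forall w, rconv (fun n => iter n avg f w) (g w).

Lemma limit_avg w : avg g w = g w.
Proof.
apply: (@rconv_unique (fun n => iter n.+1 avg f w)).
  by apply/rconvZ/rconv_sum => s; exact: rconv_act.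
by move=> e /(fg w)[N H]; exists N => n Nn; apply/H/leqW.
Qed.

(** For a fixed point of the average the right side of [dot_sub_act] is zero, so each squared
    distance on the left is zero. *)
Lemma limit_actss s w : act g s s w = g w.
Proof.
have : \sum_t dot (size w) (fun w => g w + (-1) * act g t t w)
   (fun w => g w + (-1) * act g t t w) = 0.
  rewrite dot_sub_act (eq_dot (size w) (f := g) (f' := g) (g' := g)) ?subrr ?mulr0 //.
  exact: limit_avg.
move/eqP; rewrite psumr_eq0 => [/allP/(_ s)|t _]; last exact: dot_ge0.
rewrite mem_index_enum => /(_ isT)/eqP H.
have := dot_ge_sqr (fun w => g w + (-1) * act g s s w) w; rewrite H.
rewrite mulN1r => gs; have /eqP : (g w - act g s s w) ^+ 2 = 0.
  by apply/le_anti; rewrite gs sqr_ge0.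
by rewrite expf_eq0 /= subr_eq0 => /eqP.
Qed.

(** Off the diagonal, replace g by g o M_ss; then M_ss M_st = 0 by row orthogonality. *)
Lemma limit_act s t w : act g s t w = (s == t)%:R * g w.
Proof.
have [->|st] := eqVneq s t; first by rewrite mul1r limit_actss.
rewrite mul0r -(act_row g s w st); apply: eq_act => v; exact/esym/limit_actss.
Qed.

Lemma limit_nil : g [::] = f [::].
Proof.
apply: (@rconv_unique (fun n => iter n avg f [::])) => //.
have H n : iter n avg f [::] = f [::].
  elim: n => //= n IH; rewrite /avg /=; under eq_bigr do rewrite eqxx mul1r IH.
  by rewrite sumr_const -[f _ *+ _]mulr_natl mulrA mulVf ?mul1r // gt_eqF ?nS_gt0.
by apply: eq_rconv (rconv_cst (f [::])) => n; rewrite H.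
Qed.

Lemma limit_rev : (forall w, f (rev w) = f w) -> forall w, g (rev w) = g w.
Proof.
move=> fr w; apply: rconv_unique (fg (rev w)) _.
apply: eq_rconv (fg w) => n; elim: n w => [|n IH] w /=; first by rewrite fr.
congr (_ * _); apply: eq_bigr => s _; rewrite act_rev; apply: eq_act => v.
by rewrite IH.
Qed.

Lemma limit_kills (A : rel L) :
  (forall c e p q p' q', A p q -> ~~ A p' q' -> \sum_d z c d p p' * z d e q q' = 0) ->
  kills A f -> kills A g.
Proof.
move=> zA fA u v p q Apq; apply: rconv_unique (fg _) _.
apply: eq_rconv (rconv_cst 0) => n.
suff: kills A (iter n avg f) by move->.
elim: n => // n IH {}u {}v {}p {}q {}Apq /=; rewrite /avg big1 ?mulr0 // => s _.
exact: (act_kills s s zA IH).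
Qed.

Lemma limit_sums (I : finType) (X : I -> pred L) (h : S -> S -> I -> I -> R) :
  (forall c d i q, \sum_(p | X i p) z c d p q = \sum_j h c d i j * (X j q)%:R) ->
  (forall c d i, \sum_j h c d i j = (c == d)%:R) ->
  sums X f -> sums X g.
Proof.
move=> zX h1 fX i u v; apply: rconv_unique (fg (u ++ v)).
have H n : sums X (iter n avg f).
  elim: n => // n IH {}i {}u {}v /=; rewrite /avg -mulr_sumr exchange_big /=.
  by congr (_ * _); apply: eq_bigr => s _; exact: (act_sums s s zX h1 IH).
rewrite -big_filter; have := rconv_sum [seq p <- index_enum L | X i p] (fun p => fg (u ++ p :: v)).
by apply: eq_rconv => n; rewrite big_filter H.
Qed.

End Limit.

End Words.

Lemma ext_sum (B I : Type) (r : seq I) (t : I -> B -> B -> C) x y :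
  ext (fun b b' => \sum_(i <- r) t i b b') x y = \sum_(i <- r) ext (t i) x y.
Proof.
elim: r => [|i r IH].
  rewrite big_nil /ext big1 // => p _; rewrite big1 // => q _.
  by rewrite big_nil mulr0.
by rewrite big_cons -IH -ext_add; apply: eq_ext => b b'; rewrite big_cons.
Qed.

Lemma ext_lin_lin (B : Type) (t : B -> B -> C) S T x y :
  ext t (lin S x) (lin T y) = ext (fun b b' => ext t (S b) (T b')) x y.
Proof.
rewrite ext_linr ext_linl; apply: eq_ext => b b'.
by rewrite -ext_linr lin_ket.
Qed.

Lemma cconv_ge0 (u : nat -> C) l : cconv u l -> (forall n, 0 <= u n) -> 0 <= l.
Proof.
move=> ul u0; rewrite lecE; apply/andP; split.
  rewrite -normr_eq0; apply/eqP/le_anti; rewrite normr_ge0 andbT.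
  apply: (@le_of_eps _ _ 1) => e /ul[N HN] _; rewrite add0r mulr1.
  have := HN N (leqnn _); have := Im_le_cabs (u N - l); have := ger0_Im (u0 N).
  case: (u N) l {ul HN} => a b [c d] /= ->; rewrite sub0r normrN; lra.
apply: (@le_of_eps _ _ 1) => e /ul[N HN] _.
have := HN N (leqnn _); have := Re_le_cabs (u N - l); have := u0 N.
rewrite lecE => /andP[_]; case: (u N) l {ul HN} => a b [c d] /= a0.
by rewrite ler_norml => /andP[]; lra.
Qed.

(** * Positivity of the averages and self-adjointness from invariance *)

Section WordKernel.
Variables (S L : finType) (z : S -> S -> L -> L -> R).
Hypothesis z_sym : forall s t p q, z s t p q = z s t q p.
Hypothesis z_symS : forall s t p q, z s t p q = z t s p q.
Hypothesis z_sum : forall s p q, \sum_t z s t p q = (p == q)%:R.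
Hypothesis z_row : forall s d c p r, d != c -> \sum_q z s c p q * z s d q r = 0.
Hypothesis z_col : forall s s' c p r, s != s' -> \sum_q z s' c p q * z s c q r = 0.
Hypothesis S_gt0 : (0 < #|S|)%N.
Local Notation word := (seq L).
Local Notation act := (act z).

Fixpoint mv (s t : S) (w : word) : vec word :=
  if w is p :: w' then
    flatten [seq flatten [seq [seq ((z s c p q)%:C * r.1, q :: r.2) | r <- mv c t w']
      | q <- enum L] | c <- enum S]
  else [:: ((s == t)%:R%:C, [::])].

Lemma mvE (f : word -> R) s t w :
  \sum_(r <- mv s t w) r.1 * (f r.2)%:C = (act f s t w)%:C.
Proof.
elim: w f s => [|p w IH] f s; first by rewrite big_seq1 rmorphM.
rewrite big_flatten big_map big_enum /= rmorph_sum; apply: eq_bigr => c _.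
rewrite big_flatten big_map big_enum /= rmorph_sum; apply: eq_bigr => q _.
rewrite big_map rmorphM /= -IH mulr_sumr; apply: eq_bigr => r _ /=.
by rewrite mulrA.
Qed.

Lemma mvJE (f : word -> R) s t w :
  \sum_(r <- mv s t w) conjc r.1 * (f r.2)%:C = (act f s t w)%:C.
Proof.
elim: w f s => [|p w IH] f s; first by rewrite big_seq1 conjc_real rmorphM.
rewrite big_flatten big_map big_enum /= rmorph_sum; apply: eq_bigr => c _.
rewrite big_flatten big_map big_enum /= rmorph_sum; apply: eq_bigr => q _.
rewrite big_map rmorphM /= -IH mulr_sumr; apply: eq_bigr => r _ /=.
by rewrite rmorphM /= conjc_real mulrA.
Qed.

Definition kern (f : word -> R) w w' : C := (f (rev w ++ w'))%:C.

Lemma kern_mvr f w s t w' :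
  ext (kern f) (ket w) (mv s t w') = (act (fun v => f (rev w ++ v)) s t w')%:C.
Proof.
rewrite ext_expandr -mvE; apply: eq_bigr => r _; by rewrite ext_ket.
Qed.

Lemma kern_mvlr f w s t s' t' w' :
  ext (kern f) (mv s t w) (mv s' t' w') =
  (act (fun u => act (fun v => f (rev u ++ v)) s' t' w') s t w)%:C.
Proof.
rewrite ext_expandl -(mvJE (fun u => act (fun v => f (rev u ++ v)) s' t' w')).
by apply: eq_bigr => r _; rewrite kern_mvr.
Qed.

Definition psd (f : word -> R) := forall x, 0 <= ext (kern f) x x.

(** Cutting M_ss at the seam of [rev w ++ w'] and reversing the left half writes the new kernel as a
    positive multiple of the sum over s, c of <M_cs w, M_cs w'>. *)
Lemma psd_avg f : psd f -> psd (avg z f).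
Proof.
move=> f0 x.
have -> : ext (kern (avg z f)) x x = (#|S|%:R^-1 : R)%:C *
    \sum_s \sum_c ext (kern f) (lin (mv c s) x) (lin (mv c s) x).
  under eq_bigr do under eq_bigr do rewrite ext_lin_lin.
  under eq_bigr do rewrite -ext_sum.
  rewrite -ext_sum -ext_scale; apply: eq_ext => w w'.
  rewrite /kern /avg rmorphM; congr (_ * _); rewrite rmorph_sum; apply: eq_bigr => s _.
  rewrite act_cat rmorph_sum; apply: eq_bigr => c _.
  by rewrite (act_rev z_symS) kern_mvlr.
rewrite mulr_ge0 ?ler0c ?invr_ge0 ?ler0n //.
by apply: sumr_ge0 => s _; apply: sumr_ge0 => c _.
Qed.

Lemma psd_limit f g :
  (forall w, rconv (fun n => iter n (avg z) f w) (g w)) -> psd f -> psd g.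
Proof.
move=> fg f0 x; apply: (@cconv_ge0 (fun n => ext (kern (iter n (avg z) f)) x x)).
  by apply: cconv_ext => w w'; exact: fg.
move=> n; elim: n x => [|n IH] x; first exact: f0.
by rewrite /=; apply: psd_avg.
Qed.

(* Comparing both halves of [rev w ++ w'] turns invariance of [g] under the
   transfer matrices into their self-adjointness for the kernel. *)
Lemma act_selfadj g : (forall s t w, act g s t w = (s == t)%:R * g w) ->
  forall s t w w', act (fun v => g (rev w ++ v)) s t w' = act (fun v => g (rev v ++ w')) s t w.
Proof.
move=> gI d a w w'.
(* Invariance under M_aa, cut at the seam, reads: the sum over c of <M_ca u, M_ca v> is <u, v>. *)
have star u v : \sum_c act (fun u' => act (fun v' => g (rev u' ++ v')) c a v) c a u
    = g (rev u ++ v).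
  have := gI a a (rev u ++ v); rewrite eqxx mul1r => <-.
  rewrite act_cat; apply: eq_bigr => c _.
  by rewrite (act_rev z_symS).
(* Both sides equal <M_da w, M_da w'>: after [star] is inserted, column orthogonality removes every
   c other than d, and idempotence absorbs the repeated factor. *)
transitivity (act (fun u' => act (fun v' => g (rev u' ++ v')) d a w') d a w).
  rewrite (eq_act z (g := fun v => \sum_c act (fun u' => act (fun v' => g (rev u' ++ v')) c a v) c a w));
    last by move=> v; rewrite star.
  rewrite act_sum (bigD1 d) //= [X in _ + X]big1 ?addr0 => [|c cd].
    rewrite (eq_act z (g := fun v => act (fun v' => act (fun u' => g (rev u' ++ v')) d a w) d a v)).
      by rewrite (act_idem z_sum z_row) act_exchange.
    by move=> v; rewrite act_exchange.
  rewrite (eq_act z (g := fun v => act (fun v' => act (fun u' => g (rev u' ++ v')) c a w) c a v)).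
    by rewrite (act_col z_col).
  by move=> v; rewrite act_exchange.
rewrite [RHS](eq_act z (g := fun u => \sum_c act (fun u' => act (fun v' => g (rev u' ++ v')) c a w') c a u));
  last by move=> v; rewrite star.
rewrite act_sum (bigD1 d) //= [X in _ + X]big1 ?addr0 => [|c cd].
  by rewrite (act_idem z_sum z_row).
by rewrite (act_col z_col).
Qed.

End WordKernel.

(** * The invariant state attached to two Hadamard matrices *)

Lemma sum_pair_mul (K : pzRingType) (I J : finType) (F : I -> K) (G : J -> K) :
  \sum_(q : I * J) F q.1 * G q.2 = (\sum_i F i) * (\sum_j G j).
Proof.
rewrite mulr_suml; under [RHS]eq_bigr do rewrite mulr_sumr.
by rewrite pair_bigA.
Qed.

Section SignMatrix.
Variables (n : nat) (a : 'I_n -> 'I_n -> R).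
Hypothesis a_sqr : forall i l, a i l * a i l = 1.
Hypothesis a_row : forall i i', \sum_l a i l * a i' l = n%:R * (i == i')%:R.
Hypothesis a_col : forall l l', \sum_i a i l * a i l' = n%:R * (l == l')%:R.
Hypothesis n_gt0 : (0 < n)%N.

Definition zeta i i' l l' : R := n%:R^-1 * (a i l * a i' l * (a i l' * a i' l')).

Lemma zeta_sym i i' l l' : zeta i i' l l' = zeta i i' l' l.
Proof. by rewrite /zeta [X in _ * X]mulrC. Qed.

Lemma zeta_symS i i' l l' : zeta i i' l l' = zeta i' i l l'.
Proof. by rewrite /zeta ![a i _ * _]mulrC. Qed.

Lemma nV_n : (n%:R : R)^-1 * n%:R = 1.
Proof. by rewrite mulVf // pnatr_eq0 -lt0n. Qed.

Lemma zeta_sumS i l l' : \sum_i' zeta i i' l l' = (l == l')%:R.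
Proof.
transitivity (n%:R^-1 * (a i l * a i l') * \sum_i' a i' l * a i' l').
  by rewrite mulr_sumr; apply: eq_bigr => i' _; rewrite /zeta; ring.
rewrite a_col mulrACA [n%:R^-1 * _]mulrC -mulrA; have [->|_] := eqVneq l l'.
  by rewrite a_sqr mul1r mulrCA mulrA nV_n !mulr1.
by rewrite !mulr0.
Qed.

Lemma zeta_sumL i i' l : \sum_l' zeta i i' l l' = (i == i')%:R.
Proof.
transitivity (n%:R^-1 * (a i l * a i' l) * \sum_l' a i l' * a i' l').
  by rewrite mulr_sumr; apply: eq_bigr => l' _; rewrite /zeta; ring.
rewrite a_row; have [->|_] := eqVneq i i'; last by rewrite !mulr0.
by rewrite a_sqr !mulr1 nV_n.
Qed.

(** Each coefficient matrix is the projection onto a vector of products of two rows, and the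
    remaining sum is the inner product of two such vectors. A shared row cancels by [a_sqr], which
    leaves the orthogonality of two rows of [a]. *)
Lemma zeta_mulL s t s' t' p r : \sum_q zeta s t p q * zeta s' t' q r =
  n%:R^-1 ^+ 2 * (a s p * a t p * a s' r * a t' r)
  * \sum_q (a s q * a t q * (a s' q * a t' q)).
Proof. by rewrite mulr_sumr; apply: eq_bigr => q _; rewrite /zeta; ring. Qed.

Lemma zeta_rowL s t t' p r : t' != t -> \sum_q zeta s t p q * zeta s t' q r = 0.
Proof.
move=> tt'; rewrite zeta_mulL (eq_bigr (fun q => a t q * a t' q)) => [|q _].
  by rewrite a_row eq_sym (negPf tt') !mulr0.
by rewrite mulrACA a_sqr mul1r.
Qed.

Lemma zeta_colL s s' t p r : s' != s -> \sum_q zeta s t p q * zeta s' t q r = 0.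
Proof.
move=> ss'; rewrite zeta_mulL (eq_bigr (fun q => a s q * a s' q)) => [|q _].
  by rewrite a_row eq_sym (negPf ss') !mulr0.
by rewrite mulrACA a_sqr mulr1.
Qed.

(** The counterpart of [zeta_mulL] with a sum over states, so that columns of [a] take over. It
    feeds the relations between adjacent letters. *)
Lemma zeta_mulS c e p q p' q' : \sum_d zeta c d p p' * zeta d e q q' =
  n%:R^-1 ^+ 2 * (a c p * a c p' * a e q * a e q')
  * \sum_d (a d p * a d p' * (a d q * a d q')).
Proof. by rewrite mulr_sumr; apply: eq_bigr => d _; rewrite /zeta; ring. Qed.

Lemma zeta_rowS c e p p' q' : p' != q' -> \sum_d zeta c d p p' * zeta d e p q' = 0.
Proof.
move=> pq; rewrite zeta_mulS (eq_bigr (fun d => a d p' * a d q')) => [|d _].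
  by rewrite a_col (negPf pq) !mulr0.
by rewrite mulrACA a_sqr mul1r.
Qed.

Lemma zeta_colS c e p q p' : p != q -> \sum_d zeta c d p p' * zeta d e q p' = 0.
Proof.
move=> pq; rewrite zeta_mulS (eq_bigr (fun d => a d p * a d q)) => [|d _].
  by rewrite a_col (negPf pq) !mulr0.
by rewrite mulrACA a_sqr mulr1.
Qed.

End SignMatrix.

(** * The tensor product of two sign matrices and its invariant state *)

Section Tensor.
Variables (n : nat) (a b : 'I_n -> 'I_n -> R).
Hypothesis a_sqr : forall i l, a i l * a i l = 1.
Hypothesis a_row : forall i i', \sum_l a i l * a i' l = n%:R * (i == i')%:R.
Hypothesis a_col : forall l l', \sum_i a i l * a i l' = n%:R * (l == l')%:R.
Hypothesis b_sqr : forall i l, b i l * b i l = 1.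
Hypothesis b_row : forall i i', \sum_l b i l * b i' l = n%:R * (i == i')%:R.
Hypothesis b_col : forall l l', \sum_i b i l * b i l' = n%:R * (l == l')%:R.
Hypothesis n_gt0 : (0 < n)%N.
Local Notation P := ('I_n * 'I_n)%type.
Local Notation word := (seq P).

Definition zz (s t p q : P) : R :=
  zeta a s.1 t.1 p.1 q.1 * zeta b s.2 t.2 p.2 q.2.

Lemma zz_sym s t p q : zz s t p q = zz s t q p.
Proof. by rewrite /zz zeta_sym [X in _ * X]zeta_sym. Qed.

Lemma zz_symS s t p q : zz s t p q = zz t s p q.
Proof. by rewrite /zz zeta_symS [X in _ * X]zeta_symS. Qed.

Lemma pair_eqR (s t : P) : (s == t)%:R = (s.1 == t.1)%:R * (s.2 == t.2)%:R :> R.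
Proof. by rewrite -natrM mulnb; case: s t => ? ? []. Qed.

Lemma zz_sum s p q : \sum_t zz s t p q = (p == q)%:R.
Proof. by rewrite (sum_pair_mul (zeta a _ ^~ _ ^~ _) (zeta b _ ^~ _ ^~ _)) !zeta_sumS // -pair_eqR. Qed.

Lemma zz_mulL s t s' t' p r : \sum_q zz s t p q * zz s' t' q r =
  (\sum_q zeta a s.1 t.1 p.1 q * zeta a s'.1 t'.1 q r.1) *
  (\sum_q zeta b s.2 t.2 p.2 q * zeta b s'.2 t'.2 q r.2).
Proof. by rewrite -sum_pair_mul; apply: eq_bigr => q _; rewrite mulrACA. Qed.

Lemma zz_mulS c e p q p' q' : \sum_d zz c d p p' * zz d e q q' =
  (\sum_d zeta a c.1 d p.1 p'.1 * zeta a d e.1 q.1 q'.1) *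
  (\sum_d zeta b c.2 d p.2 p'.2 * zeta b d e.2 q.2 q'.2).
Proof. by rewrite -sum_pair_mul; apply: eq_bigr => d _; rewrite mulrACA. Qed.

(** These four relations are fed to [act_act0]: M_st M_s't' vanishes when s, s' agree in a
    coordinate where t, t' differ, or differ in one where t, t' agree. Plain equality of pairs would
    lose this coordinatewise information, on which the construction of P depends. *)
Definition same1 (s t : P) := s.1 == t.1.
Definition same2 (s t : P) := s.2 == t.2.
Definition diff1 (s t : P) := s.1 != t.1.
Definition diff2 (s t : P) := s.2 != t.2.

Lemma zz_same1 s s' d c p r : same1 s s' -> ~~ same1 d c -> \sum_q zz s' c p q * zz s d q r = 0.
Proof. by move=> /eqP ss dc; rewrite zz_mulL ss zeta_rowL ?mul0r. Qed.

Lemma zz_same2 s s' d c p r : same2 s s' -> ~~ same2 d c -> \sum_q zz s' c p q * zz s d q r = 0.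
Proof. by move=> /eqP ss dc; rewrite zz_mulL ss [X in _ * X]zeta_rowL ?mulr0. Qed.

Lemma zz_diff1 s s' d c p r : diff1 s s' -> ~~ diff1 d c -> \sum_q zz s' c p q * zz s d q r = 0.
Proof. by move=> ss /negPn/eqP dc; rewrite zz_mulL dc zeta_colL ?mul0r. Qed.

Lemma zz_diff2 s s' d c p r : diff2 s s' -> ~~ diff2 d c -> \sum_q zz s' c p q * zz s d q r = 0.
Proof. by move=> ss /negPn/eqP dc; rewrite zz_mulL dc [X in _ * X]zeta_colL ?mulr0. Qed.

Lemma pair_neq (s t : P) : s != t -> ~~ same1 s t \/ ~~ same2 s t.
Proof. by case: s t => i k [j l]; rewrite xpair_eqE negb_and => /orP. Qed.

Lemma zz_row s d c p r : d != c -> \sum_q zz s c p q * zz s d q r = 0.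
Proof. by move=> /pair_neq[]; [apply: zz_same1 | apply: zz_same2]; exact: eqxx. Qed.

Lemma zz_col s s' c p r : s != s' -> \sum_q zz s' c p q * zz s c q r = 0.
Proof.
move=> /pair_neq[ss'|ss']; first by apply: zz_diff1 => //; rewrite /diff1 negbK.
by apply: zz_diff2 => //; rewrite /diff2 negbK.
Qed.

Definition clash1 (p q : P) := (p.1 == q.1) && (p.2 != q.2).
Definition clash2 (p q : P) := (p.1 != q.1) && (p.2 == q.2).

Lemma zz_clash1 c e p q p' q' : clash1 p q -> ~~ clash1 p' q' ->
  \sum_d zz c d p p' * zz d e q q' = 0.
Proof.
rewrite zz_mulS => /andP[/eqP-> pq2]; rewrite negb_and negbK => /orP[pq1|/eqP->].
  by rewrite zeta_rowS ?mul0r.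
by rewrite [X in _ * X]zeta_colS ?mulr0.
Qed.

Lemma zz_clash2 c e p q p' q' : clash2 p q -> ~~ clash2 p' q' ->
  \sum_d zz c d p p' * zz d e q q' = 0.
Proof.
rewrite zz_mulS => /andP[pq1 /eqP->]; rewrite negb_and negbK => /orP[/eqP->|pq2].
  by rewrite zeta_colS ?mul0r.
by rewrite [X in _ * X]zeta_rowS ?mulr0.
Qed.

Definition fib1 (l : 'I_n) (p : P) := p.1 == l.
Definition fib2 (j : 'I_n) (p : P) := p.2 == j.

Lemma sum_fib1 (V : nmodType) (F : P -> V) l : \sum_(p | fib1 l p) F p = \sum_j F (l, j).
Proof.
rewrite (reindex_onto (fun j => (l, j)) snd) /= => [|[i j] /eqP /= -> //].
by apply: eq_bigl => j; rewrite /fib1 /= !eqxx.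
Qed.

Lemma sum_fib2 (V : nmodType) (F : P -> V) j : \sum_(p | fib2 j p) F p = \sum_l F (l, j).
Proof.
rewrite (reindex_onto (fun l => (l, j)) fst) /= => [|[i k] /eqP /= -> //].
by apply: eq_bigl => l; rewrite /fib2 /= !eqxx.
Qed.

Definition coef1 (c d : P) l x : R := zeta a c.1 d.1 l x * (c.2 == d.2)%:R.
Definition coef2 (c d : P) j y : R := (c.1 == d.1)%:R * zeta b c.2 d.2 j y.

(** Summing over the second coordinate turns the factor of [b] into a Kronecker delta; the factor of
    [a] then acts on the labels of the fibres. *)
Lemma zz_fib1 c d l q :
  \sum_(p | fib1 l p) zz c d p q = \sum_x coef1 c d l x * (fib1 x q)%:R.
Proof.
rewrite sum_fib1 [RHS](bigD1 q.1) //= [X in _ + X]big1 => [|x xq]; last first.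
  by rewrite /fib1 eq_sym (negPf xq) mulr0.
rewrite addr0 /fib1 eqxx mulr1 /zz /= -mulr_sumr; congr (_ * _).
by under eq_bigr do rewrite zeta_sym; rewrite zeta_sumL.
Qed.

Lemma zz_fib2 c d j q :
  \sum_(p | fib2 j p) zz c d p q = \sum_y coef2 c d j y * (fib2 y q)%:R.
Proof.
rewrite sum_fib2 [RHS](bigD1 q.2) //= [X in _ + X]big1 => [|x xq]; last first.
  by rewrite /fib2 eq_sym (negPf xq) mulr0.
rewrite addr0 /fib2 eqxx mulr1 /zz /= -mulr_suml; congr (_ * _).
by under eq_bigr do rewrite zeta_sym; rewrite zeta_sumL.
Qed.

Lemma coef1_sum c d l : \sum_x coef1 c d l x = (c == d)%:R.
Proof. by rewrite -mulr_suml zeta_sumL // -pair_eqR. Qed.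

Lemma coef2_sum c d j : \sum_y coef2 c d j y = (c == d)%:R.
Proof. by rewrite -mulr_sumr zeta_sumL // -pair_eqR. Qed.

(** Since it is multiplicative and real, its kernel has rank one, and positivity is |X|^2 >= 0. *)
Definition diag (w : word) : R := \prod_(p <- w) (p.1 == p.2)%:R.

Lemma diag_cat u v : diag (u ++ v) = diag u * diag v.
Proof. exact: big_cat. Qed.

Lemma diag_cons p v : diag (p :: v) = (p.1 == p.2)%:R * diag v.
Proof. exact: big_cons. Qed.

Lemma diag_rev w : diag (rev w) = diag w.
Proof. by apply: perm_big; rewrite perm_rev. Qed.

Lemma diag_clash1 : kills clash1 diag.
Proof.
move=> u v [l j] [l' j'] /andP[/= /eqP <- jj]; rewrite diag_cat !diag_cons /=.
have [->|_] := eqVneq l j; last by rewrite mul0r mulr0.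
by rewrite (negPf jj) mul0r !mulr0.
Qed.

Lemma diag_clash2 : kills clash2 diag.
Proof.
move=> u v [l j] [l' j'] /andP[/= ll /eqP <-]; rewrite diag_cat !diag_cons /=.
have [lj|_] := eqVneq l j; last by rewrite mul0r mulr0.
by rewrite -lj eq_sym (negPf ll) mul0r !mulr0.
Qed.

Lemma diag_fib1 : sums fib1 diag.
Proof.
move=> l u v; rewrite sum_fib1 (bigD1 l) //= !diag_cat diag_cons /= eqxx mul1r.
rewrite big1 ?addr0 // => j jl.
by rewrite diag_cat diag_cons /= eq_sym (negPf jl) mul0r mulr0.
Qed.

Lemma diag_fib2 : sums fib2 diag.
Proof.
move=> l u v; rewrite sum_fib2 (bigD1 l) //= !diag_cat diag_cons /= eqxx mul1r.
rewrite big1 ?addr0 // => j jl.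
by rewrite diag_cat diag_cons /= (negPf jl) mul0r mulr0.
Qed.

Lemma diag_psd : psd diag.
Proof.
move=> x; pose X := \sum_(q <- x) q.1 * (diag q.2)%:C.
suff -> : ext (kern diag) x x = X * conjc X by exact: mulcJ_ge0.
rewrite mulrC rmorph_sum mulr_suml; apply: eq_bigr => p _.
rewrite mulr_sumr; apply: eq_bigr => q _ /=.
rewrite /kern diag_cat diag_rev !rmorphM /= conjc_real; ring.
Qed.

Record invariant_state (f : word -> R) : Prop := InvariantState {
  inv_nil : f [::] = 1;
  inv_rev : forall w, f (rev w) = f w;
  inv_psd : psd f;
  inv_act : forall s t w, act zz f s t w = (s == t)%:R * f w;
  inv_clash1 : kills clash1 f;
  inv_clash2 : kills clash2 f;
  inv_fib1 : sums fib1 f;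
  inv_fib2 : sums fib2 f
}.

Lemma exists_invariant_state : exists f, invariant_state f.
Proof.
have P_gt0 : (0 < #|{: P}|)%N by rewrite card_prod card_ord muln_gt0 n_gt0.
have [f df] := avg_limit zz_sym zz_sum zz_row P_gt0 diag; exists f; split.
- by rewrite (limit_nil P_gt0 df) /diag big_nil.
- exact: limit_rev zz_symS _ _ df diag_rev.
- exact: psd_limit zz_symS _ _ df diag_psd.
- exact: limit_act zz_sym zz_sum zz_row P_gt0 _ _ df.
- exact: (@limit_kills _ _ _ _ _ df clash1 zz_clash1 diag_clash1).
- exact: (@limit_kills _ _ _ _ _ df clash2 zz_clash2 diag_clash2).
- exact: (@limit_sums _ _ _ _ _ df _ fib1 coef1 zz_fib1 coef1_sum diag_fib1).
- exact: (@limit_sums _ _ _ _ _ df _ fib2 coef2 zz_fib2 coef2_sum diag_fib2).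
Qed.

End Tensor.

(** * Operators on words *)

Section OpElements.
Variable k : psd_kernel.
Local Notation B := (kbasis k).
Local Notation ip := (ext (@kfun k)).

Lemma ext_lin_expand (t : B -> B -> C) x T v :
  ext t x (lin T v) = \sum_(r <- v) r.1 * ext t x (T r.2).
Proof.
rewrite ext_linr ext_expandr; apply: eq_bigr => r _.
by rewrite -ext_linr lin_ket.
Qed.

Lemma cst_opM (S T : op k) b b' :
  sval (cst_op S * cst_op T) b b' = ip (ket b) (lin (oT S) (oT T b')).
Proof.
rewrite (isprod_uniq (svalP (cst_op T)) (cst_mulP (cst_op S) (cst_op T)) (isprod_opl S _)).
by rewrite ext_opf lin_ket op_adjE lin_ket.
Qed.

(** For a partial isometry T with adjoint A, put G = A T. Then G G = G gives |G x| = |T x|, so |T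
    x|^2 = <x, G x> <= |x| |T x|; the bound 1 comes from algebra alone. *)
Lemma isometry_bound (T A : B -> vec B) :
  (forall b b', ip (ket b) (T b') = ip (A b) (ket b')) ->
  (forall b b', ip (ket b) (lin A (lin T (lin A (T b')))) = ip (ket b) (lin A (T b'))) ->
  exists2 K : R, 0 <= K & forall x, nrm (lin T x) <= K * nrm x.
Proof.
move=> adj TAT; have TA := adjoint_lin adj.
have AT x y : ip (lin T x) y = ip x (lin A y) by rewrite ip_conj TA -ip_conj.
exists 1 => // x; rewrite mul1r; apply: le_of_sqr_le; rewrite ?nrm_ge0 //.
have E : nrm (lin A (lin T x)) = nrm (lin T x).
  apply/eqP; rewrite -(@eqrXn2 _ 2) ?nrm_ge0 // !nrm_sqr -TA AT [in X in _ == X]AT.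
  rewrite !lin_comp ext_linr [X in _ == cabs X]ext_linr.
  by apply/eqP; congr cabs; apply: eq_ext => b b'; rewrite -TAT !lin_comp.
by rewrite nrm_sqr AT -E; exact: cauchy_schwarz.
Qed.

Lemma projection_bound (T : B -> vec B) :
  (forall b b', ip (ket b) (T b') = ip (T b) (ket b')) ->
  (forall b b', ip (ket b) (lin T (T b')) = ip (ket b) (T b')) ->
  exists2 K : R, 0 <= K & forall x, nrm (lin T x) <= K * nrm x.
Proof.
move=> adj TT; apply: (isometry_bound adj) => b b'.
have H x : ip (ket b) (lin T (lin T x)) = ip (ket b) (lin T x).
  by rewrite lin_comp !ext_lin_expand; apply: eq_bigr => r _; rewrite TT.
by rewrite !H.
Qed.

End OpElements.

(** * Transfer matrices, letters and matrix units as operators *)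

Section Model.
Variables (n : nat) (a b : 'I_n -> 'I_n -> R).
Hypothesis a_sqr : forall i l, a i l * a i l = 1.
Hypothesis a_row : forall i i', \sum_l a i l * a i' l = n%:R * (i == i')%:R.
Hypothesis a_col : forall l l', \sum_i a i l * a i l' = n%:R * (l == l')%:R.
Hypothesis b_sqr : forall i l, b i l * b i l = 1.
Hypothesis b_row : forall i i', \sum_l b i l * b i' l = n%:R * (i == i')%:R.
Hypothesis b_col : forall l l', \sum_i b i l * b i l' = n%:R * (l == l')%:R.
Hypothesis n_gt0 : (0 < n)%N.
Local Notation P := ('I_n * 'I_n)%type.
Local Notation word := (seq P).
Variables (kap : word -> R) (kapI : invariant_state a b kap).
Variables (Lam : finType) (lam0 : Lam).
Local Notation basis := (Lam * word)%type.
Local Notation zz := (zz a b).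

(** An orthogonal sum of copies of the word space, one for each label in [Lam]. Matrix units move
    the copies and therefore commute with all that acts on words. *)
Definition kf (x y : basis) : C := ((x.1 == y.1)%:R * kap (rev x.2 ++ y.2))%:C.

Lemma kap_swap u w : kap (rev w ++ u) = kap (rev u ++ w).
Proof. by rewrite -(inv_rev kapI) rev_cat revK. Qed.

Lemma kf_herm x y : kf y x = conjc (kf x y).
Proof. by rewrite /kf conjc_real eq_sym kap_swap. Qed.

Lemma kf_psd x : 0 <= ext kf x x.
Proof.
pose restr l : vec word := [seq (p.1, p.2.2) | p <- x & p.2.1 == l].
suff -> : ext kf x x = \sum_l ext (kern kap) (restr l) (restr l).
  by apply: sumr_ge0 => l _; exact: (inv_psd kapI).
rewrite /ext; under [RHS]eq_bigr => l _.
  rewrite big_map big_filter big_mkcond /=.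
  under eq_bigr do rewrite big_map big_filter /=.
  over.
rewrite [RHS]exchange_big; apply: eq_bigr => p _ /=.
rewrite (bigD1 p.2.1) //= eqxx [X in _ + X]big1 ?addr0 => [|l lp]; last first.
  by rewrite eq_sym (negPf lp).
rewrite [RHS]big_mkcond; apply: eq_bigr => q _.
by rewrite /kf eq_sym; case: eqP => _; rewrite ?mul1r ?mul0r ?mulr0.
Qed.

Lemma kf_neq0 : exists x, kf x x != 0.
Proof. by exists (lam0, [::]); rewrite /kf eqxx (inv_nil kapI) mulr1 oner_neq0. Qed.

Definition word_kernel := PsdKernel kf_herm kf_psd kf_neq0.
Local Notation K := word_kernel.
Local Notation ip := (ext (@kfun K)).

Definition Mf (s t : P) (x : basis) : vec basis :=
  [seq (r.1, (x.1, r.2)) | r <- mv zz s t x.2].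
Definition Qf (p : P) (x : basis) : vec basis := ket (x.1, p :: x.2).
Definition Ef (l m : Lam) (x : basis) : vec basis :=
  if m == x.1 then ket (l, x.2) else [::].

Lemma ip_lin_Mf T (y : basis) (m : Lam) (G : word -> R) s t w :
  (forall v, ip (ket y) (T (m, v)) = (G v)%:C) ->
  ip (ket y) (lin T (Mf s t (m, w))) = (act zz G s t w)%:C.
Proof.
move=> TG; rewrite ext_lin_expand big_map -mvE.
by apply: eq_bigr => r _ /=; rewrite TG.
Qed.

Lemma ip_ket l u m v :
  ip (ket (l, u)) (ket (m, v)) = ((l == m)%:R * kap (rev u ++ v))%:C.
Proof. by rewrite ext_ket. Qed.

Lemma ip_Mf l u m w s t :
  ip (ket (l, u)) (Mf s t (m, w))
  = ((l == m)%:R * act zz (fun v => kap (rev u ++ v)) s t w)%:C.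
Proof.
rewrite -[Mf _ _ _]lin_id -act_scale; apply: ip_lin_Mf => v.
exact: ip_ket.
Qed.

Lemma ip_lin_Qf T (y : basis) (m : Lam) p w :
  ip (ket y) (lin T (Qf p (m, w))) = ip (ket y) (T (m, p :: w)).
Proof. by rewrite lin_ket. Qed.

Lemma ip_Qf l u m w p :
  ip (ket (l, u)) (Qf p (m, w)) = ((l == m)%:R * kap (rev u ++ p :: w))%:C.
Proof. exact: ip_ket. Qed.

Lemma ip_lin_Ef T (y : basis) l m m' w :
  ip (ket y) (lin T (Ef l m (m', w))) = (m == m')%:R%:C * ip (ket y) (T (l, w)).
Proof.
rewrite /Ef /=; case: eqP => _; last by rewrite ext0r rmorph0 mul0r.
by rewrite lin_ket rmorph1 mul1r.
Qed.

Lemma ip_Ef l u l' m m' w :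
  ip (ket (l, u)) (Ef l' m (m', w))
  = ((l == l')%:R * (m == m')%:R * kap (rev u ++ w))%:C.
Proof.
rewrite -[Ef _ _ _]lin_id ip_lin_Ef ip_ket -rmorphM /=.
by congr (_%:C); ring.
Qed.

Fact Mf_adj s t x y : ip (ket x) (Mf s t y) = ip (Mf s t x) (ket y).
Proof.
case: x y => [l u] [m w]; rewrite [RHS]ip_conj !ip_Mf conjc_real eq_sym.
rewrite (act_selfadj (@zz_symS _ a b) _ _ _ (inv_act kapI)).
- by congr ((_ * _)%:C); apply: eq_act => v; rewrite kap_swap.
- exact: zz_sum.
- exact: zz_row.
- exact: zz_col.
Qed.

Fact Mf_idem s t x y : ip (ket x) (lin (Mf s t) (Mf s t y)) = ip (ket x) (Mf s t y).
Proof.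
case: x y => [l u] [m w]; rewrite ip_Mf -act_scale.
rewrite (ip_lin_Mf _ _ _ (fun v => ip_Mf l u m v s t)).
by rewrite -(eq_act _ _ _ _ (fun v => act_scale _ _ _ _ _ v)) act_idem //;
  [exact: zz_sum | exact: zz_row].
Qed.

Definition opM s t : op K := Op (Mf_adj s t) (projection_bound (Mf_adj s t) (Mf_idem s t)).

Fact Qf_adj p x y : ip (ket x) (Qf p y) = ip (Qf p x) (ket y).
Proof. by case: x y => [l u] [m w]; rewrite /Qf !ip_ket rev_cons cat_rcons. Qed.

Lemma kap_clash1 u v p q : clash1 p q -> kap (u ++ p :: q :: v) = 0.
Proof. exact: (inv_clash1 kapI). Qed.

Lemma kap_clash2 u v p q : clash2 p q -> kap (u ++ p :: q :: v) = 0.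
Proof. exact: (inv_clash2 kapI). Qed.

Lemma kap_fib1 l u v : \sum_j kap (u ++ (l, j) :: v) = kap (u ++ v).
Proof. by rewrite -(inv_fib1 kapI l) sum_fib1. Qed.

Lemma kap_fib2 j u v : \sum_l kap (u ++ (l, j) :: v) = kap (u ++ v).
Proof. by rewrite -(inv_fib2 kapI j) sum_fib2. Qed.

(** Idempotence of Q_(l,j) is derived: multiply it by the sum over j' of Q_(l,j'), which is 1 and of
    which only j' = j survives. *)
Lemma kap_dup u p v : kap (u ++ p :: p :: v) = kap (u ++ p :: v).
Proof.
case: p => l j; transitivity (kap (rcons u (l, j) ++ v)); last by rewrite cat_rcons.
rewrite -[RHS](kap_fib1 l) (bigD1 j) //= cat_rcons big1 ?addr0 // => j' jj; rewrite cat_rcons kap_clash1 //.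
by rewrite /clash1 /= eqxx eq_sym.
Qed.

Fact Qf_idem p x y : ip (ket x) (lin (Qf p) (Qf p y)) = ip (ket x) (Qf p y).
Proof. by case: x y => [l u] [m w]; rewrite ip_lin_Qf !ip_Qf kap_dup. Qed.

Definition opQ p : op K := Op (Qf_adj p) (projection_bound (Qf_adj p) (Qf_idem p)).

Fact Ef_adj l m x y : ip (ket x) (Ef l m y) = ip (Ef m l x) (ket y).
Proof.
case: x y => [l' u] [m' w]; rewrite [RHS]ip_conj !ip_Ef conjc_real kap_swap.
by rewrite (eq_sym l' l) (eq_sym m' m); congr (_%:C); ring.
Qed.

Fact Ef_iso l m x y : ip (ket x) (lin (Ef m l) (lin (Ef l m) (lin (Ef m l) (Ef l m y))))
  = ip (ket x) (lin (Ef m l) (Ef l m y)).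
Proof.
have E v : lin (Ef m l) (Ef l m v) = Ef m m v.
  by rewrite /Ef; case: (m == v.1); rewrite // lin_ket /= eqxx.
rewrite lin_comp (funext E) E /Ef; case: (m == y.1) => //.
by rewrite lin_ket /= eqxx.
Qed.

Definition opE l m : op K := Op (Ef_adj l m) (isometry_bound (Ef_adj l m) (Ef_iso l m)).

Local Notation A := (kernel_cstar K).
Definition elM s t : A := cst_op (opM s t).
Definition elQ p : A := cst_op (opQ p).
Definition elE l m : A := cst_op (opE l m).

Lemma sval_op (T : op K) x y : sval (cst_op T) x y = ip (ket x) (oT T y).
Proof. by []. Qed.

Lemma sval_zero x y : sval (0 : A) x y = 0.
Proof. by rewrite /= mul0r. Qed.

Lemma sval_sum (I : Type) (r : seq I) (F : I -> A) x y :
  sval (\sum_(i <- r) F i) x y = \sum_(i <- r) sval (F i) x y.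
Proof.
elim: r => [|i r IH]; first by rewrite !big_nil sval_zero.
by rewrite !big_cons -IH.
Qed.

Lemma sval_one l u m w : sval (1 : A) (l, u) (m, w) = ((l == m)%:R * kap (rev u ++ w))%:C.
Proof. by rewrite sval_op ip_ket. Qed.

Lemma elM_star s t : cs_star (elM s t) = elM s t.
Proof. by apply: cst_eq => x y /=; rewrite /opf -ip_conj /= Mf_adj. Qed.

Lemma elQ_star p : cs_star (elQ p) = elQ p.
Proof. by apply: cst_eq => x y /=; rewrite /opf -ip_conj /= Qf_adj. Qed.

Lemma elE_star l m : cs_star (elE l m) = elE m l.
Proof. by apply: cst_eq => x y /=; rewrite /opf -ip_conj /= Ef_adj. Qed.

Lemma elMM l u m w s t s' t' : sval (elM s t * elM s' t') (l, u) (m, w) =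
  ((l == m)%:R * act zz (act zz (fun v => kap (rev u ++ v)) s t) s' t' w)%:C.
Proof.
by rewrite cst_opM (ip_lin_Mf _ _ _ (fun v => ip_Mf l u m v s t)) act_scale.
Qed.

Lemma elMM0 (R : rel P) s t s' t' :
  (forall s s' d c p r, R s s' -> ~~ R d c -> \sum_q zz s' c p q * zz s d q r = 0) ->
  R s s' -> ~~ R t t' -> elM s t * elM s' t' = 0.
Proof.
move=> zR Rs Rt; apply: cst_eq => -[l u] [m w]; rewrite elMM sval_zero.
by rewrite (act_act0 zR _ _ Rs Rt) mulr0.
Qed.

Lemma elM_row s : \sum_t elM s t = 1.
Proof.
apply: cst_eq => -[l u] [m w]; rewrite sval_sum sval_one.
under eq_bigr do rewrite sval_op ip_Mf.
by rewrite -rmorph_sum /= -mulr_sumr act_sumr //; exact: zz_sum.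
Qed.

Lemma elM_col t : \sum_s elM s t = 1.
Proof.
apply: cst_eq => -[l u] [m w]; rewrite sval_sum sval_one.
under eq_bigr do rewrite sval_op ip_Mf.
by rewrite -rmorph_sum /= -mulr_sumr act_suml //; [exact: zz_symS | exact: zz_sum].
Qed.

Lemma elQQ l u m w p q : sval (elQ p * elQ q) (l, u) (m, w) =
  ((l == m)%:R * kap (rev u ++ p :: q :: w))%:C.
Proof. by rewrite cst_opM ip_lin_Qf ip_Qf. Qed.

Lemma elQ_clash1 p q : clash1 p q -> elQ p * elQ q = 0.
Proof.
by move=> pq; apply: cst_eq => -[l u] [m w]; rewrite elQQ kap_clash1 // mulr0 sval_zero.
Qed.

Lemma elQ_clash2 p q : clash2 p q -> elQ p * elQ q = 0.
Proof.
by move=> pq; apply: cst_eq => -[l u] [m w]; rewrite elQQ kap_clash2 // mulr0 sval_zero.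
Qed.

Lemma elQ_fib1 l : \sum_j elQ (l, j) = 1.
Proof.
apply: cst_eq => -[l' u] [m w]; rewrite sval_sum sval_one.
under eq_bigr do rewrite sval_op ip_Qf.
by rewrite -rmorph_sum /= -mulr_sumr kap_fib1.
Qed.

Lemma elQ_fib2 j : \sum_l elQ (l, j) = 1.
Proof.
apply: cst_eq => -[l' u] [m w]; rewrite sval_sum sval_one.
under eq_bigr do rewrite sval_op ip_Qf.
by rewrite -rmorph_sum /= -mulr_sumr kap_fib2.
Qed.

(** Q_p prepends the letter that M_st reads next, so the exchange relation is one unfolding of
    [act]. *)
Lemma elMQ s t p :
  elM s t * elQ p = \sum_c \sum_q (zz s c p q)%:C *: (elQ q * elM c t).
Proof.
apply: cst_eq => -[l u] [m w]; rewrite cst_opM ip_lin_Qf ip_Mf /= mulr_sumr rmorph_sum.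
rewrite sval_sum; apply: eq_bigr => c _; rewrite sval_sum mulr_sumr rmorph_sum.
apply: eq_bigr => q _; rewrite cst_scaleE cst_opM.
rewrite (ip_lin_Mf _ _ _ (fun v => ip_Qf l u m v q)) act_scale -rmorphM /=.
by rewrite mulrCA.
Qed.

Lemma elE_mul l m m' k : elE l m * elE m' k = if m == m' then elE l k else 0.
Proof.
apply: cst_eq => -[l' u] [k' w]; rewrite cst_opM ip_lin_Ef ip_Ef.
case: (m == m'); last by rewrite sval_zero mulr0 mul0r rmorph0 mulr0.
by rewrite sval_op ip_Ef -rmorphM /= mulr1; congr (_%:C); ring.
Qed.

Lemma elE_sum : \sum_l elE l l = 1.
Proof.
apply: cst_eq => -[l' u] [k' w]; rewrite sval_sum sval_one.
under eq_bigr do rewrite sval_op ip_Ef.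
rewrite (bigD1 l') //= eqxx mul1r big1 ?addr0 // => l ll.
by rewrite eq_sym (negPf ll) !mul0r.
Qed.

Lemma elEQ l m p : elE l m * elQ p = elQ p * elE l m.
Proof.
apply: cst_eq => -[l' u] [m' w]; rewrite !cst_opM ip_lin_Qf ip_Ef ip_lin_Ef ip_Qf.
by rewrite -[RHS]rmorphM /=; congr (_%:C); ring.
Qed.

Lemma elEM l m s t : elE l m * elM s t = elM s t * elE l m.
Proof.
apply: cst_eq => -[l' u] [m' w]; rewrite !cst_opM ip_lin_Ef ip_Mf.
rewrite (ip_lin_Mf _ _ _ (fun v => ip_Ef l' u l m m' v)) act_scale -[RHS]rmorphM /=.
by congr (_%:C); ring.
Qed.

End Model.

(** * From magic unitaries to cubic unitaries *)

Record cubic (A : cstar_algebra) (n : nat) (x : 'I_n * 'I_n -> A) : Prop := Cubic {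
  cub_star : forall s, cs_star (x s) = x s;
  cub_row : forall i k k', k != k' -> x (i, k) * x (i, k') = 0;
  cub_col : forall i i' k, i != i' -> x (i, k) * x (i', k) = 0;
  cub_rsum : forall i, \sum_k x (i, k) * x (i, k) = 1;
  cub_csum : forall k, \sum_i x (i, k) * x (i, k) = 1
}.

Record magic (A : cstar_algebra) (n : nat) (p : 'I_n * 'I_n -> A) : Prop := Magic {
  mag_star : forall s, cs_star (p s) = p s;
  mag_row : forall i k k', k != k' -> p (i, k) * p (i, k') = 0;
  mag_col : forall i i' k, i != i' -> p (i, k) * p (i', k) = 0;
  mag_rsum : forall i, \sum_k p (i, k) = 1;
  mag_csum : forall k, \sum_i p (i, k) = 1
}.

Record matrix_units (A : cstar_algebra) (L : finType) (E : L -> L -> A) : Prop := MatrixUnits {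
  mu_star : forall l m, cs_star (E l m) = E m l;
  mu_mul : forall l m m' k, E l m * E m' k = if m == m' then E l k else 0;
  mu_sum : \sum_l E l l = 1
}.

Lemma cs_star_sum (A : cstar_algebra) (I : Type) (r : seq I) (F : I -> A) :
  cs_star (\sum_(i <- r) F i) = \sum_(i <- r) cs_star (F i).
Proof.
have s0 : cs_star (0 : A) = 0.
  by rewrite -[0 in LHS](scale0r (0 : A)) cs_starZ conjc0 scale0r.
by elim: r => [|i r IH]; rewrite ?big_nil // !big_cons cs_starD IH.
Qed.

(** * The cubic matrix built from [p], [T] and matrix units *)

Section Core.
Variables (A : cstar_algebra) (n : nat).
Local Notation P := ('I_n * 'I_n)%type.
Variables (E : bool * 'I_n -> bool * 'I_n -> A) (p : P -> A) (T : P -> P -> A).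
Hypothesis EP : matrix_units E.
Hypothesis pP : magic p.
Hypothesis T_star : forall s t, cs_star (T s t) = T t s.
Hypothesis T_row : forall i k k', T (i, k) (i, k') = (k == k')%:R.
Hypothesis T_col : forall i i' k, T (i, k) (i', k) = (i == i')%:R.
Hypothesis TT1 : forall s t k, \sum_i T s (i, k) * T (i, k) t = T s t.
Hypothesis TT2 : forall s t i, \sum_k T s (i, k) * T (i, k) t = T s t.
Hypothesis pT : forall s t, p s * T s t = T s t * p t.
Hypothesis Ep : forall l m s, E l m * p s = p s * E l m.
Hypothesis ET : forall l m s t, E l m * T s t = T s t * E l m.

Lemma mag_idem s : p s * p s = p s.
Proof.
case: s => i k; rewrite -[RHS]mulr1 -(mag_rsum pP i) mulr_sumr (bigD1 k) //=.
by rewrite big1 ?addr0 // => k' kk'; rewrite (mag_row pP) // eq_sym.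
Qed.

Definition gg s t : A := p s * T s t.

Lemma gg_star s t : cs_star (gg s t) = gg t s.
Proof. by rewrite cs_starM T_star (mag_star pP) -pT. Qed.

Lemma Egg l m s t : E l m * gg s t = gg s t * E l m.
Proof. by rewrite mulrA Ep -mulrA ET mulrA. Qed.

(** The inner [p t] moves left through [T s t], becomes [p s] and is absorbed by idempotence. *)
Lemma gg_mul s t r : gg s t * gg t r = p s * (T s t * T t r).
Proof.
rewrite /gg -[LHS]mulrA [T s t * _]mulrA -pT -mulrA mulrA mag_idem.
by rewrite mulrA.
Qed.

Lemma gg_mul0 s t t' r : p t * p t' = 0 -> gg s t * gg t' r = 0.
Proof.
move=> pp; rewrite /gg pT -mulrA [p t * _]mulrA pp mul0r mulr0 //.
Qed.

Lemma gg_row i k k' : gg (i, k) (i, k') = if k == k' then p (i, k) else 0.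
Proof. by rewrite /gg T_row; case: eqP; rewrite ?mulr1 ?mulr0. Qed.

Lemma gg_col i i' k : gg (i, k) (i', k) = if i == i' then p (i, k) else 0.
Proof. by rewrite /gg T_col; case: eqP; rewrite ?mulr1 ?mulr0. Qed.

(** The label [false] carries second indices k and [true] first indices i, so [xu] lies in one
    off-diagonal corner and [xv], its adjoint, in the other. Products of [xx] therefore live in the
    two diagonal corners. *)
Definition xu s : A := \sum_i \sum_k E (false, k) (true, i) * gg s (i, k).
Definition xv s : A := \sum_i \sum_k E (true, i) (false, k) * gg (i, k) s.
Definition xx s : A := xu s + xv s.

Lemma xu_star s : cs_star (xu s) = xv s.
Proof.
rewrite cs_star_sum; apply: eq_bigr => i _; rewrite cs_star_sum; apply: eq_bigr => k _.
by rewrite cs_starM gg_star (mu_star EP) Egg.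
Qed.

Lemma sum4_mul (U V G H : 'I_n -> 'I_n -> A) :
  (forall i k j l, G i k * V j l = V j l * G i k) ->
  (\sum_i \sum_k U i k * G i k) * (\sum_i \sum_k V i k * H i k) =
  \sum_i \sum_k \sum_j \sum_l (U i k * V j l) * (G i k * H j l).
Proof.
move=> GV; rewrite mulr_suml; apply: eq_bigr => i _; rewrite mulr_suml; apply: eq_bigr => k _.
rewrite mulr_sumr; apply: eq_bigr => j _; rewrite mulr_sumr; apply: eq_bigr => l _.
by rewrite -!mulrA [G i k * (V j l * _)]mulrA GV -!mulrA.
Qed.

Lemma xu_xu s r : xu s * xu r = 0.
Proof.
rewrite sum4_mul => [|*]; last by rewrite Egg.
do 4!(rewrite big1 // => ? _).
by rewrite (mu_mul EP) /= mul0r.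
Qed.

Lemma xv_xv s r : xv s * xv r = 0.
Proof.
rewrite sum4_mul => [|*]; last by rewrite Egg.
do 4!(rewrite big1 // => ? _).
by rewrite (mu_mul EP) /= mul0r.
Qed.

(** The matrix units force equal first indices. Unequal second indices are then removed by the row
    relations of [p], and [TT1] contracts what is left. *)
Lemma xu_xv s r : xu s * xv r = (\sum_k E (false, k) (false, k)) * gg s r.
Proof.
rewrite sum4_mul => [|*]; last by rewrite Egg.
rewrite exchange_big mulr_suml; apply: eq_bigr => k _ /=.
transitivity (E (false, k) (false, k) * \sum_i gg s (i, k) * gg (i, k) r); last first.
  by under eq_bigr do rewrite gg_mul; rewrite -mulr_sumr TT1.
rewrite mulr_sumr; apply: eq_bigr => i _.
rewrite (bigD1 i) //= [X in _ + X]big1 ?addr0 => [|j ji]; last first.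
  rewrite big1 // => l _; rewrite (mu_mul EP) xpair_eqE /= eq_sym (negPf ji) mul0r //.
rewrite (bigD1 k) //= [X in _ + X]big1 ?addr0 => [|l lk]; last first.
  by rewrite gg_mul0 ?mulr0 // (mag_row pP) // eq_sym.
by rewrite (mu_mul EP) eqxx.
Qed.

Lemma xv_xu s r : xv s * xu r =
  \sum_i \sum_j E (true, i) (true, j) * \sum_k gg (i, k) s * gg r (j, k).
Proof.
rewrite sum4_mul => [|*]; last by rewrite Egg.
apply: eq_bigr => i _; rewrite exchange_big; apply: eq_bigr => j _ /=.
rewrite mulr_sumr; apply: eq_bigr => k _.
rewrite (bigD1 k) //= [X in _ + X]big1 ?addr0 => [|l lk]; last first.
  by rewrite (mu_mul EP) xpair_eqE /= eq_sym (negPf lk) mul0r.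
by rewrite (mu_mul EP) eqxx.
Qed.

Lemma xx_mul s r : xx s * xx r = (\sum_k E (false, k) (false, k)) * gg s r
  + \sum_i \sum_j E (true, i) (true, j) * \sum_k gg (i, k) s * gg r (j, k).
Proof. by rewrite /xx mulrDl !mulrDr xu_xu xv_xv add0r addr0 xu_xv xv_xu. Qed.

Lemma xx_mul0 s r : p s * p r = 0 -> gg s r = 0 -> xx s * xx r = 0.
Proof.
move=> pp g0; rewrite xx_mul g0 mulr0 add0r.
do 2!(rewrite big1 // => ? _); rewrite big1 ?mulr0 // => k _; exact: gg_mul0.
Qed.

(** [f] runs through one row or one column. The [false] corner receives the corresponding sum of
    [p]. In the [true] corner the sum contracts to gg (i,k) (j,k), which vanishes for i != j and
    otherwise gives a row sum of [p]. *)
Lemma xx_sum (I : finType) (f : I -> P) :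
  \sum_m p (f m) = 1 -> (forall s, gg s s = p s) ->
  (forall s t, \sum_m gg s (f m) * gg (f m) t = gg s t) ->
  \sum_m xx (f m) * xx (f m) = 1.
Proof.
move=> p1 gp gf; under eq_bigr do rewrite xx_mul gp.
rewrite big_split /= -mulr_sumr p1 mulr1 -(mu_sum EP).
transitivity (\sum_k E (false, k) (false, k) + \sum_i E (true, i) (true, i)).
  congr (_ + _); rewrite exchange_big; apply: eq_bigr => i _ /=.
  rewrite exchange_big (bigD1 i) //= [X in _ + X]big1 => [|j ji].
    rewrite addr0 -mulr_sumr exchange_big /=.
    under eq_bigr do rewrite gf gp.
    by rewrite (mag_rsum pP) mulr1.
  rewrite -mulr_sumr exchange_big /=; under eq_bigr do rewrite gf gg_col eq_sym (negPf ji).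
  by rewrite big1 ?mulr0.
transitivity (\sum_b \sum_i E (b, i) (b, i)); first by rewrite big_bool addrC.
by rewrite pair_bigA; apply: eq_bigr => -[b i] _.
Qed.

Lemma gg_diag s : gg s s = p s.
Proof. by case: s => i k; rewrite gg_row eqxx. Qed.

Lemma cubic_xx : cubic xx.
Proof.
split.
- by move=> s; rewrite /xx cs_starD -xu_star cs_starK addrC.
- by move=> i k k' kk'; rewrite xx_mul0 ?(mag_row pP) // gg_row (negPf kk').
- by move=> i i' k ii'; rewrite xx_mul0 ?(mag_col pP) // gg_col (negPf ii').
- move=> i; apply: (xx_sum (mag_rsum pP i) gg_diag) => s t.
  by under eq_bigr do rewrite gg_mul; rewrite -mulr_sumr TT2.
- move=> k; apply: (@xx_sum _ (fun i => (i, k)) (mag_csum pP k) gg_diag) => s t.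
  by under eq_bigr do rewrite gg_mul; rewrite -mulr_sumr TT1.
Qed.

End Core.

Record sign_matrix (n : nat) (h : 'I_n -> 'I_n -> C) : Prop := SignMatrix {
  sg_conj : forall i l, conjc (h i l) = h i l;
  sg_sqr : forall i l, h i l * h i l = 1;
  sg_row : forall i i', \sum_l h i l * h i' l = n%:R * (i == i')%:R;
  sg_col : forall l l', \sum_i h i l * h i l' = n%:R * (l == l')%:R
}.

Lemma sign_matrix_tr n (h : 'I_n -> 'I_n -> C) :
  sign_matrix h -> sign_matrix (fun l i => h i l).
Proof. by case=> *; split. Qed.

Lemma sum_pairE (V : nmodType) (I J : finType) (F : I * J -> V) :
  \sum_q F q = \sum_i \sum_j F (i, j).
Proof. by rewrite pair_bigA; apply: eq_bigr => -[]. Qed.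

Lemma scaleL (A : cstar_algebra) (c : C) (x y : A) : (c *: x) * y = c *: (x * y).
Proof. by rewrite scalerAl. Qed.

Lemma scaleR (A : cstar_algebra) (c : C) (x y : A) : x * (c *: y) = c *: (x * y).
Proof. by rewrite scalerAr. Qed.

(** * Algebra of the matrices [Tm] *)

Section Tmat.
Variables (A : cstar_algebra) (n : nat) (al be : 'I_n -> 'I_n -> C).
Hypothesis n_gt0 : (0 < n)%N.
Hypothesis alP : sign_matrix al.
Hypothesis beP : sign_matrix be.
Local Notation P := ('I_n * 'I_n)%type.
Local Notation N := (n%:R : C).

Definition hh (s q : P) : C := al s.1 q.1 * be s.2 q.2.
Definition Tm (Q : P -> A) s t : A := N^-1 *: \sum_q (hh s q * hh t q) *: Q q.

Lemma N_neq0 : N != 0. Proof. by rewrite pnatr_eq0 -lt0n. Qed.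

Lemma hh_sqr s q : hh s q * hh s q = 1.
Proof. by rewrite mulrACA (sg_sqr alP) (sg_sqr beP) mulr1. Qed.

Lemma hh_conj s q : conjc (hh s q) = hh s q.
Proof. by rewrite rmorphM /= (sg_conj alP) (sg_conj beP). Qed.

Lemma pair_eqC (s t : P) : (s == t)%:R = (s.1 == t.1)%:R * (s.2 == t.2)%:R :> C.
Proof. by rewrite -natrM mulnb; case: s t => ? ? []. Qed.

Lemma hh_row s t : \sum_q hh s q * hh t q = N * N * (s == t)%:R.
Proof.
under eq_bigr do rewrite mulrACA.
rewrite (sum_pair_mul (fun l => al s.1 l * al t.1 l) (fun l => be s.2 l * be t.2 l)).
by rewrite (sg_row alP) (sg_row beP) mulrACA -pair_eqC.
Qed.

Lemma hh_col p q : \sum_s hh s p * hh s q = N * N * (p == q)%:R.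
Proof.
under eq_bigr do rewrite mulrACA.
rewrite (sum_pair_mul (fun i => al i p.1 * al i q.1) (fun k => be k p.2 * be k q.2)).
by rewrite (sg_col alP) (sg_col beP) mulrACA -pair_eqC.
Qed.

Lemma Tm_sym Q s t : Tm Q s t = Tm Q t s.
Proof. by congr (_ *: _); apply: eq_bigr => q _; rewrite mulrC. Qed.

Lemma Tm_comm Q s t y : (forall q, y * Q q = Q q * y) -> y * Tm Q s t = Tm Q s t * y.
Proof.
move=> yQ; rewrite /Tm scaleL scaleR; congr (_ *: _).
rewrite mulr_sumr mulr_suml; apply: eq_bigr => q _.
by rewrite scaleL scaleR yQ.
Qed.

(** Fourier inversion: [hh] is orthogonal with constant N * N, of which the normalisation of [Tm]
    leaves N. The row [t] is free, and its sign enters squared. *)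
Lemma Tm_inv Q t q : \sum_s (hh s q * hh t q) *: Tm Q s t = N *: Q q.
Proof.
rewrite /Tm; under eq_bigr do rewrite scalerA mulrC -scalerA scaler_sumr.
rewrite -scaler_sumr exchange_big /= (bigD1 q) //= [X in _ + X]big1 => [|r rq].
  under eq_bigr do rewrite scalerA mulrACA [hh t q * _]hh_sqr mulr1.
  rewrite addr0 -scaler_suml hh_col eqxx mulr1 scalerA.
  by rewrite mulrA mulVf ?mul1r // N_neq0.
under eq_bigr do rewrite scalerA mulrACA.
by rewrite -scaler_suml -mulr_suml hh_col eq_sym (negPf rq) mulr0 mul0r scale0r.
Qed.

Lemma Tm_invr Q s q : \sum_t (hh s q * hh t q) *: Tm Q s t = N *: Q q.
Proof. by rewrite -(Tm_inv Q s q); apply: eq_bigr => t _; rewrite Tm_sym mulrC. Qed.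

Variable Q : P -> A.
Hypothesis QP : magic Q.

Lemma Tm_star s t : cs_star (Tm Q s t) = Tm Q t s.
Proof.
rewrite /Tm cs_starZ conjc_inv conjc_nat cs_star_sum; congr (_ *: _); apply: eq_bigr => q _.
by rewrite cs_starZ (mag_star QP) rmorphM /= !hh_conj mulrC.
Qed.

Lemma Tm_row i k k' : Tm Q (i, k) (i, k') = (k == k')%:R.
Proof.
rewrite /Tm sum_pairE exchange_big /= (eq_bigr (fun j => (be k j * be k' j) *: (1 : A))) => [|j _].
  by rewrite -scaler_suml (sg_row beP) scalerA mulrA mulVf ?N_neq0 // mul1r scaler_nat.
rewrite -(mag_csum QP j) scaler_sumr; apply: eq_bigr => l _.
by rewrite /hh /= mulrACA (sg_sqr alP) mul1r.
Qed.

Lemma Tm_col i i' k : Tm Q (i, k) (i', k) = (i == i')%:R.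
Proof.
rewrite /Tm sum_pairE (eq_bigr (fun l => (al i l * al i' l) *: (1 : A))) => [|l _].
  by rewrite -scaler_suml (sg_row alP) scalerA mulrA mulVf ?N_neq0 // mul1r scaler_nat.
rewrite -(mag_rsum QP l) scaler_sumr; apply: eq_bigr => j _.
by rewrite /hh /= mulrACA (sg_sqr beP) mulr1.
Qed.

(** In the double sum over letters q, r, a pair q != r is removed in one of two ways: orthogonality
    of one sign matrix if the relevant coordinates differ, the magic relations of [Q] if they agree.
    The diagonal contributes the factor N and Q_q Q_q = Q_q. *)
Lemma Tm_TT (I : finType) (f : I -> P) s t :
  (forall q, \sum_i hh (f i) q * hh (f i) q = N) ->
  (forall q r, q != r -> (\sum_i hh (f i) q * hh (f i) r) *: (Q q * Q r) = 0) ->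
  \sum_i Tm Q s (f i) * Tm Q (f i) t = Tm Q s t.
Proof.
move=> f1 f0.
transitivity (N^-1 *: (N^-1 *: \sum_q \sum_r (hh s q * hh t r) *:
    ((\sum_i hh (f i) q * hh (f i) r) *: (Q q * Q r)))).
  rewrite /Tm; under eq_bigr do rewrite scaleL scaleR.
  rewrite -scaler_sumr; congr (_ *: _); rewrite -scaler_sumr; congr (_ *: _).
  under eq_bigr do rewrite mulr_suml.
  rewrite exchange_big; apply: eq_bigr => q _ /=.
  under eq_bigr do rewrite mulr_sumr.
  rewrite exchange_big; apply: eq_bigr => r _ /=.
  rewrite scalerA mulr_sumr scaler_suml; apply: eq_bigr => i _.
  by rewrite scaleL scaleR !scalerA; congr (_ *: _); ring.
congr (_ *: _); rewrite scaler_sumr; apply: eq_bigr => q _.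
rewrite (bigD1 q) //= [X in _ + X]big1 ?addr0 => [|r rq]; last by rewrite f0 ?scaler0 // eq_sym.
rewrite f1 (mag_idem QP) !scalerA; congr (_ *: _).
by rewrite mulrCA mulVf ?mulr1 ?N_neq0.
Qed.

Lemma Tm_TT1 s t k : \sum_i Tm Q s (i, k) * Tm Q (i, k) t = Tm Q s t.
Proof.
apply: (Tm_TT (f := fun i => (i, k))) => [q|[l j] [l' j'] qr].
  by under eq_bigr do rewrite hh_sqr; rewrite sumr_const card_ord.
rewrite /hh /=; under eq_bigr do rewrite mulrACA.
rewrite -mulr_suml (sg_col alP); have [ll|_] := eqVneq l l'; last by rewrite mulr0 mul0r scale0r.
rewrite ll (mag_row QP) ?scaler0 //; apply: contra qr => /eqP ->.
by rewrite ll.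
Qed.

Lemma Tm_TT2 s t i : \sum_k Tm Q s (i, k) * Tm Q (i, k) t = Tm Q s t.
Proof.
apply: (Tm_TT (f := fun k => (i, k))) => [q|[l j] [l' j'] qr].
  by under eq_bigr do rewrite hh_sqr; rewrite sumr_const card_ord.
rewrite /hh /=; under eq_bigr do rewrite mulrACA.
rewrite -mulr_sumr (sg_col beP); have [jj|_] := eqVneq j j'; last by rewrite !mulr0 scale0r.
rewrite jj (mag_col QP) ?scaler0 //; apply: contra qr => /eqP ->.
by rewrite jj.
Qed.

End Tmat.

(** * Exchanging the two magic unitaries *)

Section Dual.
Variables (A : cstar_algebra) (n : nat) (al be : 'I_n -> 'I_n -> C).
Hypothesis n_gt0 : (0 < n)%N.
Hypothesis alP : sign_matrix al.
Hypothesis beP : sign_matrix be.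
Local Notation P := ('I_n * 'I_n)%type.
Local Notation N := (n%:R : C).
Variables (p Q : P -> A).
Local Notation hh := (hh al be).
Local Notation T := (Tm al be Q).
Local Notation D := (Tm (fun l i => al i l) (fun j k => be k j) p).

(** Expand N Q_q by [Tm_inv], with its free row taken to be the index of the neighbouring [p]; one
    sign is then squared away. Both sides become the sum over s, t of N^-1 hh_sq hh_tr p_s T_st. *)
Lemma Tm_dual : (forall s t, p s * T s t = T s t * p t) ->
  forall q r, Q q * D q r = D q r * Q r.
Proof.
move=> pT q r; apply: (@scalerI _ _ N); first exact: N_neq0.
transitivity (\sum_s \sum_t (N^-1 * (hh s q * hh t r)) *: (p s * T s t)).
  transitivity (\sum_t (N^-1 * (hh t q * hh t r)) *: ((N *: Q q) * p t)).
    rewrite /Tm scaleR mulr_sumr !scaler_sumr; apply: eq_bigr => t _.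
    by rewrite scaleL scaleR !scalerA; congr (_ *: _); exact: mulrC.
  rewrite exchange_big; apply: eq_bigr => t _ /=.
  rewrite -(Tm_inv n_gt0 alP beP Q t) mulr_suml scaler_sumr; apply: eq_bigr => s _.
  rewrite scaleL scalerA pT; congr (_ *: _).
  transitivity (N^-1 * (hh s q * hh t r) * (hh t q * hh t q)); first ring.
  by rewrite hh_sqr // mulr1.
transitivity (\sum_s (N^-1 * (hh s q * hh s r)) *: (p s * (N *: Q r))); last first.
  rewrite /Tm scaleL mulr_suml !scaler_sumr; apply: eq_bigr => t _.
  by rewrite scaleL scaleR !scalerA; congr (_ *: _); exact: mulrC.
apply: eq_bigr => s _; rewrite -(Tm_invr n_gt0 alP beP Q s) mulr_sumr scaler_sumr.
apply: eq_bigr => t _; rewrite scaleR scalerA; congr (_ *: _).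
transitivity (N^-1 * (hh s q * hh t r) * (hh s r * hh s r)); last ring.
by rewrite hh_sqr // mulr1.
Qed.

End Dual.

(** * Matrix units rotated by the sign matrices *)

Section Rotate.
Variables (A : cstar_algebra) (n : nat) (h : bool -> 'I_n -> 'I_n -> C).
Hypothesis n_gt0 : (0 < n)%N.
Hypothesis hP : forall b, sign_matrix (h b).
Local Notation N := (n%:R : C).
Local Notation L := (bool * 'I_n)%type.
Variable E : L -> L -> A.
Hypothesis EP : matrix_units E.

(** Conjugation by the block-diagonal unitary with blocks h / sqrt N. The two square roots combine
    into N^-1, so none has to be taken. *)
Definition rot (l m : L) : A :=
  N^-1 *: \sum_u \sum_v (h l.1 u l.2 * h m.1 v m.2) *: E (l.1, u) (m.1, v).

Lemma rot_star l m : cs_star (rot l m) = rot m l.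
Proof.
rewrite /rot cs_starZ conjc_inv conjc_nat cs_star_sum exchange_big; congr (_ *: _).
apply: eq_bigr => u _; rewrite cs_star_sum; apply: eq_bigr => v _.
by rewrite cs_starZ (mu_star EP) rmorphM /= !(sg_conj (hP _)) mulrC.
Qed.

Lemma rot_comm l m y : (forall l m, E l m * y = y * E l m) -> rot l m * y = y * rot l m.
Proof.
move=> Ey; rewrite /rot scaleL scaleR mulr_suml mulr_sumr; congr (_ *: _).
apply: eq_bigr => u _; rewrite mulr_suml mulr_sumr; apply: eq_bigr => v _.
by rewrite scaleL scaleR Ey.
Qed.

Lemma rot_inv b b' u v :
  \sum_x \sum_y (h b u x * h b' v y) *: rot (b, x) (b', y) = N *: E (b, u) (b', v).
Proof.
transitivity (N^-1 *: \sum_u' \sum_v' ((\sum_x h b u x * h b u' x) *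
    (\sum_y h b' v y * h b' v' y)) *: E (b, u') (b', v')).
  rewrite /rot; under eq_bigr do under eq_bigr do rewrite scalerA mulrC -scalerA scaler_sumr.
  under eq_bigr do rewrite -scaler_sumr exchange_big /=.
  rewrite -scaler_sumr exchange_big; congr (_ *: _); apply: eq_bigr => u' _ /=.
  under eq_bigr do under eq_bigr do rewrite scaler_sumr.
  under eq_bigr do rewrite exchange_big /=.
  rewrite exchange_big; apply: eq_bigr => v' _ /=.
  rewrite mulr_suml scaler_suml; apply: eq_bigr => x _.
  rewrite mulr_sumr scaler_suml; apply: eq_bigr => y _.
  by rewrite scalerA mulrACA.
rewrite (bigD1 u) //= [X in _ + X]big1 => [|u' uu']; last first.
  by rewrite big1 // => v' _; rewrite (sg_row (hP b)) eq_sym (negPf uu') mulr0 mul0r scale0r.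
rewrite addr0 (bigD1 v) //= [X in _ + X]big1 => [|v' vv']; last first.
  by rewrite (sg_row (hP b')) eq_sym (negPf vv') !mulr0 scale0r.
rewrite addr0 (sg_row (hP b)) (sg_row (hP b')) !eqxx !mulr1 scalerA mulrA mulVf ?mul1r //.
exact: N_neq0.
Qed.

Lemma rot_mul l m m' k : rot l m * rot m' k = if m == m' then rot l k else 0.
Proof.
case: l m m' k => [b x] [b1 y] [b2 y'] [b3 w]; rewrite /rot /=.
transitivity (N^-1 *: (N^-1 *: \sum_u \sum_w' (h b u x * h b3 w' w) *:
   \sum_v \sum_v' (h b1 v y * h b2 v' y') *: (E (b, u) (b1, v) * E (b2, v') (b3, w')))).
  rewrite scaleL scaleR; do 2!congr (_ *: _).
  rewrite mulr_suml; apply: eq_bigr => u _.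
  rewrite mulr_suml; under [RHS]eq_bigr do rewrite scaler_sumr.
  rewrite [RHS]exchange_big; apply: eq_bigr => v _ /=.
  rewrite mulr_sumr; under [RHS]eq_bigr do rewrite scaler_sumr.
  rewrite [RHS]exchange_big; apply: eq_bigr => v' _ /=.
  rewrite mulr_sumr; apply: eq_bigr => w' _.
  by rewrite scaleL scaleR !scalerA; congr (_ *: _); ring.
have [b12|b12] := eqVneq b1 b2; last first.
  rewrite xpair_eqE (negPf b12) /=; do 2!(rewrite big1 ?scaler0 // => ? _).
  do 2!(rewrite big1 ?scaler0 // => ? _).
  by rewrite (mu_mul EP) xpair_eqE (negPf b12) scaler0.
rewrite -b12 xpair_eqE eqxx /=.
transitivity (N^-1 *: (N^-1 *: \sum_u \sum_w' (h b u x * h b3 w' w) *: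
   ((N * (y == y')%:R) *: E (b, u) (b3, w')))).
  do 2!congr (_ *: _); apply: eq_bigr => u _; apply: eq_bigr => w' _; congr (_ *: _).
  rewrite -(sg_col (hP b1)) scaler_suml; apply: eq_bigr => v _.
  rewrite (bigD1 v) //= (mu_mul EP) eqxx big1 ?addr0 // => v' vv'.
  by rewrite (mu_mul EP) xpair_eqE eqxx /= eq_sym (negPf vv') scaler0.
case: (y == y'); last first.
  by do 2!(rewrite big1 ?scaler0 // => ? _); rewrite mulr0 scale0r scaler0.
congr (_ *: _); rewrite scaler_sumr; apply: eq_bigr => u _; rewrite scaler_sumr.
apply: eq_bigr => w' _; rewrite !scalerA mulr1 mulrA; congr (_ *: _).
by rewrite mulrC mulrA mulfV ?mul1r // N_neq0.
Qed.

Lemma rot_sum : \sum_l rot l l = 1.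
Proof.
rewrite -(mu_sum EP) !sum_pairE; apply: eq_bigr => b _.
rewrite /rot -scaler_sumr exchange_big /=.
transitivity (N^-1 *: \sum_u \sum_v (N * (u == v)%:R) *: E (b, u) (b, v)).
  congr (_ *: _); apply: eq_bigr => u _; rewrite exchange_big; apply: eq_bigr => v _ /=.
  by rewrite -scaler_suml (sg_row (hP b)).
rewrite scaler_sumr; apply: eq_bigr => u _.
rewrite (bigD1 u) //= big1 => [|v uv]; last by rewrite eq_sym (negPf uv) mulr0 scale0r.
by rewrite addr0 eqxx mulr1 scalerA mulVf ?scale1r // N_neq0.
Qed.

Lemma rot_units : matrix_units rot.
Proof. by split; [exact: rot_star | exact: rot_mul | exact: rot_sum]. Qed.

End Rotate.

(** * The two cubic matrices and their intertwining relation *)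

Section Intertwine.
Variables (A : cstar_algebra) (n : nat) (al be : 'I_n -> 'I_n -> C).
Hypothesis n_gt0 : (0 < n)%N.
Hypothesis alP : sign_matrix al.
Hypothesis beP : sign_matrix be.
Local Notation P := ('I_n * 'I_n)%type.
Local Notation N := (n%:R : C).
Variables (E : bool * 'I_n -> bool * 'I_n -> A) (p Q : P -> A).
Hypothesis EP : matrix_units E.
Hypothesis pP : magic p.
Hypothesis QP : magic Q.
Hypothesis Ep : forall l m s, E l m * p s = p s * E l m.
Hypothesis EQ : forall l m q, E l m * Q q = Q q * E l m.
Local Notation hh := (hh al be).
Local Notation T := (Tm al be Q).
Local Notation D := (Tm (fun l i => al i l) (fun j k => be k j) p).
Hypothesis pT : forall s t, p s * T s t = T s t * p t.

(** The block [true] is indexed by first coordinates, which belong to [al], and the block [false] by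
    second coordinates, which belong to [be]. *)
Let h (b : bool) := if b then al else be.
Local Notation F := (rot h E).

Let hP b : sign_matrix (h b). Proof. by case: b. Qed.

Definition qrow s : A := xx E p T s.
Definition qcol q : A := xx F Q D q.

Lemma cubic_qrow : cubic qrow.
Proof.
apply: cubic_xx => //.
- exact: Tm_star.
- exact: Tm_row.
- exact: Tm_col.
- by move=> s t k; exact: Tm_TT1.
- by move=> s t i; exact: Tm_TT2.
- by move=> l m s t; apply: Tm_comm => q.
Qed.

Lemma QD q r : Q q * D q r = D q r * Q r.
Proof. exact: Tm_dual. Qed.

Lemma cubic_qcol : cubic qcol.
Proof.
have al'P := sign_matrix_tr alP; have be'P := sign_matrix_tr beP.
apply: cubic_xx => //.
- exact: rot_units.
- exact: Tm_star.
- exact: Tm_row.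
- exact: Tm_col.
- by move=> s t k; exact: Tm_TT1.
- by move=> s t i; exact: Tm_TT2.
- exact: QD.
- by move=> l m q; apply: rot_comm => *; exact: EQ.
- by move=> l m s t; apply: rot_comm => l' m'; apply: Tm_comm => r.
Qed.

(** Summing the rotated units against the signs inside [D] undoes the rotation by [rot_inv]. The
    result is written in the original units, where it can be compared with [qrow]. *)
Lemma qcolE q : qcol q = \sum_s hh s q *:
  (E (false, s.2) (true, s.1) * (Q q * p s) + E (true, s.1) (false, s.2) * (p s * Q q)).
Proof.
under eq_bigr do rewrite scalerDr; rewrite big_split /=; congr (_ + _).
- rewrite /xu -(sum_pairE (fun r : P => F (false, r.2) (true, r.1) * gg Q D q r)).
  transitivity (\sum_r \sum_s (N^-1 * hh s q) *:
      ((hh s r *: F (false, r.2) (true, r.1)) * (Q q * p s))).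
    apply: eq_bigr => r _; rewrite /gg /Tm !scaleR mulr_sumr mulr_sumr scaler_sumr.
    apply: eq_bigr => s _; rewrite !scaleR scaleL !scalerA; congr (_ *: _).
    by rewrite mulrA.
  rewrite exchange_big; apply: eq_bigr => s _ /=; rewrite -scaler_sumr -mulr_suml.
  have -> : \sum_r hh s r *: F (false, r.2) (true, r.1) = N *: E (false, s.2) (true, s.1).
    rewrite -(rot_inv n_gt0 hP E) sum_pairE exchange_big; apply: eq_bigr => x _.
    by apply: eq_bigr => y _; rewrite /hh /= mulrC.
  by rewrite scaleL scalerA mulrAC mulVf ?mul1r // N_neq0.
- rewrite /xv -(sum_pairE (fun r : P => F (true, r.1) (false, r.2) * gg Q D r q)).
  transitivity (\sum_r \sum_s (N^-1 * hh s q) *: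
      ((hh s r *: F (true, r.1) (false, r.2)) * (p s * Q q))).
    apply: eq_bigr => r _; rewrite /gg QD /Tm [X in _ * X]scaleL scaleR.
    rewrite [X in _ * X]mulr_suml mulr_sumr scaler_sumr; apply: eq_bigr => s _.
    rewrite [X in _ *: (_ * X) = _]scaleL scaleR [in RHS]scaleL !scalerA; congr (_ *: _).
    by rewrite -[RHS]mulrA; congr (_ * _); exact: mulrC.
  rewrite exchange_big; apply: eq_bigr => s _ /=; rewrite -scaler_sumr -mulr_suml.
  have -> : \sum_r hh s r *: F (true, r.1) (false, r.2) = N *: E (true, s.1) (false, s.2).
    by rewrite -(rot_inv n_gt0 hP E) sum_pairE.
  by rewrite scaleL scalerA mulrAC mulVf ?mul1r // N_neq0.
Qed.

(** Column orthogonality of [be] singles out the letters with second coordinate [j]. *)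
Lemma Tm_sum_be i j t :
  \sum_k be k j *: T (i, k) t = \sum_l (al i l * hh t (l, j)) *: Q (l, j).
Proof.
rewrite /Tm; under eq_bigr do rewrite scalerA mulrC -scalerA scaler_sumr sum_pairE.
rewrite -scaler_sumr exchange_big /= scaler_sumr; apply: eq_bigr => l _.
have key j' : \sum_k be k j *: ((hh (i, k) (l, j') * hh t (l, j')) *: Q (l, j'))
    = ((al i l * hh t (l, j')) * (N * (j == j')%:R)) *: Q (l, j').
  rewrite -(sg_col beP) mulr_sumr scaler_suml; apply: eq_bigr => k _.
  by rewrite scalerA; congr (_ *: _); rewrite /hh /=; ring.
rewrite exchange_big (bigD1 j) //= key [X in _ + X]big1 => [|j' jj']; last first.
  by rewrite key eq_sym (negPf jj') !mulr0 scale0r.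
rewrite addr0 eqxx mulr1 scalerA; congr (_ *: _).
by rewrite mulrCA mulVf ?mulr1 // N_neq0.
Qed.

(** Compared unit by unit: since p_s T_st = T_st p_t, the coefficient of E (false, t.2) (true, t.1)
    is on both sides the sum over l of al_il hh_t(l,j) Q_(l,j) p_t; the opposite corner has the
    factors reversed. *)
Lemma qrow_qcol i j :
  \sum_k be k j *: qrow (i, k) = \sum_l al i l *: qcol (l, j).
Proof.
under [RHS]eq_bigr do rewrite qcolE scaler_sumr.
rewrite [RHS]exchange_big /=.
transitivity (\sum_t (E (false, t.2) (true, t.1) * ((\sum_k be k j *: T (i, k) t) * p t)
   + E (true, t.1) (false, t.2) * (p t * (\sum_k be k j *: T (i, k) t)))).
  under [RHS]eq_bigr do rewrite mulr_suml mulr_sumr [in X in _ + X]mulr_sumr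
    [in X in _ + X]mulr_sumr -big_split /=.
  rewrite exchange_big; apply: eq_bigr => k _ /=.
  rewrite /qrow /xx /xu /xv -(sum_pairE (fun t : P => E (false, t.2) (true, t.1) * gg p T (i, k) t)).
  rewrite -(sum_pairE (fun t : P => E (true, t.1) (false, t.2) * gg p T t (i, k))).
  rewrite -big_split scaler_sumr; apply: eq_bigr => t _ /=.
  rewrite scalerDr /gg pT (Tm_sym _ _ _ t).
  by move: (T (i, k) t) => X; rewrite !(scaleL, scaleR).
apply: eq_bigr => t _; rewrite Tm_sum_be mulr_suml mulr_sumr [in X in _ + X]mulr_sumr.
rewrite mulr_sumr -big_split; apply: eq_bigr => l _ /=.
by rewrite !scalerDr !(scaleL, scaleR) !scalerA.
Qed.

End Intertwine.

(** * Quantum isomorphism of Hadamard graphs *)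

Section Projections.
Variables (A : cstar_algebra) (n : nat) (M : 'I_n * 'I_n -> 'I_n * 'I_n -> A).
Hypothesis n_gt0 : (0 < n)%N.
Hypothesis M_star : forall s t, cs_star (M s t) = M s t.
Hypothesis M_same1 : forall s t s' t', same1 s s' -> ~~ same1 t t' -> M s t * M s' t' = 0.
Hypothesis M_same2 : forall s t s' t', same2 s s' -> ~~ same2 t t' -> M s t * M s' t' = 0.
Hypothesis M_diff1 : forall s t s' t', diff1 s s' -> ~~ diff1 t t' -> M s t * M s' t' = 0.
Hypothesis M_diff2 : forall s t s' t', diff2 s s' -> ~~ diff2 t t' -> M s t * M s' t' = 0.
Hypothesis M_row : forall s, \sum_t M s t = 1.
Hypothesis M_col : forall t, \sum_s M s t = 1.

(** The diagonal meets each value of either coordinate exactly once, so distinct columns (c,c) and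
    (c',c') differ in both coordinates. This is what the orthogonality of [pM] rests on. *)
Definition pM s : A := \sum_c M s (c, c).

(** F_i = F_i (sum of the G_j) = F_i G_i = (sum of the F_j) G_i = G_i. *)
Lemma partition_unique (I : finType) (F G : I -> A) :
  \sum_i F i = 1 -> \sum_i G i = 1 -> (forall i j, i != j -> F i * G j = 0) -> F =1 G.
Proof.
move=> F1 G1 FG i; transitivity (F i * G i).
  rewrite -[LHS]mulr1 -G1 mulr_sumr (bigD1 i) //= big1 ?addr0 // => j ji.
  by rewrite FG // eq_sym.
by rewrite -[RHS]mul1r -F1 mulr_suml (bigD1 i) //= [X in _ + X]big1 ?addr0 // => j ji; exact: FG.
Qed.

(** For fixed columns, the two families indexed by [i] are partitions of 1. They are mutually
    orthogonal for distinct [i] by [M_diff1], as the columns (c,d) and (c,d') share their first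
    coordinate. *)
Lemma marginal1 i c d d' : \sum_k M (i, k) (c, d) = \sum_k M (i, k) (c, d').
Proof.
apply: (@partition_unique _ (fun i => \sum_k M (i, k) (c, d)) (fun i => \sum_k M (i, k) (c, d'))).
- by rewrite -(sum_pairE (fun s => M s (c, d))).
- by rewrite -(sum_pairE (fun s => M s (c, d'))).
- move=> j j' jj'; rewrite mulr_suml big1 // => k _; rewrite mulr_sumr big1 // => k' _.
  by apply: M_diff1 => //; rewrite /diff1 /= eqxx.
Qed.

Lemma marginal2 k c c' d : \sum_i M (i, k) (c, d) = \sum_i M (i, k) (c', d).
Proof.
apply: (@partition_unique _ (fun k => \sum_i M (i, k) (c, d)) (fun k => \sum_i M (i, k) (c', d))).
- by rewrite exchange_big -(sum_pairE (fun s => M s (c, d))).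
- by rewrite exchange_big -(sum_pairE (fun s => M s (c', d))).
- move=> j j' jj'; rewrite mulr_suml big1 // => i _; rewrite mulr_sumr big1 // => i' _.
  by apply: M_diff2 => //; rewrite /diff2 /= eqxx.
Qed.

Lemma sum_const_inj (x y : A) : \sum_(d < n) x = \sum_(d < n) y -> x = y.
Proof.
rewrite !sumr_const card_ord => H; apply: (@scalerI _ _ (n%:R : C)); first exact: N_neq0.
by rewrite !scaler_nat.
Qed.

Lemma magic_pM : magic pM.
Proof.
split.
- by move=> s; rewrite cs_star_sum; apply: eq_bigr => c _.
- move=> i k k' kk'; rewrite mulr_suml big1 // => c _; rewrite mulr_sumr big1 // => c' _.
  have [->|cc'] := eqVneq c c'; last by apply: M_same1; rewrite /same1 /= ?eqxx.
  by apply: M_diff2; rewrite /diff2 /= ?eqxx.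
- move=> i i' k ii'; rewrite mulr_suml big1 // => c _; rewrite mulr_sumr big1 // => c' _.
  have [->|cc'] := eqVneq c c'; last by apply: M_same2; rewrite /same2 /= ?eqxx.
  by apply: M_diff1; rewrite /diff1 /= ?eqxx.
- move=> i; rewrite exchange_big /=; apply: sum_const_inj.
  (* The marginal at (c,c) equals that at (c,d) for every d, so n copies of the row sum of [pM] make
     up the full sum over the columns of M, which is 1 for each of the n values of k. *)
  transitivity (\sum_d \sum_c \sum_k M (i, k) (c, d)).
    by apply: eq_bigr => d _; apply: eq_bigr => c _; exact: marginal1.
  under eq_bigr do rewrite exchange_big /=; rewrite exchange_big /=.
  by apply: eq_bigr => k _; rewrite exchange_big -(sum_pairE (fun t => M (i, k) t)).
- move=> k; rewrite exchange_big /=; apply: sum_const_inj.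
  transitivity (\sum_c \sum_d \sum_i M (i, k) (c, d)).
    by apply: eq_bigr => c _; apply: eq_bigr => d _; exact: marginal2.
  under eq_bigr do rewrite exchange_big /=; rewrite exchange_big /=.
  by apply: eq_bigr => i _; rewrite -(sum_pairE (fun t => M (i, k) t)).
Qed.

End Projections.

(** * From matching cubic matrices to a quantum isomorphism *)

Section QuantumIso.
Variables (A : cstar_algebra) (n : nat) (H1 H2 : 'M[int]_n) (x y : 'I_n * 'I_n -> A).
Hypothesis xP : cubic x.
Hypothesis yP : cubic y.
Hypothesis H1P : forall i j, H1 i j = 1 \/ H1 i j = -1.
Hypothesis H2P : forall i j, H2 i j = 1 \/ H2 i j = -1.
Local Notation al := (fun i l => (H2 i l)%:~R : C).
Local Notation be := (fun k j => (H1 k j)%:~R : C).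
Hypothesis xy : forall i j, \sum_k be k j *: x (i, k) = \sum_l al i l *: y (l, j).
Hypothesis yx : forall l k, \sum_j be k j *: y (l, j) = \sum_i al i l *: x (i, k).

Definition sg (s t : bool) : C := if s == t then 1 else -1.
Definition qent (z : A) s t : A := 2^-1 *: (z * z + sg s t *: z).

Lemma cubic_cube (z : 'I_n * 'I_n -> A) s : cubic z -> z s * z s * z s = z s.
Proof.
case: s => i k zP; rewrite -[RHS]mulr1 -(cub_rsum zP i) mulr_sumr (bigD1 k) //=.
rewrite big1 ?addr0 ?mulrA // => k' kk'.
by rewrite mulrA (cub_row zP) ?mul0r // eq_sym.
Qed.

Lemma qent_proj (z : 'I_n * 'I_n -> A) q s t : cubic z ->
  cs_star (qent (z q) s t) = qent (z q) s t /\ qent (z q) s t * qent (z q) s t = qent (z q) s t.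
Proof.
move=> zP; have z3 := cubic_cube q zP; have sgsg : sg s t * sg s t = 1.
  by rewrite /sg; case: ifP; rewrite ?mulr1 // mulrNN mulr1.
have sgJ : conjc (sg s t) = sg s t.
  by rewrite /sg; case: ifP; rewrite ?rmorphN ?rmorph1.
split; rewrite /qent.
  by rewrite cs_starZ conjc_inv conjc_nat cs_starD cs_starM cs_starZ (cub_star zP) sgJ.
rewrite scaleL scaleR mulrDl !mulrDr !scaleL !scaleR.
rewrite [sg s t *: (sg s t *: _)]scalerA sgsg scale1r.
rewrite !mulrA !z3 [_ + z q * z q]addrC addrACA -!mulr2n -mulrnDl.
rewrite -[(_ + _ *: _) *+ 2]scaler_nat !scalerA; congr (_ *: _).
by rewrite -mulrA mulVf ?mulr1 // pnatr_eq0.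
Qed.

Lemma qent_sumr (z : A) s : \sum_t qent z s t = z * z.
Proof.
rewrite big_bool /= /qent -scalerDr addrACA -scalerDl.
have -> : sg s true + sg s false = 0 by rewrite /sg; case: s; rewrite /= ?subrr ?addNr.
by rewrite scale0r addr0 -mulr2n -[(z * z) *+ 2]scaler_nat scalerA mulVf ?scale1r // pnatr_eq0.
Qed.

Lemma qent_suml (z : A) t : \sum_s qent z s t = z * z.
Proof.
by rewrite -(qent_sumr z t); apply: eq_bigr => s _; rewrite /qent /sg eq_sym.
Qed.

(** For given [t] and [h] only one sign s' is adjacent, the product of the two; multiplication by
    the adjacency entry therefore multiplies the odd part of [qent] by [h]. *)
Lemma qent_adjr (z : A) (h : int) s t : h = 1 \/ h = -1 ->
  \sum_s' qent z s s' * ((((s' == t) == (h == 1)) : nat)%:R : A)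
  = 2^-1 *: (z * z + sg s t *: (h%:~R *: z)).
Proof.
by case=> ->; rewrite big_bool; case: s; case: t; rewrite /= /qent /sg /=
  ?mulr1 ?mulr0 ?addr0 ?add0r ?scale1r ?scaleN1r ?opprK.
Qed.

Lemma qent_adjl (z : A) (h : int) s t : h = 1 \/ h = -1 ->
  \sum_t' ((((s == t') == (h == 1)) : nat)%:R : A) * qent z t' t
  = 2^-1 *: (z * z + sg s t *: (h%:~R *: z)).
Proof.
by case=> ->; rewrite big_bool; case: s; case: t; rewrite /= /qent /sg /=
  ?mul1r ?mul0r ?addr0 ?add0r ?scale1r ?scaleN1r ?opprK.
Qed.

(** The first argument is a vertex of the graph of [H2] and the second of the graph of [H1]: in x
    (i, k), i is a row of [H2] and k a row of [H1], and likewise for columns in y (l, j). *)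
Definition qmat (v w : hvertex n) : A :=
  match v, w with
  | (true, (i, s)), (true, (k, t)) => qent (x (i, k)) s t
  | (false, (l, s)), (false, (j, t)) => qent (y (l, j)) s t
  | _, _ => 0
  end.

Lemma sum_hvertex (F : hvertex n -> A) :
  \sum_v F v = \sum_i \sum_s F (true, (i, s)) + \sum_j \sum_s F (false, (j, s)).
Proof. by rewrite sum_pairE big_bool !sum_pairE. Qed.

Lemma sum_half (z : 'I_n -> A) (c : C) (h : 'I_n -> C) :
  \sum_k z k * z k = 1 ->
  \sum_k 2^-1 *: (z k * z k + c *: (h k *: z k)) = 2^-1 *: (1 + c *: \sum_k h k *: z k).
Proof. by move=> z1; rewrite -scaler_sumr big_split /= z1 -scaler_sumr. Qed.

Lemma quantum_isomorphic_of_cubic :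
  quantum_isomorphic (hadamard_adj H1) (hadamard_adj H2).
Proof.
exists A, qmat; split.
- move=> [[] [i s]] [[] [k t]] /=; try exact: qent_proj.
    by split; [rewrite -(scale0r (0 : A)) cs_starZ conjc0 !scale0r | rewrite mulr0].
  by split; [rewrite -(scale0r (0 : A)) cs_starZ conjc0 !scale0r | rewrite mulr0].
- move=> [[] [i s]]; rewrite sum_hvertex /=.
    rewrite [X in _ + X]big1 ?addr0 => [|j _]; last by rewrite big1.
    by under eq_bigr do rewrite qent_sumr; exact: cub_rsum.
  rewrite [X in X + _]big1 ?add0r => [|j _]; last by rewrite big1.
  by under eq_bigr do rewrite qent_sumr; exact: cub_rsum.
- move=> [[] [i s]]; rewrite sum_hvertex /=.
    rewrite [X in _ + X]big1 ?addr0 => [|j _]; last by rewrite big1.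
    by under eq_bigr do rewrite qent_suml; exact: cub_csum.
  rewrite [X in X + _]big1 ?add0r => [|j _]; last by rewrite big1.
  by under eq_bigr do rewrite qent_suml; exact: cub_csum.
- move=> [[] [i s]] [[] [k t]]; rewrite !sum_hvertex /=.
  + rewrite !big1 // => j _; rewrite big1 // => r _; by rewrite ?mulr0 ?mul0r.
  + rewrite [X in _ + X]big1 ?addr0 => [|j _]; last by rewrite big1 // => r _; rewrite mul0r.
    rewrite [X in _ = X + _]big1 ?add0r => [|j _]; last by rewrite big1 // => r _; rewrite mul0r.
    under eq_bigr do rewrite qent_adjr //.
    under [RHS]eq_bigr do rewrite qent_adjl //.
    rewrite (sum_half _ _ (cub_rsum xP i)) (sum_half (z := fun l => y (l, k)) _ _ (cub_csum yP k)).
    by rewrite xy.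
  + rewrite [X in X + _ = _]big1 ?add0r => [|j _]; last by rewrite big1 // => r _; rewrite mul0r.
    rewrite [X in _ = _ + X]big1 ?addr0 => [|j _]; last by rewrite big1 // => r _; rewrite mul0r.
    under eq_bigr do under eq_bigr do rewrite (eq_sym t).
    under [RHS]eq_bigr do under eq_bigr do rewrite (eq_sym _ s).
    under eq_bigr do rewrite qent_adjr //.
    under [RHS]eq_bigr do rewrite qent_adjl //.
    rewrite (sum_half _ _ (cub_rsum yP i)) (sum_half (z := fun l => x (l, k)) _ _ (cub_csum xP k)).
    by rewrite yx.
  + rewrite !big1 // => j _; rewrite big1 // => r _; by rewrite ?mulr0 ?mul0r.
Qed.

End QuantumIso.

(** * Hadamard matrices as real and complex sign matrices *)

Section Hadamard.
Variables (n : nat) (H : 'M[int]_n).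
Hypothesis n_gt0 : (0 < n)%N.
Hypothesis HP : is_hadamard H.

Definition realH (i j : 'I_n) : R := (H i j)%:~R.

Lemma realH_sqr i j : realH i j * realH i j = 1.
Proof. by rewrite /realH -intrM; have [->|->] := HP.1 i j. Qed.

Lemma realH_row i i' : \sum_l realH i l * realH i' l = n%:R * (i == i')%:R.
Proof.
have := congr1 (fun M : 'M[int]_n => (M i i')%:~R : R) HP.2; rewrite !mxE.
under eq_bigr do rewrite mxE; rewrite rmorph_sum /=.
under eq_bigr do rewrite intrM; move=> ->.
by rewrite rmorphMn rmorph_nat mulr_natr.
Qed.

(** The definition gives orthogonality of rows only; over a field, a one-sided inverse of a square
    matrix is two-sided. *)
Lemma realH_col l l' : \sum_i realH i l * realH i l' = n%:R * (l == l')%:R.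
Proof.
pose M : 'M[R]_n := \matrix_(i, j) realH i j.
have n0 : (n%:R : R) != 0 by rewrite pnatr_eq0 -lt0n.
have MM : (n%:R^-1 *: M) *m M^T = 1%:M.
  apply/matrixP => i i'; rewrite -scalemxAl !mxE.
  under eq_bigr do rewrite !mxE.
  by rewrite realH_row mulrA mulVf // mul1r.
have := congr1 (fun X : 'M[R]_n => n%:R * X l l') (mulmx1C MM).
rewrite -scalemxAr !mxE mulrA mulfV // mul1r => <-.
by apply: eq_bigr => i _; rewrite !mxE.
Qed.

Lemma sign_matrix_realH : sign_matrix (fun i j => (realH i j)%:C).
Proof.
split=> *.
- exact: conjc_real.
- by rewrite -rmorphM /= realH_sqr.
- under eq_bigr do rewrite -rmorphM; rewrite -rmorph_sum /= realH_row.
  by rewrite rmorphM /= !rmorph_nat.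
- under eq_bigr do rewrite -rmorphM; rewrite -rmorph_sum /= realH_col.
  by rewrite rmorphM /= !rmorph_nat.
Qed.

End Hadamard.

Section Transfer.
Variables (n : nat) (al be : 'I_n -> 'I_n -> C) (A : cstar_algebra).
Hypothesis n_gt0 : (0 < n)%N.
Hypothesis alP : sign_matrix al.
Hypothesis beP : sign_matrix be.
Variables (x y : 'I_n * 'I_n -> A).
Hypothesis xy : forall i j, \sum_k be k j *: x (i, k) = \sum_l al i l *: y (l, j).

(** In matrix form x H1 = H2 y yields N y H1^T = H2^T H2 y H1^T = H2^T x H1 H1^T = N H2^T x. This is
    the relation needed at the edges read from a column vertex to a row vertex. *)
Lemma intertwine_tr l k : \sum_j be k j *: y (l, j) = \sum_i al i l *: x (i, k).
Proof.
apply: (@scalerI _ _ (n%:R : C)); first exact: N_neq0.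
transitivity (\sum_j \sum_i \sum_l' (be k j * (al i l * al i l')) *: y (l', j)).
  rewrite scaler_sumr; apply: eq_bigr => j _; rewrite exchange_big (bigD1 l) //=.
  rewrite [X in _ + X]big1 => [|l' ll']; last first.
    by rewrite -scaler_suml -mulr_sumr (sg_col alP) eq_sym (negPf ll') !mulr0 scale0r.
  by rewrite addr0 -scaler_suml -mulr_sumr (sg_col alP) eqxx mulr1 scalerA mulrC.
transitivity (\sum_j \sum_i \sum_k' (be k j * be k' j * al i l) *: x (i, k')).
  apply: eq_bigr => j _; apply: eq_bigr => i _.
  transitivity ((be k j * al i l) *: \sum_l' al i l' *: y (l', j)).
    by rewrite scaler_sumr; apply: eq_bigr => l' _; rewrite scalerA mulrA.
  rewrite -xy scaler_sumr; apply: eq_bigr => k' _; rewrite scalerA.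
  by congr (_ *: _); ring.
rewrite exchange_big scaler_sumr; apply: eq_bigr => i _ /=.
rewrite exchange_big (bigD1 k) //= [X in _ + X]big1 => [|k' kk']; last first.
  by rewrite -scaler_suml -mulr_suml (sg_row beP) eq_sym (negPf kk') mulr0 mul0r scale0r.
by rewrite addr0 -scaler_suml -mulr_suml (sg_row beP) eqxx mulr1 scalerA.
Qed.

End Transfer.

Lemma zz_complex n (a b : 'I_n -> 'I_n -> R) s c p q :
  (zz a b s c p q)%:C = (n%:R * n%:R)^-1 *
  (hh (fun i l => (a i l)%:C) (fun i l => (b i l)%:C) s p *
   hh (fun i l => (a i l)%:C) (fun i l => (b i l)%:C) c p *
   (hh (fun i l => (a i l)%:C) (fun i l => (b i l)%:C) s q *
    hh (fun i l => (a i l)%:C) (fun i l => (b i l)%:C) c q)).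
Proof.
rewrite /zz /zeta /hh !rmorphM /= !fmorphV /= !rmorph_nat invfM.
ring.
Qed.

Theorem mainTheorem3 (n : nat) (H1 H2 : 'M[int]_n) :
  (1 <= n)%N -> is_hadamard H1 -> is_hadamard H2 ->
  quantum_isomorphic (hadamard_adj H1) (hadamard_adj H2).
Proof.
move=> n_gt0 H1P H2P.
(* The first coordinates, those of the target graph, go with [H2], so that [al] and [be] take the
   places fixed by x H1 = H2 y. *)
pose a := realH H2; pose b := realH H1.
have a_sqr := realH_sqr H2P; have a_row := realH_row H2P; have a_col := realH_col n_gt0 H2P.
have b_sqr := realH_sqr H1P; have b_row := realH_row H1P; have b_col := realH_col n_gt0 H1P.
have alP := sign_matrix_realH n_gt0 H2P; have beP := sign_matrix_realH n_gt0 H1P.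
pose al i l := (a i l)%:C; pose be i l := (b i l)%:C.
have [kap kapI] := exists_invariant_state a_sqr a_row a_col b_sqr b_row b_col n_gt0.
pose lam0 : bool * 'I_n := (true, Ordinal n_gt0).
pose M := elM a_sqr a_row a_col b_sqr b_row b_col n_gt0 kapI lam0.
pose Q := elQ kapI lam0.
pose E := elE kapI lam0.
have EP : matrix_units E by split; [exact: elE_star | exact: elE_mul | exact: elE_sum].
have QP : magic Q.
  split.
  - exact: elQ_star.
  - by move=> i k k' kk'; apply: elQ_clash1; rewrite /clash1 /= eqxx.
  - by move=> i i' k ii'; apply: elQ_clash2; rewrite /clash2 /= eqxx andbT.
  - exact: elQ_fib1.
  - exact: elQ_fib2.
have pP : magic (pM M).
  apply: magic_pM => //.
  - exact: elM_star.
  - by move=> s t s' t'; apply: elMM0 => *; apply: zz_same1.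
  - by move=> s t s' t'; apply: elMM0 => *; apply: zz_same2.
  - by move=> s t s' t'; apply: elMM0 => *; apply: zz_diff1.
  - by move=> s t s' t'; apply: elMM0 => *; apply: zz_diff2.
  - exact: elM_row.
  - exact: elM_col.
(* Pushing M_st through T_ss' pairs the vector (HH_sp HH_s'p)_p with the projections onto (HH_sp
   HH_cp)_p; orthogonality, computed in [key], leaves only the state c = s'. *)
have MT s s' t : M s t * Tm al be Q s s' = Tm al be Q s s' * M s' t.
  rewrite /Tm scaleR scaleL; congr (_ *: _); rewrite mulr_sumr mulr_suml.
  transitivity (\sum_c \sum_q (\sum_p hh al be s p * hh al be s' p * (zz a b s c p q)%:C)
     *: (Q q * M c t)).
    under eq_bigr do rewrite scaleR elMQ scaler_sumr.
    rewrite exchange_big; apply: eq_bigr => c _ /=.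
    under eq_bigr do rewrite scaler_sumr.
    rewrite exchange_big; apply: eq_bigr => q _ /=.
    by rewrite scaler_suml; apply: eq_bigr => p _; rewrite scalerA.
  have key c q : \sum_p hh al be s p * hh al be s' p * (zz a b s c p q)%:C
      = (s' == c)%:R * (hh al be s q * hh al be c q).
    transitivity ((n%:R * n%:R)^-1 * (hh al be s q * hh al be c q) *
        \sum_p hh al be s' p * hh al be c p).
      rewrite mulr_sumr; apply: eq_bigr => p _; rewrite zz_complex -/al -/be.
      transitivity ((n%:R * n%:R)^-1 * (hh al be s q * hh al be c q) *
        (hh al be s' p * hh al be c p) * (hh al be s p * hh al be s p)); first by ring.
      by rewrite hh_sqr // mulr1.
    by rewrite hh_row // mulrACA mulVf ?mulf_neq0 ?N_neq0 // mul1r mulrC.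
  rewrite (bigD1 s') //= [X in _ + X]big1 => [|c cs].
    by rewrite addr0; apply: eq_bigr => q _; rewrite key eqxx mul1r; exact: scalerAl.
  by rewrite big1 // => q _; rewrite key eq_sym (negPf cs) mul0r scale0r.
(* The exchange leaves the column index of M untouched, so it survives the sum over the columns
   (c,c). *)
have pT s t : pM M s * Tm al be Q s t = Tm al be Q s t * pM M t.
  by rewrite mulr_suml mulr_sumr; apply: eq_bigr => c _; exact: MT.
have Ep l m s : E l m * pM M s = pM M s * E l m.
  by rewrite mulr_suml mulr_sumr; apply: eq_bigr => c _; exact: elEM.
have EQ l m q : E l m * Q q = Q q * E l m by exact: elEQ.
pose x := qrow al be E (pM M) Q; pose y := qcol al be E (pM M) Q.
have xP : cubic x by apply: cubic_qrow.
have yP : cubic y by apply: cubic_qcol.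
have xy i j : \sum_k be k j *: x (i, k) = \sum_l al i l *: y (l, j) by apply: qrow_qcol.
have yx l k : \sum_j be k j *: y (l, j) = \sum_i al i l *: x (i, k) by apply: intertwine_tr.
have alE i l : (H2 i l)%:~R = al i l by rewrite /al /a /realH rmorph_int.
have beE i l : (H1 i l)%:~R = be i l by rewrite /be /b /realH rmorph_int.
apply: (quantum_isomorphic_of_cubic xP yP H1P.1 H2P.1) => i j.
- by under eq_bigr do rewrite beE; under [RHS]eq_bigr do rewrite alE.
- by under eq_bigr do rewrite beE; under [RHS]eq_bigr do rewrite alE.
Qed.
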